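(* In either the discrete-time or the continuous-time setting of the context, with maximum controlled invariant set $X_I$, for each $k\ge k_0$ let $(v_k,w_k)\in\mathbb{R}_{2k}[x]\times\mathbb{R}_{2k}[x]$ be (the $(v,w)$-component of) an optimal solution of the dual sum-of-squares problem of order $k$ defined in the context, and let $X_{I,k}:=\{x\in X: v_k(x)\ge0\}$. Then $X_I\subset X_{I,k}$ for every $k\ge k_0$, $$\lim_{k\to\infty}\lambda(X_{I,k}\setminus X_I)=0\quad\text{and}\quad \lambda\Big(\bigcap_{k\ge k_0}X_{I,k}\setminus X_I\Big)=0.$$
   Context: Data. $f:\mathbb{R}^n\times\mathbb{R}^m\to\mathbb{R}^n$ has polynomial entries; $X=\{x\in\mathbb{R}^n: g_{X_i}(x)\ge 0,\ i=1,\dots,n_X\}$ and $U=\{u\in\mathbb{R}^m: g_{U_i}(u)\ge0,\ i=1,\dots,n_U\}$ are compact with polynomial $g_{X_i},g_{U_i}$. Standing assumption: one of the $g_{X_i}$ equals $R_X^2-\|x\|_2^2$ and one of the $g_{U_i}$ equals $R_U^2-\|u\|_2^2$, with $R_X,R_U$ sufficiently large constants. $\lambda$ is the $n$-dimensional Lebesgue measure. Two settings, treated in parallel: - discrete time, discount $\alpha\in(0,1)$: $(Lv)(x,u)=v(x)-\alpha v(f(x,u))$; the maximum controlled invariant set $X_I$ is the set of all $x_0\in X$ for which there exist $\{x_t\}_{t\ge1}$, $\{u_t\}_{t\ge0}$ with $x_{t+1}=f(x_t,u_t)$, $u_t\in U$, $x_t\in X$ for all $t\in\{0,1,\dots\}$;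 - continuous time, discount $\beta>0$: $(Lv)(x,u)=\beta v(x)-\mathrm{grad}\,v(x)\cdot f(x,u)$; $X_I$ is the set of all $x_0\in X$ for which there exists a (locally) absolutely continuous $x:[0,\infty)\to\mathbb{R}^n$ with $x(0)=x_0$, $\dot x(t)\in\mathrm{conv}\{f(x(t),u):u\in U\}$ for almost every $t\ge0$, and $x(t)\in X$ for all $t\ge0$. $\mathbb{R}_r[\cdot]$ denotes real polynomials of total degree at most $r$. Let $d_{X_i}=\lceil\deg g_{X_i}/2\rceil$, $d_{U_i}=\lceil\deg g_{U_i}/2\rceil$, and let $k_0\ge1$ be the maximum of all these integers. Dual sum-of-squares problem of order $k\ge k_0$: minimize $\int_X w\,d\lambda$ over $v,w\in\mathbb{R}_{2k}[x]$ such that, as polynomial identities, $$Lv=q_0+\sum_{i=1}^{n_X}q_i\,g_{X_i}+\sum_{i=1}^{n_U}r_i\,g_{U_i},\qquad w-v-1=p_0+\sum_{i=1}^{n_X}p_i\,g_{X_i},\qquad w=s_0+\sum_{i=1}^{n_X}s_i\,g_{X_i},$$ where $q_0,q_i,r_i$ are sums of squares of polynomials in $(x,u)$ and $p_0,p_i,s_0,s_i$ sums of squares of polynomials in $x$; the squared polynomials have degree at most $k$ for index $0$, at most $k-d_{X_i}$ for $q_i,p_i,s_i$, and at most $k-d_{U_i}$ for $r_i$. Existence of optimal solutions for each $k$ is taken as given. *)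

(* Defs.v *)
From HB Require Import structures.
From mathcomp Require Import all_boot all_order all_algebra.
From mathcomp Require mpoly.
(* The notations of mpoly and of MathComp-Analysis cannot be loaded together. *)
Import -(notations) mpoly.
From mathcomp Require Import all_classical all_reals all_analysis.

Set Implicit Arguments.
Unset Strict Implicit.
Unset Printing Implicit Defensive.

Import Order.TTheory GRing.Theory Num.Theory.
Import numFieldNormedType.Exports.

Local Open Scope classical_set_scope.
Local Open Scope ring_scope.

Notation "{ 'mpoly' R [ n ] }" := (mpoly n R)
  (at level 0, R, n at level 2, format "{ 'mpoly'  R [ n ] }") : type_scope.

Definition rV_display : measure_display. Proof. exact: default_measure_display. Qed.

Section measurable_rV.
Context {R : realType} (n : nat).

Definition rV_coord (i : 'I_n) (x : 'rV[R]_n) : measurableTypeR R := x ord0 i.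

Let rV_set0 : g_sigma_preimage rV_coord set0.
Proof. exact: sigma_algebra0. Qed.

Let rV_setC A : g_sigma_preimage rV_coord A -> g_sigma_preimage rV_coord (~` A).
Proof. exact: sigma_algebraC. Qed.

Let rV_bigcup (F : (set 'rV[R]_n)^nat) :
  (forall i, g_sigma_preimage rV_coord (F i)) ->
  g_sigma_preimage rV_coord (\bigcup_i (F i)).
Proof. exact: sigma_algebra_bigcup. Qed.

(* The sigma-algebra generated by the coordinates, i.e. the Borel one. *)
HB.instance Definition _ := @isMeasurable.Build rV_display
  'rV[R]_n (g_sigma_preimage rV_coord) rV_set0 rV_setC rV_bigcup.

Lemma measurable_rV_coord (i : 'I_n) : measurable_fun [set: 'rV[R]_n] (rV_coord i).
Proof.
move=> _ Y mY; rewrite setTI; apply: sub_sigma_algebra => /=.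
rewrite -bigcup_seq/=; exists i => /=; first by rewrite mem_index_enum.
by exists Y => //; rewrite setTI.
Qed.

Lemma measurable_fun_rVP d (T : measurableType d) (f : T -> 'rV[R]_n) :
  (forall i, measurable_fun [set: T] (rV_coord i \o f)) ->
  measurable_fun [set: T] f.
Proof.
move=> mf _ A mA.
have : (g_sigma_preimage (fun i => rV_coord i \o f)) (setT `&` f @^-1` A).
  by rewrite g_sigma_preimage_comp; exists A.
apply: smallest_sub; first exact: sigma_algebra_measurable.
rewrite -bigcup_seq; apply: bigcup_sub => i _ B [C mC <-].
exact: mf.
Qed.

End measurable_rV.

Section lebesgue_rV.
Context {R : realType}.

Definition rV_cons n (p : measurableTypeR R * 'rV[R]_n) : 'rV[R]_n.+1 :=
  row_mx (const_mx p.1 : 'rV[R]_1) p.2.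

Definition rV_uncons n (x : 'rV[R]_n.+1) : measurableTypeR R * 'rV[R]_n :=
  (x ord0 ord0, \row_i x ord0 (lift ord0 i)).

Lemma rV_cons0 n p : @rV_cons n p ord0 ord0 = p.1.
Proof.
rewrite /rV_cons (_ : ord0 = lshift n (ord0 : 'I_1)); last exact/val_inj.
by rewrite (@row_mxEl _ 1 1 n) mxE.
Qed.

Lemma rV_consS n p i : @rV_cons n p ord0 (lift ord0 i) = p.2 ord0 i.
Proof.
rewrite /rV_cons (_ : lift ord0 i = rshift 1 i); last exact/val_inj.
by rewrite (@row_mxEr _ 1 1 n).
Qed.

Lemma rV_consK n : cancel (@rV_cons n) (@rV_uncons n).
Proof.
move=> p; rewrite /rV_uncons rV_cons0; case: p => a x /=; congr (_, _).
by apply/rowP => i; rewrite mxE rV_consS.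
Qed.

Lemma measurable_rV_cons n : measurable_fun [set: _] (@rV_cons n).
Proof.
apply: measurable_fun_rVP => i; case: (unliftP ord0 i) => [j|] ->.
  rewrite (_ : _ \o _ = rV_coord j \o snd).
    by apply: measurableT_comp => //; exact: measurable_rV_coord.
  by apply/funext => p /=; rewrite /rV_coord rV_consS.
rewrite (_ : _ \o _ = fst) //.
by apply/funext => p /=; rewrite /rV_coord rV_cons0.
Qed.

Lemma measurable_rV_uncons n : measurable_fun [set: _] (@rV_uncons n).
Proof.
apply/measurable_fun_pairP; split.
  exact: (measurable_rV_coord (ord0 : 'I_n.+1)).
apply: measurable_fun_rVP => i.
rewrite (_ : _ \o _ = @rV_coord R n.+1 (lift ord0 i)).
  exact: measurable_rV_coord.
by apply/funext => x; rewrite /rV_coord /= mxE.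
Qed.

Section step.
Variables (n : nat) (mu : {sigma_finite_measure set 'rV[R]_n -> \bar R}).

Definition lebesgue_rV_step : set 'rV[R]_n.+1 -> \bar R :=
  pushforward (lebesgue_measure \x mu)%E (@rV_cons n).

Let step0 : lebesgue_rV_step set0 = 0%E.
Proof. by rewrite /lebesgue_rV_step /pushforward preimage_set0 measure0. Qed.

Let step_ge0 A : (0 <= lebesgue_rV_step A)%E.
Proof. by rewrite /lebesgue_rV_step /pushforward measure_ge0. Qed.

Let step_sigma_additive : semi_sigma_additive lebesgue_rV_step.
Proof.
pose m := [the measure _ _ of (lebesgue_measure \x mu)%E].
have mcons := @measurable_rV_cons n.
move=> F mF tF mUF; rewrite /lebesgue_rV_step /pushforward preimage_bigcup.
apply: (@measure_semi_sigma_additive _ _ _ m).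
- by move=> k; rewrite -[X in measurable X]setTI; exact: mcons.
- apply/trivIsetP => /= i j _ _ ij; rewrite -preimage_setI.
  by move/trivIsetP : tF => /(_ _ _ _ _ ij) ->//; rewrite preimage_set0.
- by rewrite -preimage_bigcup -[X in measurable X]setTI; exact: mcons.
Qed.

HB.instance Definition _ := isMeasure.Build _ _ _ lebesgue_rV_step
  step0 step_ge0 step_sigma_additive.

Let step_sigma_finite : sigma_finite setT lebesgue_rV_step.
Proof.
have /sigma_finiteP[F [UF ndF mF]] :=
  sigma_finiteT (@lebesgue_measure R : {sigma_finite_measure set _ -> \bar R}).
have /sigma_finiteP[G [UG ndG mG]] := sigma_finiteT mu.
exists (fun k => @rV_uncons n @^-1` (F k `*` G k)).
  rewrite -preimage_bigcup -[LHS](preimage_setT (@rV_uncons n)); congr (_ @^-1` _).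
  rewrite -setXTT UF UG; apply/seteqP; split=> [[x y]|[x y] [k _ []]] /=.
    move=> [[i _ Fix] [j _ Gjy]]; exists (maxn i j) => //; split.
      by move: x Fix; exact/subsetPset/ndF/leq_maxl.
    by move: y Gjy; exact/subsetPset/ndG/leq_maxr.
  by split; exists k.
move=> k; have [mFk Fk] := mF k; have [mGk Gk] := mG k; split.
  rewrite -[X in measurable X]setTI.
  by apply: measurable_rV_uncons => //; exact: measurableX.
rewrite /lebesgue_rV_step /pushforward -comp_preimage (_ : _ \o _ = id).
  by rewrite preimage_id product_measure1E// lte_mul_pinfty// ge0_fin_numE.
by apply/funext => p; exact: rV_consK.
Qed.

HB.instance Definition _ := Measure_isSigmaFinite.Build _ _ _ lebesgue_rV_step
  step_sigma_finite.

End step.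

Fixpoint lebesgue_rV_rec n : {sigma_finite_measure set 'rV[R]_n -> \bar R} :=
  match n with
  | 0 => dirac (0 : 'rV[R]_0)
  | n'.+1 => lebesgue_rV_step (lebesgue_rV_rec n')
  end.

(* lebesgue_rV_box below fixes its values on boxes, which determine it. *)
Definition lebesgue_rV n : set 'rV[R]_n -> \bar R := lebesgue_rV_rec n.

HB.instance Definition _ n := SigmaFiniteMeasure.on (@lebesgue_rV n).

Lemma lebesgue_rV_box n (a b : 'rV[R]_n) : (forall i, a ord0 i <= b ord0 i) ->
  lebesgue_rV [set x | forall i, a ord0 i <= x ord0 i <= b ord0 i] =
  (\prod_(i < n) (b ord0 i - a ord0 i))%:E.
Proof.
rewrite /lebesgue_rV; elim: n a b => [|n IHn] a b ab.
  by rewrite big_ord0 /= diracE mem_set// => -[].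
rewrite /= /lebesgue_rV_step /pushforward.
pose a' := (rV_uncons a).2; pose b' := (rV_uncons b).2.
rewrite (_ : _ @^-1` _ = `[a ord0 ord0, b ord0 ord0] `*`
    [set x : 'rV_n | forall i, a' ord0 i <= x ord0 i <= b' ord0 i]); last first.
  apply/seteqP; split=> [[t x] /= h|[t x] /= [ht h] i].
    split; first by have := h ord0; rewrite rV_cons0 in_itv.
    by move=> i; have := h (lift ord0 i); rewrite rV_consS !mxE.
  case: (unliftP ord0 i) => [j|] ->; last by move: ht; rewrite rV_cons0 in_itv.
  by have := h j; rewrite rV_consS !mxE.
rewrite product_measure1E//; last first.
  rewrite (_ : mkset _ = \bigcap_(i in [set: 'I_n])
      (rV_coord i @^-1` `[a' ord0 i, b' ord0 i])).
    apply: fin_bigcap_measurable => // i _.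
    by rewrite -[X in measurable X]setTI; exact: measurable_rV_coord.
  by apply/seteqP; split=> x /= h i; have := h i; rewrite /= in_itv; auto.
rewrite IHn; last by move=> i; rewrite !mxE.
rewrite [X in (X * _)%E](_ : _ = (b ord0 ord0 - a ord0 ord0)%:E); last first.
  rewrite [LHS](lebesgue_measure_itv `[a ord0 ord0, b ord0 ord0])/= lte_fin.
  have := ab ord0; rewrite le_eqVlt => /predU1P[->|->]; last by [].
  by rewrite ltxx subrr.
rewrite big_ord_recl EFinM; congr (_ * _)%E; congr EFin.
by apply: eq_bigr => i _; rewrite !mxE.
Qed.

End lebesgue_rV.

Section polynomials.
Context {R : realType}.

Definition peval n (p : {mpoly R[n]}) (x : 'rV[R]_n) : R := meval (x ord0) p.

(* Total degree, 0 for the zero polynomial; mmeasure mdeg p is 1 + deg p. *)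
Definition mpdeg n (p : {mpoly R[n]}) : nat := (mmeasure mdeg p).-1.

Definition half_deg n (p : {mpoly R[n]}) : nat := uphalf (mpdeg p).

Definition ball_poly n (r : R) : {mpoly R[n]} :=
  mpolyC n (r ^+ 2) - \sum_(j < n) mpolyX R (mnm1 j) ^+ 2.

Definition semialg n N (g : 'I_N -> {mpoly R[n]}) : set 'rV[R]_n :=
  [set x | forall i, 0 <= peval (g i) x].

(* The bound d is on the squared polynomials, not on p. *)
Definition is_sos n (d : nat) (p : {mpoly R[n]}) : Prop :=
  exists2 s : seq {mpoly R[n]},
    all (fun h => mpdeg h <= d)%N s & p = \sum_(h <- s) h ^+ 2.

(* In {mpoly R[n + m]}, the first n variables are x and the last m are u. *)
Definition lift_x n m (p : {mpoly R[n]}) : {mpoly R[n + m]} :=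
  comp_mpoly [tuple mpolyX R (mnm1 (lshift m i)) | i < n] p.

Definition lift_u n m (p : {mpoly R[m]}) : {mpoly R[n + m]} :=
  comp_mpoly [tuple mpolyX R (mnm1 (rshift n i)) | i < m] p.

End polynomials.

Section dynamics.
Context {R : realType} {n m : nat}.
Variables (f : 'I_n -> {mpoly R[n + m]}).
Variables (X : set 'rV[R]_n) (U : set 'rV[R]_m).

Definition vfield (x : 'rV[R]_n) (u : 'rV[R]_m) : 'rV[R]_n :=
  \row_i peval (f i) (row_mx x u).

Definition abs_cont (y : R -> 'rV[R]_n) (a b : R) : Prop :=
  forall e : R, 0 < e -> exists2 d : R, 0 < d &
    forall (N : nat) (s t : 'I_N -> R),
      (forall i, a <= s i /\ s i <= t i /\ t i <= b) ->
      trivIset setT (fun i => `](s i), (t i)[%classic) ->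
      \sum_(i < N) (t i - s i) < d ->
      \sum_(i < N) `|y (t i) - y (s i)| < e.

Definition conv_hull (A : set 'rV[R]_n) : set 'rV[R]_n :=
  smallest (@convex_set R 'rV[R]_n) A.

Definition mci_discrete : set 'rV[R]_n :=
  [set x0 | exists (x : nat -> 'rV[R]_n) (u : nat -> 'rV[R]_m),
    x 0%N = x0 /\
    forall t, [/\ x t.+1 = vfield (x t) (u t), U (u t) & X (x t)]].

(* Only the restriction of y to [0, +oo[ matters. *)
Definition mci_continuous : set 'rV[R]_n :=
  [set x0 | exists y : R -> 'rV[R]_n,
    [/\ y 0 = x0,
        forall b : R, 0 <= b -> abs_cont y 0 b,
        {ae lebesgue_measure, forall t : R, 0 <= t ->
           derivable y t 1 /\ conv_hull [set vfield (y t) u | u in U] (derive1 y t)}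
      & forall t : R, 0 <= t -> X (y t)]].

End dynamics.

Variant time_setting (R : Type) : Type :=
  | DiscreteTime of R
  | ContinuousTime of R.

Section setting.
Context {R : realType} {n m : nat}.
Variables (T : time_setting R) (f : 'I_n -> {mpoly R[n + m]}).

Definition valid_discount : Prop :=
  match T with
  | DiscreteTime alpha => 0 < alpha < 1
  | ContinuousTime beta => 0 < beta
  end.

Definition max_controlled_invariant (X : set 'rV[R]_n) (U : set 'rV[R]_m) :
    set 'rV[R]_n :=
  match T with
  | DiscreteTime _ => mci_discrete f X U
  | ContinuousTime _ => mci_continuous f X U
  end.

Definition Lop (v : {mpoly R[n]}) : {mpoly R[n + m]} :=
  match T with
  | DiscreteTime alpha =>
      lift_x m v - alpha *: comp_mpoly [tuple f i | i < n] v
  | ContinuousTime beta =>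
      beta *: lift_x m v - \sum_(i < n) lift_x m (mderiv i v) * f i
  end.

End setting.

Section sos_problem.
Context {R : realType} {n m nX nU : nat}.
Variables (T : time_setting R) (f : 'I_n -> {mpoly R[n + m]}).
Variables (gX : 'I_nX -> {mpoly R[n]}) (gU : 'I_nU -> {mpoly R[m]}).

Definition min_order : nat :=
  maxn (\max_(i < nX) half_deg (gX i)) (\max_(i < nU) half_deg (gU i)).

Definition cert_x (k : nat) (p : {mpoly R[n]}) : Prop :=
  exists (s0 : {mpoly R[n]}) (s : 'I_nX -> {mpoly R[n]}),
    [/\ is_sos k s0,
        forall i, is_sos (k - half_deg (gX i)) (s i)
      & p = s0 + \sum_(i < nX) s i * gX i].

Definition cert_xu (k : nat) (p : {mpoly R[n + m]}) : Prop :=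
  exists (q0 : {mpoly R[n + m]}) (q : 'I_nX -> {mpoly R[n + m]})
      (r : 'I_nU -> {mpoly R[n + m]}),
    [/\ is_sos k q0,
        forall i, is_sos (k - half_deg (gX i)) (q i),
        forall i, is_sos (k - half_deg (gU i)) (r i)
      & p = q0 + \sum_(i < nX) q i * lift_x m (gX i)
               + \sum_(i < nU) r i * lift_u n (gU i)].

Definition dual_feasible (k : nat) (v w : {mpoly R[n]}) : Prop :=
  [/\ (mpdeg v <= 2 * k)%N, (mpdeg w <= 2 * k)%N,
      cert_xu k (Lop T f v), cert_x k (w - v - 1) & cert_x k w].

Definition dual_objective (w : {mpoly R[n]}) : \bar R :=
  (\int[@lebesgue_rV R n]_(x in semialg gX) (peval w x)%:E)%E.

Definition dual_optimal (k : nat) (v w : {mpoly R[n]}) : Prop :=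
  dual_feasible k v w /\
  forall v' w', dual_feasible k v' w' ->
    (dual_objective w <= dual_objective w')%E.

Definition outer_set (v : {mpoly R[n]}) : set 'rV[R]_n :=
  [set x | semialg gX x /\ 0 <= peval v x].

End sos_problem.

(* Main.v *)
(* Evaluating the certificate of Lv along a trajectory shows that v >= 0 on X_I, so
   w >= 1 on X_{I,k}, w >= 0 on X, and lambda(X_{I,k} \ X_I) is at most the optimal
   value minus lambda(X_I). It remains to exhibit feasible pairs of value close to
   lambda(X_I). Iterating V_{j+1}(x) = min(c(x), g sup_u V_j(F(x, u))), where -c is
   a large multiple of the violation of the constraints of X and F is the dynamics
   (or one Euler step of it), gives Lipschitz functions V <= 0 with LV >= 0 up to a
   small error near X. If V(x) stays above -2 for infinitely many of these problems,
   an ultrafilter limit of near-optimal chains is an admissible trajectory from x;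
   hence V <= -2 eventually off X_I. Bernstein polynomials approximate V (followed,
   in continuous time, by averaging over small cubes to control the gradient), and
   w approximates max(v + 1, 0). Putinar's theorem turns the strict inequalities
   into certificates; it reduces to positivity on a box, where the Bernstein
   coefficients become positive, so that p lies in the preorder generated by the
   ball constraint. *)
From HB Require Import structures.
Require Import Defs.
From mathcomp Require Import all_boot all_order all_algebra.
From mathcomp Require mpoly.
Import -(notations) mpoly.
From mathcomp Require Import all_classical all_reals all_analysis.
From mathcomp Require Import measurable_realfun.
From mathcomp Require Import ring lra zify.

Set Implicit Arguments.
Unset Strict Implicit.
Unset Printing Implicit Defensive.

Import Order.TTheory GRing.Theory Num.Theory.
Import numFieldNormedType.Exports.

Local Open Scope classical_set_scope.
Local Open Scope ring_scope.

(** * Evaluation of polynomials *)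

(** Adding a constant d to a polynomial adds (1 - alpha) d or beta d to its image under L. This
    slack, which comes from the discount, absorbs every approximation error and makes Lv >= 0
    strict. The cost is multiplied by N = l + 1 and switched off where the violation is at most 1/N.
    A chain of value above -2 then violates the constraints at step i by less than (1 + 2 / g^i) /
    N, which vanishes for fixed i, while the dead zone keeps the dynamic programming inequality
    valid on a neighbourhood of X, as averaging over cubes requires. Pointwise convergence of the
    P_l is never established, only that X_I is the upper limit of the sets {P_l > -1}. Continuity
    from above along their tail unions B_l suffices, since w is at most 3 d on X outside B_l. In
    continuous time the obstacle is the gradient: a uniform approximation P of V says nothing about
    grad P. Values of P, and values of its partial derivatives, are therefore compared at one common
    shift of all points involved, and the Lipschitz constant of V is bounded independently of the
    Euler step before that step is chosen. *)

Section polynomial_evaluation.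
Context {R : realType} {n : nat}.
Implicit Types (p q : {mpoly R[n]}) (x y : 'rV[R]_n).

Lemma pevalD p q x : peval (p + q) x = peval p x + peval q x.
Proof. exact: mevalD. Qed.

Lemma pevalN p x : peval (- p) x = - peval p x.
Proof. exact: mevalN. Qed.

Lemma pevalB p q x : peval (p - q) x = peval p x - peval q x.
Proof. exact: mevalB. Qed.

Lemma pevalM p q x : peval (p * q) x = peval p x * peval q x.
Proof. exact: mevalM. Qed.

Lemma pevalZ c p x : peval (c *: p) x = c * peval p x.
Proof. exact: mevalZ. Qed.

Lemma pevalC c x : peval (mpolyC n c) x = c.
Proof. exact: mevalC. Qed.

Lemma peval1 x : peval 1 x = 1.
Proof. exact: meval1. Qed.

Lemma pevalXU i x : peval (mpolyX R (mnm1 i)) x = x ord0 i.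
Proof. exact: mevalXU. Qed.

Lemma pevalXn p k x : peval (p ^+ k) x = peval p x ^+ k.
Proof. by elim: k => [|k ih]; rewrite ?expr0 ?peval1// !exprS pevalM ih. Qed.

Lemma peval_sum I (r : seq I) (P : pred I) (F : I -> {mpoly R[n]}) x :
  peval (\sum_(i <- r | P i) F i) x = \sum_(i <- r | P i) peval (F i) x.
Proof. by rewrite /peval raddf_sum. Qed.

Lemma peval_prod I (r : seq I) (P : pred I) (F : I -> {mpoly R[n]}) x :
  peval (\prod_(i <- r | P i) F i) x = \prod_(i <- r | P i) peval (F i) x.
Proof. by rewrite /peval rmorph_prod. Qed.

Lemma pevalE p x :
  peval p x = \sum_(m <- msupp p) mcoeff m p * \prod_i x ord0 i ^+ m i.
Proof. exact: mevalE. Qed.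

Lemma mpoly_ring_ind (P : {mpoly R[n]} -> Prop) :
  (forall c, P (mpolyC n c)) -> (forall i, P (mpolyX R (mnm1 i))) ->
  (forall p q, P p -> P q -> P (p + q)) ->
  (forall p q, P p -> P q -> P (p * q)) -> forall p, P p.
Proof.
move=> PC PX PD PM p; rewrite (mpolyE p).
elim: (msupp p : seq _) => [|m s ih]; first by rewrite big_nil -(mpolyC0 n R).
rewrite big_cons; apply: (PD) => //; rewrite -mul_mpolyC; apply: (PM) => //.
have P1 : P 1 by rewrite -(mpolyC1 n R).
rewrite mpolyXE_id; apply: (big_ind P P1 PM) => i _.
by elim: (m i) => [|k ihk]; rewrite ?expr0// exprS; apply: (PM).
Qed.

Lemma le_coord_norm x i : `|x ord0 i| <= `|x|.
Proof.
rewrite {2}/Num.norm /= mx_normrE.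
by apply: (le_trans _ (le_bigmax _ _ (ord0, i))).
Qed.

Lemma norm_rV_le x (c : R) : 0 <= c -> (forall i, `|x ord0 i| <= c) -> `|x| <= c.
Proof.
move=> c0 h; rewrite /Num.norm /= mx_normrE; apply/bigmax_leP; split=> //.
by move=> [a i] _ /=; rewrite (ord1 a).
Qed.

Lemma continuous_peval p : continuous (peval p).
Proof.
elim/mpoly_ring_ind: p => [c|i|p q cp cq|p q cp cq] x.
- rewrite (_ : peval _ = fun=> c); first exact: cst_continuous.
  by apply/funext => z; rewrite pevalC.
- rewrite (_ : peval _ = fun z => z ord0 i); first exact: coord_continuous.
  by apply/funext => z; rewrite pevalXU.
- rewrite (_ : peval _ = peval p \+ peval q).
    by apply: continuousD; [exact: cp|exact: cq].
  by apply/funext => z; rewrite pevalD.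
- rewrite (_ : peval _ = peval p \* peval q).
    by apply: continuousM; [exact: cp|exact: cq].
  by apply/funext => z; rewrite pevalM.
Qed.

Lemma measurable_peval p : measurable_fun [set: 'rV[R]_n] (peval p : _ -> measurableTypeR R).
Proof.
elim/mpoly_ring_ind: p => [c|i|p q mp mq|p q mp mq].
- rewrite (_ : peval _ = fun=> c); first exact: measurable_cst.
  by apply/funext => z; rewrite pevalC.
- rewrite (_ : peval _ = rV_coord i); first exact: measurable_rV_coord.
  by apply/funext => z; rewrite pevalXU.
- rewrite (_ : peval _ = peval p \+ peval q); first exact: measurable_funD.
  by apply/funext => z; rewrite pevalD.
- rewrite (_ : peval _ = peval p \* peval q); first exact: measurable_funM.
  by apply/funext => z; rewrite pevalM.
Qed.

(** The sup bound K is carried along with the Lipschitz constant L because the Lipschitz constant of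
    a product involves both. *)
Lemma peval_lipschitz_box p (r : R) : exists L K : R, [/\ 0 <= L, 0 <= K,
  forall x, `|x| <= r -> `|peval p x| <= K &
  forall x y, `|x| <= r -> `|y| <= r -> `|peval p x - peval p y| <= L * `|x - y|].
Proof.
elim/mpoly_ring_ind: p => [c|i|p q [L [K [L0 K0 hK hL]]] [L' [K' [L0' K0' hK' hL']]]
  |p q [L [K [L0 K0 hK hL]]] [L' [K' [L0' K0' hK' hL']]]].
- exists 0, `|c|; split=> // [x _|x y _ _]; rewrite !pevalC//.
  by rewrite subrr normr0 mul0r.
- exists 1, `|r|; split=> // [x xr|x y _ _]; rewrite !pevalXU.
    by rewrite (le_trans (le_coord_norm _ _))// (le_trans xr)// ler_norm.
  by rewrite mul1r (le_trans _ (le_coord_norm _ i))// !mxE.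
- exists (L + L'), (K + K'); split=> [||x xr|x y xr yr]; rewrite ?addr_ge0//.
    by rewrite pevalD (le_trans (ler_normD _ _))// lerD// ?hK ?hK'.
  by rewrite !pevalD opprD addrACA (le_trans (ler_normD _ _))// mulrDl lerD// ?hL ?hL'.
- exists (K * L' + K' * L), (K * K'); split=> [||x xr|x y xr yr]; rewrite ?addr_ge0 ?mulr_ge0//.
    by rewrite pevalM normrM ler_pM// ?hK ?hK'.
  rewrite !pevalM (_ : _ - _ = peval p x * (peval q x - peval q y) +
    peval q y * (peval p x - peval p y)); last by ring.
  rewrite (le_trans (ler_normD _ _))// !normrM mulrDl -!mulrA.
  by apply: lerD; apply: ler_pM => //; rewrite ?hK ?hK' ?hL ?hL'.
Qed.

Lemma is_derive_peval p (y : R -> 'rV[R]_n) (t : R) (dy : 'I_n -> R) :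
  (forall i, is_derive t (1 : R) (fun s => y s ord0 i) (dy i)) ->
  is_derive t (1 : R) (fun s => peval p (y s))
    (\sum_i peval (mderiv i p) (y t) * dy i).
Proof.
move=> hy; elim/mpoly_ring_ind: p => [c|j|p q hp hq|p q hp hq].
- rewrite (_ : (fun s => _) = fun=> c); last by apply/funext => s; rewrite pevalC.
  rewrite big1; first exact: is_derive_cst.
  by move=> i _; rewrite mderivC -(mpolyC0 n R) pevalC mul0r.
- rewrite (_ : (fun s => _) = fun s => y s ord0 j); last first.
    by apply/funext => s; rewrite pevalXU.
  rewrite (bigD1 j)//= big1 => [|i ij]; last first.
    by rewrite mderivX mnm1E eq_sym (negbTE ij) scale0r -(mpolyC0 n R) pevalC mul0r.
  rewrite mderivX mnm1E eqxx scale1r (_ : mnm_sub _ _ = mnm0).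
    by rewrite mpolyX0 peval1 mul1r addr0.
  by apply/mnmP => k; rewrite mnmBE mnm0E subnn.
- rewrite (_ : (fun s => _) = (fun s => peval p (y s)) + (fun s => peval q (y s))); last first.
    by apply/funext => s; rewrite pevalD.
  apply: is_derive_eq; rewrite -big_split/=; apply: eq_bigr => i _.
  by rewrite mderivD pevalD mulrDl.
- rewrite (_ : (fun s => _) = (fun s => peval p (y s)) * (fun s => peval q (y s))); last first.
    by apply/funext => s; rewrite pevalM.
  apply: is_derive_eq.
  rewrite /GRing.scale/= !mulr_sumr -big_split/=; apply: eq_bigr => i _.
  by rewrite mderivM pevalD !pevalM; ring.
Qed.

(** The norm of a row vector is the maximum of its coordinates, so a single square of the Euclidean
    constraint bounds each of them; r may be negative, hence the absolute value. *)
Lemma ball_poly_norm_le (r : R) x : 0 <= peval (ball_poly n r) x -> `|x| <= `|r|.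
Proof.
rewrite /ball_poly pevalB pevalC peval_sum subr_ge0 => h.
apply: norm_rV_le => // i; rewrite -ler_sqr ?nnegrE// !real_normK ?num_real//.
apply: le_trans h; rewrite (bigD1 i)//= pevalXn pevalXU lerDl.
by apply: sumr_ge0 => j _; rewrite pevalXn sqr_ge0.
Qed.

End polynomial_evaluation.

Section lifted_polynomials.
Context {R : realType} {n m : nat}.

Lemma peval_lift_x (p : {mpoly R[n]}) (x : 'rV[R]_n) (u : 'rV[R]_m) :
  peval (lift_x m p) (row_mx x u) = peval p x.
Proof.
rewrite /peval /lift_x comp_mpoly_meval; apply: meval_eq => i.
by rewrite tnth_mktuple mevalXU row_mxEl.
Qed.

Lemma peval_lift_u (p : {mpoly R[m]}) (x : 'rV[R]_n) (u : 'rV[R]_m) :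
  peval (lift_u n p) (row_mx x u) = peval p u.
Proof.
rewrite /peval /lift_u comp_mpoly_meval; apply: meval_eq => i.
by rewrite tnth_mktuple mevalXU row_mxEr.
Qed.

Lemma peval_comp_vfield (f : 'I_n -> {mpoly R[n + m]}) (v : {mpoly R[n]})
    (x : 'rV[R]_n) (u : 'rV[R]_m) :
  peval (comp_mpoly [tuple f i | i < n] v) (row_mx x u) = peval v (vfield f x u).
Proof.
rewrite /peval comp_mpoly_meval; apply: meval_eq => i.
by rewrite tnth_mktuple mxE.
Qed.

End lifted_polynomials.

(** * Bernstein expansions and Putinar's Positivstellensatz *)

Section bernstein_coefficients.

(** Both sides count the a-subsets of k-subsets of a d-set; the proof multiplies each by the
    factorials that turn it into d!. *)
Lemma mul_bin_bin (d a k : nat) : (a <= k)%N -> (k <= d)%N ->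
  ('C(k, a) * 'C(d, k) = 'C(d, a) * 'C(d - a, k - a))%N.
Proof.
move=> ak kd; have ad := leq_trans ak kd.
have kad : (k - a <= d - a)%N by exact: leq_sub2r.
apply/eqP; rewrite -(@eqn_pmul2r (a`! * (k - a)`! * (d - k)`!)); last first.
  by rewrite !muln_gt0 !fact_gt0.
apply/eqP; transitivity d`!.
  by rewrite (_ : _ * _ = 'C(d, k) * (('C(k, a) * (a`! * (k - a)`!)) * (d - k)`!))%N;
    [rewrite bin_fact// bin_fact|ring].
have e : (d - a - (k - a) = d - k)%N by rewrite subnBA// subnK.
rewrite (_ : _ * _ = 'C(d, a) * (a`! * ('C(d - a, k - a) * ((k - a)`! * (d - k)`!))))%N;
  last by ring.
by rewrite -e bin_fact// bin_fact.
Qed.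

(** The binomial formula for (y + z)^(d - a), reindexed by k - a. With z = 1 - y it expands y^a in
    the Bernstein basis of degree d; stated in a ring, it serves both for polynomials and for
    numbers. *)
Lemma bernstein_monomial (A : comNzRingType) (d a : nat) (y z : A) : (a <= d)%N ->
  \sum_(k < d.+1) ('C(k, a) * 'C(d, k))%:R * (y ^+ k * z ^+ (d - k)) =
  'C(d, a)%:R * (y ^+ a * (y + z) ^+ (d - a)).
Proof.
move=> ad.
rewrite -(big_mkord xpredT (fun k => ('C(k, a) * 'C(d, k))%:R * (y ^+ k * z ^+ (d - k)))).
rewrite (big_cat_nat _ (n := a))//=; last exact: leqW.
rewrite big_nat big1 ?add0r => [|k /andP[_ ka]]; last first.
  by rewrite bin_small// mul0n mul0r.
rewrite -{1}[a]add0n big_addn addrC exprDn subSn// big_mkord !mulr_sumr.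
apply: eq_bigr => i _.
have id : (i <= d - a)%N by rewrite -ltnS.
have aid : (i + a <= d)%N by rewrite addnC -leq_subRL.
rewrite mul_bin_bin ?leq_addl// addnK natrM exprD.
rewrite (_ : d - (i + a) = d - a - i)%N; last by rewrite addnC subnDA.
by rewrite -[X in _ = _ * (_ * X)]mulr_natl; ring.
Qed.

Context {R : realType}.

(* The coefficient of ['X^a] on the k-th Bernstein polynomial of degree d,
   which tends to (k / d) ^ a. *)
Definition bern_coef (d k a : nat) : R := 'C(k, a)%:R / 'C(d, a)%:R.

Lemma bern_coefS d k a : (a < d)%N ->
  bern_coef d k a.+1 = bern_coef d k a * ((k - a)%:R / (d - a)%:R).
Proof.
move=> ad; rewrite /bern_coef.
have h (b : nat) : 'C(b, a.+1)%:R = (b - a)%:R * 'C(b, a)%:R / a.+1%:R :> R.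
  by rewrite -natrM -mul_bin_left natrM mulrC mulrA mulVf ?mul1r// pnatr_eq0.
rewrite !h.
have : (a.+1%:R : R) != 0 by rewrite pnatr_eq0.
have : ((d - a)%:R : R) != 0 by rewrite pnatr_eq0 subn_eq0 -ltnNge.
have : ('C(d, a)%:R : R) != 0 by rewrite pnatr_eq0 -lt0n bin_gt0 ltnW.
by move=> *; field; rewrite ?andbT; do ?[apply/andP; split].
Qed.

Lemma ratio01 (k d : nat) : (k <= d)%N -> 0 <= (k%:R / d%:R : R) <= 1.
Proof.
move=> kd; rewrite divr_ge0//=; case: d kd => [|d] kd; first by rewrite invr0 mulr0.
by rewrite ler_pdivrMr ?ltr0n// mul1r ler_nat.
Qed.

Lemma bern_coef01 d k a : (a <= d)%N -> (k <= d)%N -> 0 <= bern_coef d k a <= 1.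
Proof.
move=> ad kd; elim: a ad => [|a ih] ad; first by rewrite /bern_coef !bin0 divr1 ler01 lexx.
have /andP[h0 h1] := ih (ltnW ad).
have /andP[g0 g1] := ratio01 (leq_sub2r a kd).
by rewrite bern_coefS// mulr_ge0//= mulr_ile1.
Qed.

(** The coefficient is the product of the a ratios (k - j) / (d - j), j < a, each of which is within
    j / d of k / d; the errors add up because all factors lie in [0, 1]. *)
Lemma bern_coef_approx d k a : (a <= d)%N -> (k <= d)%N ->
  `|bern_coef d k a - (k%:R / d%:R) ^+ a| <= (a ^ 2)%:R / d%:R.
Proof.
move=> ad kd; elim: a ad => [|a ih] ad.
  by rewrite /bern_coef !bin0 divr1 expr0 subrr normr0 divr_ge0.
have /andP[g0 g1] := ratio01 (leq_sub2r a kd).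
have /andP[x0 x1] := ratio01 kd.
have d0 : (0 < d%:R :> R) by rewrite ltr0n (leq_trans _ ad).
have da0 : (0 < (d - a)%:R :> R) by rewrite ltr0n subn_gt0.
have step : `|(k - a)%:R / (d - a)%:R - k%:R / d%:R| <= (a%:R / d%:R : R).
  (* For k < a the natural subtraction makes the ratio 0, and k / d itself is below a / d. *)
  have [ka|ak] := ltnP k a.
    have -> : (k - a = 0)%N by apply/eqP; rewrite subn_eq0 ltnW.
    by rewrite mul0r sub0r normrN ger0_norm// ler_pM2r ?invr_gt0// ler_nat ltnW.
  rewrite (_ : _ - _ = - (a%:R / d%:R * ((d - k)%:R / (d - a)%:R))); last first.
    rewrite !natrB//; last exact: ltnW.
    have : d%:R - a%:R != 0 :> R by rewrite -natrB ?gt_eqF// ltnW.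
    by move=> h; field; rewrite h gt_eqF.
  rewrite normrN ger0_norm ?mulr_ge0// ler_piMr ?divr_ge0//.
  by rewrite ler_pdivrMr// mul1r ler_nat leq_sub2l.
rewrite bern_coefS// exprS [X in _ - X]mulrC.
set c := bern_coef d k a; set x := k%:R / d%:R; set r := (_ - _)%:R / _.
rewrite (_ : _ - _ = (c - x ^+ a) * r + x ^+ a * (r - x)); last by ring.
rewrite (le_trans (ler_normD _ _))// (normrM (c - _)) (normrM (x ^+ a)).
have : `|c - x ^+ a| * `|r| <= (a ^ 2)%:R / d%:R.
  by rewrite (le_trans _ (ih (ltnW ad)))// ler_piMr// ger0_norm.
have : `|x ^+ a| * `|r - x| <= a%:R / d%:R.
  rewrite (le_trans _ step)// ler_piMl// ger0_norm ?exprn_ge0//.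
  exact: exprn_ile1.
move=> h2 h1; rewrite (le_trans (lerD h1 h2))// -mulrDl ler_pM2r ?invr_gt0//.
by rewrite -natrD ler_nat !expnS expn0 !muln1 mulSn mulnS (addnC (a * a)%N) leq_addl.
Qed.

Lemma normB_prod_le (I : Type) (s : seq I) (a b : I -> R) :
  (forall i, 0 <= a i <= 1) -> (forall i, 0 <= b i <= 1) ->
  `|\prod_(i <- s) a i - \prod_(i <- s) b i| <= \sum_(i <- s) `|a i - b i|.
Proof.
move=> ha hb; elim: s => [|i s ih]; first by rewrite !big_nil subrr normr0.
rewrite !big_cons.
set A := \prod_(_ <- _) a _; set B := \prod_(_ <- _) b _.
have /andP[a0 a1] := ha i; have /andP[b0 b1] := hb i.
have /andP[B0 B1] : 0 <= B <= 1.
  rewrite /B; apply: (big_ind (fun x => 0 <= x <= 1)) => //; first by rewrite ler01 lexx.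
  by move=> x y /andP[x0 x1] /andP[y0 y1]; rewrite mulr_ge0//= mulr_ile1.
rewrite (_ : _ - _ = (a i - b i) * B + a i * (A - B)); last by ring.
rewrite (le_trans (ler_normD _ _))// !normrM (ger0_norm B0) (ger0_norm a0).
by apply: lerD; [rewrite ler_piMr|rewrite (le_trans _ ih)// ler_piMl].
Qed.

End bernstein_coefficients.

Lemma compact_rV_itv {R : realType} n (a b : R) :
  compact [set y : 'rV[R]_n | forall i, a <= y ord0 i <= b].
Proof.
have h := @rV_compact R n (fun=> `[a, b]%classic) (fun=> @segment_compact R a b).
by rewrite (_ : mkset _ = [set v : 'rV[R]_n | forall i, `[a, b]%classic (v ord0 i)]).
Qed.

Lemma compact_norm_le {R : realType} n (r : R) : 0 <= r -> compact [set x : 'rV[R]_n | `|x| <= r].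
Proof.
move=> r0; rewrite (_ : mkset _ = [set y : 'rV[R]_n | forall i, - r <= y ord0 i <= r]).
  exact: compact_rV_itv.
apply/seteqP; split=> x /= h.
  by move=> i; rewrite -ler_norml (le_trans (le_coord_norm _ _)).
by apply: norm_rV_le => // i; rewrite ler_norml.
Qed.

Lemma continuous_min_gt0 {R : realType} (T : topologicalType) (A : set T) (f : T -> R) :
  compact A -> continuous f -> (forall x, A x -> 0 < f x) ->
  exists2 e, 0 < e & forall x, A x -> e <= f x.
Proof.
move=> cA cf fA; have [->|/set0P A0] := eqVneq A set0; first by exists 1.
have [c cA' hc] := compact_EVT_min A0 cA (continuous_subspaceT cf).
exists (f c); first by apply: fA; rewrite inE in cA'.
by move=> x Ax; apply: hc; rewrite inE.
Qed.

Section bernstein_positivity.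
Context {R : realType} {n : nat}.
Implicit Types (p : {mpoly R[n]}).

Lemma bernstein_expansion p :
  (forall y : 'rV[R]_n, (forall i, 0 <= y ord0 i <= 1) -> 0 < peval p y) ->
  exists d (b : {ffun 'I_n -> 'I_d.+1} -> R), (forall k, 0 <= b k) /\
    p = \sum_k b k *: \prod_i (mpolyX R (mnm1 i) ^+ k i *
                               (1 - mpolyX R (mnm1 i)) ^+ (d - k i)).
Proof.
move=> p0.
have [e e0 he] := continuous_min_gt0 (@compact_rV_itv R n 0 1) (@continuous_peval _ _ p) p0.
(* The normalised Bernstein coefficient at k differs from the value of p at the node k / d by at
   most E / d. The degree d is taken so that this is at most the minimum e of p on the cube, and
   large enough for every monomial of p to be expanded. *)
pose E := \sum_(m <- msupp p) `|mcoeff m p| * \sum_(i < n) (m i ^ 2)%:R.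
have E0 : 0 <= E by apply: sumr_ge0 => m _; rewrite mulr_ge0// sumr_ge0.
pose d := maxn (Num.truncn (E / e)).+1 (mmeasure mdeg p).
have d0 : (0 < d%:R :> R) by rewrite ltr0n /d leq_max.
have dE : E / d%:R <= e.
  rewrite ler_pdivrMr// mulrC -ler_pdivrMr//.
  by rewrite (le_trans (ltW (truncnS_gt _)))// ler_nat leq_maxl.
have md m : m \in msupp p -> forall i, (m i <= d)%N.
  move=> mp i; apply: (@leq_trans (mdeg m)); first by rewrite mdegE (bigD1 i)//= leq_addr.
  by rewrite ltnW// (leq_trans (mmeasure_mnm_lt mdeg mp))// leq_maxr.
pose g (k : {ffun 'I_n -> 'I_d.+1}) :=
  \sum_(m <- msupp p) mcoeff m p * \prod_i bern_coef d (k i) (m i).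
exists d, (fun k => g k * \prod_i 'C(d, k i)%:R); split=> [k|].
  apply: mulr_ge0; last by apply: prodr_ge0.
  pose y : 'rV[R]_n := \row_i ((k i)%:R / d%:R).
  have kd i : (k i <= d)%N by rewrite -ltnS.
  have : e <= peval p y by apply: he => i; rewrite mxE ratio01.
  suff : `|g k - peval p y| <= E / d%:R by move: dE; rewrite ler_norml; lra.
  rewrite pevalE /g -sumrB (le_trans (ler_norm_sum _ _ _))// /E mulr_suml.
  rewrite big_seq [leRHS]big_seq; apply: ler_sum => m mp.
  rewrite -mulrBr normrM -mulrA ler_wpM2l//.
  apply: le_trans (normB_prod_le _ _ _) _ => [i|i|].
  - by rewrite bern_coef01// md.
  - rewrite mxE; have /andP[h0 h1] := ratio01 (R := R) (kd i).
    by rewrite exprn_ge0//= exprn_ile1.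
  - rewrite mulr_suml; apply: ler_sum => i _.
    by rewrite mxE bern_coef_approx// md.
rewrite {1}(mpolyE p).
transitivity (\sum_(m <- msupp p) \sum_(k : {ffun 'I_n -> 'I_d.+1})
   (mcoeff m p * \prod_i bern_coef d (k i) (m i) * \prod_i 'C(d, k i)%:R) *:
    \prod_i (mpolyX R (mnm1 i) ^+ k i * (1 - mpolyX R (mnm1 i)) ^+ (d - k i))); last first.
  rewrite exchange_big/=; apply: eq_bigr => k _.
  by rewrite /g -scaler_suml mulr_suml.
rewrite big_seq [RHS]big_seq; apply: eq_bigr => m mp.
rewrite mpolyXE_id.
under eq_bigr => i _.
  have -> : mpolyX R (mnm1 i) ^+ m i = \sum_(k < d.+1)
      (bern_coef d k (m i) * 'C(d, k)%:R) *:
      (mpolyX R (mnm1 i) ^+ k * (1 - mpolyX R (mnm1 i)) ^+ (d - k)).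
    have := bernstein_monomial (mpolyX R (mnm1 i)) (1 - mpolyX R (mnm1 i)) (md m mp i).
    rewrite addrCA subrr addr0 expr1n mulr1 => h.
    apply: (@scalerI _ _ ('C(d, m i)%:R : R)).
      by rewrite pnatr_eq0 -lt0n bin_gt0 md.
    rewrite scaler_nat -[LHS]mulr_natl -h scaler_sumr; apply: eq_bigr => k _.
    rewrite scalerA /bern_coef mulr_natl -scaler_nat; congr (_ *: _).
    by rewrite natrM; field; rewrite pnatr_eq0 -lt0n bin_gt0 md.
  over.
rewrite bigA_distr_bigA/= scaler_sumr; apply: eq_bigr => k _.
by rewrite scaler_prod scalerA big_split/= mulrA.
Qed.

End bernstein_positivity.

(** * Quadratic modules and the Positivstellensatz *)

Section quadratic_modules.
Context {R : realType} {n : nat}.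
Implicit Types (p q : {mpoly R[n]}).

(** Kept as an abstract predicate: it is later instantiated by the polynomials that have a
    certificate of every large order, so that no degree bound enters the Positivstellensatz. *)
Definition quadratic_module (M : {mpoly R[n]} -> Prop) : Prop :=
  [/\ M 1, forall p q, M p -> M q -> M (p + q) & forall h p, M p -> M (h ^+ 2 * p)].

Lemma quadratic_module0 M : quadratic_module M -> M 0.
Proof. by case=> M1 _ /(_ 0 1 M1); rewrite expr0n mul0r. Qed.

Lemma quadratic_module_sum M (I : Type) (s : seq I) (F : I -> {mpoly R[n]}) :
  quadratic_module M -> (forall i, M (F i)) -> M (\sum_(i <- s) F i).
Proof.
move=> qM MF; have M0 := quadratic_module0 qM; case: qM => _ MD _.
by elim/big_ind : _.
Qed.

Lemma quadratic_moduleZ M (c : R) p : quadratic_module M -> 0 <= c -> M p -> M (c *: p).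
Proof.
move=> [_ _ MX] c0 Mp; have := MX (mpolyC n (Num.sqrt c)) p Mp.
by rewrite -rmorphXn /= sqr_sqrtr// mul_mpolyC.
Qed.

Definition sum_of_squares p : Prop := exists s : seq {mpoly R[n]}, p = \sum_(h <- s) h ^+ 2.

Lemma sum_of_squares_sqr p : sum_of_squares (p ^+ 2).
Proof. by exists [:: p]; rewrite big_seq1. Qed.

Lemma sum_of_squares0 : sum_of_squares 0.
Proof. by exists [::]; rewrite big_nil. Qed.

Lemma sum_of_squaresD p q : sum_of_squares p -> sum_of_squares q -> sum_of_squares (p + q).
Proof. by move=> [s ->] [t ->]; exists (s ++ t); rewrite big_cat. Qed.

Lemma sum_of_squaresM p q : sum_of_squares p -> sum_of_squares q -> sum_of_squares (p * q).
Proof.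
move=> [s ->] [t ->]; exists [seq x * y | x <- s, y <- t].
rewrite big_allpairs_dep /= mulr_suml; apply: eq_bigr => x _.
by rewrite mulr_sumr; apply: eq_bigr => y _; rewrite exprMn.
Qed.

Lemma quadratic_module_sos_mul M p q :
  quadratic_module M -> sum_of_squares p -> M q -> M (p * q).
Proof.
move=> qM [s ->] Mq; rewrite mulr_suml; apply: quadratic_module_sum => // h.
by case: qM => _ _; apply.
Qed.

(* With a single generator, the quadratic module is closed under products. *)
Definition principal_preorder (b p : {mpoly R[n]}) : Prop :=
  exists s t, [/\ sum_of_squares s, sum_of_squares t & p = s + t * b].

Lemma principal_preorderD b p q :
  principal_preorder b p -> principal_preorder b q -> principal_preorder b (p + q).
Proof.
move=> [s [t [hs ht ->]]] [s' [t' [hs' ht' ->]]].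
exists (s + s'), (t + t'); split; [exact: sum_of_squaresD|exact: sum_of_squaresD|].
by rewrite mulrDl addrACA.
Qed.

Lemma principal_preorderM b p q :
  principal_preorder b p -> principal_preorder b q -> principal_preorder b (p * q).
Proof.
move=> [s [t [hs ht ->]]] [s' [t' [hs' ht' ->]]].
exists (s * s' + t * t' * b ^+ 2), (s * t' + s' * t); split; last by ring.
- apply: sum_of_squaresD; first exact: sum_of_squaresM.
  by apply: sum_of_squaresM (sum_of_squares_sqr _); exact: sum_of_squaresM.
- by apply: sum_of_squaresD; exact: sum_of_squaresM.
Qed.

Lemma principal_preorder_sos b p : sum_of_squares p -> principal_preorder b p.
Proof. by move=> hp; exists p, 0; rewrite mul0r addr0; split=> //; exact: sum_of_squares0. Qed.

Lemma principal_preorder1 b : principal_preorder b 1.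
Proof. by apply: principal_preorder_sos; rewrite -(expr1n _ 2); exact: sum_of_squares_sqr. Qed.

Lemma principal_preorderZ b (c : R) p :
  0 <= c -> principal_preorder b p -> principal_preorder b (c *: p).
Proof.
move=> c0 hp; rewrite -mul_mpolyC; apply: principal_preorderM => //.
apply: principal_preorder_sos; rewrite -(sqr_sqrtr c0) rmorphXn.
exact: sum_of_squares_sqr.
Qed.

Lemma principal_preorder_sum b (I : Type) (s : seq I) (F : I -> {mpoly R[n]}) :
  (forall i, principal_preorder b (F i)) -> principal_preorder b (\sum_(i <- s) F i).
Proof.
move=> bF; elim/big_ind : _ => //; last exact: principal_preorderD.
exact/principal_preorder_sos/sum_of_squares0.
Qed.

Lemma principal_preorderX b p k : principal_preorder b p -> principal_preorder b (p ^+ k).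
Proof.
move=> hp; elim: k => [|k ih]; first by rewrite expr0; exact: principal_preorder1.
by rewrite exprS; exact: principal_preorderM.
Qed.

Lemma principal_preorder_prod b (I : Type) (s : seq I) (F : I -> {mpoly R[n]}) :
  (forall i, principal_preorder b (F i)) -> principal_preorder b (\prod_(i <- s) F i).
Proof.
move=> bF; elim/big_ind : _ => //; first exact: principal_preorder1.
exact: principal_preorderM.
Qed.

Lemma principal_preorder_quadratic_module M b p :
  quadratic_module M -> M b -> principal_preorder b p -> M p.
Proof.
move=> qM Mb [s [t [hs ht ->]]]; have [M1 MD _] := qM; apply: MD.
  by rewrite -[s]mulr1; exact: quadratic_module_sos_mul.
exact: quadratic_module_sos_mul.
Qed.

Lemma ball_poly_coord (r s : R) (i : 'I_n) : s ^+ 2 = 1 ->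
  principal_preorder (ball_poly n r)
    ((2 * (`|r| + 1))^-1 *: (mpolyC n (`|r| + 1) + s *: mpolyX R (mnm1 i))).
Proof.
move=> s2; set q : R := `|r| + 1; have q0 : 0 < q by rewrite /q ltr_wpDl.
pose S := \sum_(j < n | j != i) mpolyX R (mnm1 j) ^+ 2.
have e2 : (2 * q) *: (mpolyC n q + s *: mpolyX R (mnm1 i)) =
    (mpolyC n q + s *: mpolyX R (mnm1 i)) ^+ 2 +
    (mpolyC n (q ^+ 2 - r ^+ 2) + S) + 1 * ball_poly n r.
  have -> : ball_poly n r = mpolyC n (r ^+ 2) - (mpolyX R (mnm1 i) ^+ 2 + S).
    by rewrite /ball_poly (bigD1 i).
  have c2 : mpolyC n s ^+ 2 = 1 by rewrite -rmorphXn s2 rmorph1.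
  have -> : mpolyC n (q ^+ 2 - r ^+ 2) = mpolyC n q ^+ 2 - mpolyC n (r ^+ 2).
    by rewrite -rmorphXn rmorphB.
  have -> : (2 * q) *: (mpolyC n q + s *: mpolyX R (mnm1 i)) =
      2 * mpolyC n q * (mpolyC n q + mpolyC n s * mpolyX R (mnm1 i)).
    by rewrite -!mul_mpolyC rmorphM rmorph_nat.
  rewrite -mul_mpolyC.
  move: c2; set c := mpolyC n s; set X := mpolyX _ _; set Q := mpolyC n q => c2.
  rewrite [RHS](_ : _ = 2 * Q * (Q + c * X) + (c ^+ 2 - 1) * X ^+ 2); last by ring.
  by rewrite c2 subrr mul0r addr0.
suff h : principal_preorder (ball_poly n r) ((2 * q) *: (mpolyC n q + s *: mpolyX R (mnm1 i))).
  have -> : (2 * q)^-1 *: (mpolyC n q + s *: mpolyX R (mnm1 i)) =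
     ((2 * q)^-1 ^+ 2) *: ((2 * q) *: (mpolyC n q + s *: mpolyX R (mnm1 i))).
    by rewrite scalerA expr2 mulfVK// gt_eqF// mulr_gt0.
  by apply: principal_preorderZ => //; exact: sqr_ge0.
rewrite e2; do 2 eexists; split; last reflexivity; last first.
  by rewrite -(expr1n _ 2); exact: sum_of_squares_sqr.
apply: sum_of_squaresD; first exact: sum_of_squares_sqr.
apply: sum_of_squaresD.
  have h : 0 <= q ^+ 2 - r ^+ 2.
    by rewrite subr_ge0 -(real_normK (num_real r)) lerXn2r// ?nnegrE ?ltW// /q; lra.
  by rewrite -(sqr_sqrtr h) rmorphXn; exact: sum_of_squares_sqr.
rewrite /S; elim/big_ind : _ => [||j _]; first exact: sum_of_squares0.
  exact: sum_of_squaresD.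
exact: sum_of_squares_sqr.
Qed.

(** [up] maps the unit cube onto the box of radius q and [down] inverts it. Pulled back by [down],
    the Bernstein factors y_i and 1 - y_i become the two forms of [ball_poly_coord], so each
    Bernstein product lies in the preorder. *)
Lemma principal_preorder_pos_box (r : R) p :
  (forall x : 'rV[R]_n, `|x| <= `|r| + 1 -> 0 < peval p x) ->
  principal_preorder (ball_poly n r) p.
Proof.
set q : R := `|r| + 1; have q0 : 0 < q by rewrite /q ltr_wpDl.
move=> p0.
pose up := [tuple (2 * q) *: mpolyX R (mnm1 i) - mpolyC n q | i < n].
pose Y i := (2 * q)^-1 *: (mpolyC n q + mpolyX R (mnm1 i)).
pose down := [tuple Y i | i < n].
have upK p' : comp_mpoly down (comp_mpoly up p') = p'.
  move: p'; apply: mpoly_ring_ind => [c|i|p1 p2 h1 h2|p1 p2 h1 h2].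
  - by rewrite !comp_mpolyC.
  - rewrite comp_mpolyXU -tnth_nth tnth_mktuple raddfB/= comp_mpolyC comp_mpolyZ.
    rewrite comp_mpolyXU -tnth_nth tnth_mktuple /Y scalerA mulfV ?scale1r; last first.
      by rewrite gt_eqF// mulr_gt0.
    by rewrite addrC addKr.
  - by rewrite !raddfD/= h1 h2.
  - by rewrite !rmorphM/= h1 h2.
have := @bernstein_expansion _ _ (comp_mpoly up p).
case=> [y y01|d [b [b0 e]]].
  have -> : peval (comp_mpoly up p) y = peval p (\row_i (2 * q * y ord0 i - q)).
    rewrite {1}/peval comp_mpoly_meval; apply: meval_eq => i.
    by rewrite tnth_mktuple mxE -/(peval _ y) pevalB pevalC pevalZ pevalXU.
  apply: p0; apply: norm_rV_le; first exact: ltW.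
  move=> i; rewrite mxE ler_norml; have /andP[h0 h1] := y01 i.
  by apply/andP; split; nra.
rewrite -[p]upK e raddf_sum/=; apply: principal_preorder_sum => k.
rewrite comp_mpolyZ; apply: principal_preorderZ => //.
rewrite rmorph_prod/=; apply: principal_preorder_prod => i.
rewrite rmorphM !rmorphXn/= rmorphB rmorph1 /= comp_mpolyXU -tnth_nth tnth_mktuple.
apply: principal_preorderM; apply: principal_preorderX.
  by have := ball_poly_coord r i (expr1n _ 2); rewrite scale1r.
have := @ball_poly_coord r (- 1) i (etrans (sqrrN 1) (expr1n _ 2)); rewrite scaleN1r -/q.
congr principal_preorder.
have q2 : 2 * q != 0 by rewrite gt_eqF// mulr_gt0.
have -> : 1 = (2 * q)^-1 *: mpolyC n (q + q).
  by rewrite -mul_mpolyC -rmorphM/= -(mpolyC1 n R); congr mpolyC; field; rewrite gt_eqF.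
rewrite /Y -scalerBr [mpolyC n (q + q)]rmorphD/=; congr (_ *: _).
by rewrite opprD addrACA subrr add0r.
Qed.

(** From (1 - h)^m (1 + m h) <= 1, proved by induction in the manner of Bernoulli's inequality. *)
Lemma pow1B_mul_le (m : nat) (h : R) : (0 < m)%N -> 0 <= h <= 1 ->
  (1 - h) ^+ m * h <= m%:R^-1.
Proof.
move=> m0 /andP[h0 h1].
have bern k : (1 - h) ^+ k * (1 + k%:R * h) <= 1.
  elim: k => [|k ih]; first by rewrite expr0 mul0r addr0 mul1r.
  apply: le_trans ih; rewrite exprSr -mulrA ler_wpM2l ?exprn_ge0 ?subr_ge0//.
  rewrite -natr1; have : 0 <= k%:R :> R by [].
  by move: (k%:R : R) => z z0; nra.
have m0' : 0 < m%:R :> R by rewrite ltr0n.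
rewrite -(ler_pM2l m0') mulfV ?gt_eqF//.
apply: le_trans (bern m); rewrite mulrCA ler_wpM2l ?exprn_ge0 ?subr_ge0//.
by lra.
Qed.

(** Bernoulli's inequality (1 - h)^m >= 1 - m h, multiplied by the nonpositive h. *)
Lemma pow1B_mul_le_neg (m : nat) (h : R) : h <= 0 -> (1 - h) ^+ m * h <= - (m%:R * h ^+ 2).
Proof.
move=> h0.
have bern k : 1 + k%:R * (- h) <= (1 - h) ^+ k.
  elim: k => [|k ih]; first by rewrite expr0 mul0r addr0.
  rewrite exprSr; have h1 : 0 <= 1 - h by lra.
  apply: le_trans (ler_wpM2r h1 ih).
  rewrite -natr1; have : 0 <= k%:R :> R by [].
  by move: (k%:R : R) => z z0; nra.
have := bern m; move: ((1 - h) ^+ m) (m%:R : R) => a b; nra.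
Qed.

(** Subtracting suitable elements of M from p leaves a polynomial positive on a whole box. These
    elements are (1 - h_i)^m h_i, where h_i is g_i scaled to be at most 1 in modulus on the box and
    m is even, so that the multiplier is a square. *)
Theorem putinar M (N : nat) (g : 'I_N -> {mpoly R[n]}) (r : R) p :
  quadratic_module M -> (forall i, M (g i)) -> M (ball_poly n r) ->
  (forall x, (forall i, 0 <= peval (g i) x) -> 0 < peval p x) -> M p.
Proof.
move=> qM Mg Mb p0; have [M1 MD MX] := qM.
set q : R := `|r| + 1; have q0 : 0 < q by rewrite /q ltr_wpDl.
have cbox := @compact_norm_le R n q (ltW q0).
have [C C0 hC] : exists2 C, 0 < C & forall i x, `|x| <= q -> `|peval (g i) x| <= C.
  have /choice[K hK] : forall i, exists K, 0 <= K /\ forall x, `|x| <= q -> `|peval (g i) x| <= K.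
    by move=> i; have [L [K [_ K0 hK _]]] := peval_lipschitz_box (g i) q; exists K.
  exists (1 + \sum_i K i) => [|i x xq].
    by rewrite ltr_pwDl// sumr_ge0// => i _; case: (hK i).
  rewrite (le_trans ((hK i).2 x xq))// (bigD1 i)//= addrCA lerDl addr_ge0//.
  by rewrite sumr_ge0// => j _; case: (hK j).
have [L [P [_ P0 hP _]]] := peval_lipschitz_box p q.
pose h i : {mpoly R[n]} := C^-1 *: g i.
have hE i x : peval (h i) x = C^-1 * peval (g i) x by rewrite pevalZ.
(* The sum F of the positive part of p and the negative parts of the h_i is continuous and positive
   on the box: either all constraints hold and p > 0, or one fails. If every summand were below the
   minimum of F divided by N + 1, F would be too small. *)
have [e e0 he] : exists2 e, 0 < e & forall x, `|x| <= q ->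
    e <= peval p x \/ exists i, peval (h i) x <= - e.
  pose F := (fun x => Num.max 0 (peval p x)) \+ (fun x => \sum_i Num.max 0 (- peval (h i) x)).
  have cF : continuous F.
    have cm : forall (G : 'rV[R]_n -> R), continuous G -> continuous (fun x => Num.max 0 (G x)).
      by move=> G cG x; apply: continuous_max (@cst_continuous _ _ _ _) (cG x).
    move=> x; apply: continuousD; first by apply: cm; exact: continuous_peval.
    apply: continuous_big => [z|i _]; first exact: add_continuous.
    by apply: cm => z; apply: continuousN; exact: continuous_peval.
  have [|e e0 he] := continuous_min_gt0 cbox cF.
    move=> x _; rewrite /F/=.
    have [hx|/existsNP[i /negP]] := pselect (forall i, 0 <= peval (g i) x).
      by rewrite ltr_wpDr ?lt_max ?p0 ?orbT// sumr_ge0// => i _; rewrite le_max lexx.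
    rewrite -ltNge => hi; rewrite (bigD1 i)//= ltr_wpDl ?le_max ?lexx//.
    rewrite ltr_wpDr ?sumr_ge0// => [j _|]; first by rewrite le_max lexx.
    by rewrite lt_max hE -mulrN mulr_gt0 ?orbT ?invr_gt0 ?oppr_gt0.
  exists (e / N.+1%:R) => [|x xq]; first by rewrite divr_gt0.
  apply: contrapT => /not_orP[/negP + /forallNP hn]; rewrite -ltNge => hp.
  have hn' i : - peval (h i) x < e / N.+1%:R by move: (hn i) => /negP; rewrite -ltNge ltrNl.
  have := he x xq; rewrite leNgt => /negP; apply.
  have eE : e / N.+1%:R + \sum_(i < N) (e / N.+1%:R) = e.
    by rewrite sumr_const card_ord -mulrS -[LHS]mulr_natr divfK// pnatr_eq0.
  rewrite -[X in _ < X]eE.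
  rewrite /F/=; apply: ltr_leD.
    by rewrite gt_max hp divr_gt0.
  by apply: ler_sum => i _; rewrite ge_max divr_ge0//= ?ltW.
(* On [0, 1] the terms (1 - h_i)^m h_i are at most 1/m, and where some h_i <= - e
   they are very negative; so p minus their sum is positive on the whole box. *)
pose m := ((Num.truncn ((P + 1) / e ^+ 2 + N%:R / e + N%:R)).+1).*2.
have m0 : (0 < m)%N by rewrite /m double_gt0.
have m0' : 0 < m%:R :> R by rewrite ltr0n.
(* The first summand lets m e^2 outweigh p >= - P where some h_i <= - e; the second makes the N
   small terms sum to less than e where p >= e; the third makes them sum to less than 1 in the other
   case. *)
have hm : (P + 1) / e ^+ 2 + N%:R / e + N%:R < m%:R.
  apply: (lt_le_trans (truncnS_gt _)); rewrite ler_nat /m -addnn leq_addr//.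
have t1 : 0 <= (P + 1) / e ^+ 2 by rewrite divr_ge0 ?sqr_ge0 ?addr_ge0.
have t2 : 0 <= N%:R / e by rewrite divr_ge0// ltW.
have NP : P + 1 <= m%:R * e ^+ 2.
  by rewrite -ler_pdivrMr ?exprn_gt0//; have : 0 <= N%:R :> R by []; lra.
have Ne : N%:R / m%:R < e :> R.
  by rewrite ltr_pdivrMr// mulrC -ltr_pdivrMr//; have : 0 <= N%:R :> R by []; lra.
have N1 : N%:R / m%:R < 1 :> R.
  by rewrite ltr_pdivrMr// mul1r; lra.
have hle1 i x : `|x| <= q -> `|peval (h i) x| <= 1.
  move=> xq; rewrite hE normrM normfV (gtr0_norm C0) ler_pdivrMl// mulr1.
  exact: hC.
have term i x : `|x| <= q -> (1 - peval (h i) x) ^+ m * peval (h i) x <= m%:R^-1.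
  move=> xq; have := hle1 i x xq; rewrite ler_norml => /andP[_ h1].
  have [h0|h0] := leP 0 (peval (h i) x); first by apply: pow1B_mul_le => //; rewrite h0.
  apply: (le_trans (pow1B_mul_le_neg _ (ltW h0))).
  by rewrite (@le_trans _ _ 0) ?invr_ge0// oppr_le0 mulr_ge0// sqr_ge0.
suff : M (p - \sum_i ((1 - h i) ^+ m * h i)).
  move=> Mq; rewrite -[p](subrK (\sum_i ((1 - h i) ^+ m * h i))); apply: MD => //.
  apply: quadratic_module_sum => // i.
  rewrite /m -muln2 exprM; apply: MX.
  by apply: quadratic_moduleZ => //; rewrite invr_ge0 ltW.
apply: principal_preorder_quadratic_module qM Mb _.
apply: principal_preorder_pos_box => x xq; rewrite pevalB peval_sum.
under eq_bigr do rewrite pevalM pevalXn pevalB peval1.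
have [pe|[i hi]] := he x xq.
  suff : \sum_i (1 - peval (h i) x) ^+ m * peval (h i) x <= N%:R / m%:R by lra.
  apply: (@le_trans _ _ (\sum_(i < N) m%:R^-1)); first by apply: ler_sum => i _; exact: term.
  by rewrite sumr_const card_ord mulr_natl.
have := hP x xq; rewrite ler_norml => /andP[pP _].
rewrite (bigD1 i)//=.
have : \sum_(j < N | j != i) (1 - peval (h j) x) ^+ m * peval (h j) x <= N%:R / m%:R.
  apply: (@le_trans _ _ (\sum_(j < N | j != i) m%:R^-1)); first by apply: ler_sum => j _; exact: term.
  have -> : N%:R / m%:R = \sum_(j < N) m%:R^-1 :> R by rewrite sumr_const card_ord mulr_natl.
  rewrite [leRHS](bigD1 i)//=.
  by rewrite lerDr invr_ge0.
have h0 : peval (h i) x <= 0 by lra.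
have := pow1B_mul_le_neg m h0.
have : m%:R * e ^+ 2 <= m%:R * peval (h i) x ^+ 2.
  have : 0 <= (peval (h i) x - e) * (peval (h i) x + e) by rewrite mulr_le0//; lra.
  by move=> ?; apply: ler_wpM2l; [exact: ltW|lra].
by move=> *; lra.
Qed.

End quadratic_modules.

(** * Approximation of Lipschitz functions by polynomials *)

Section bernstein_approximation.
Context {R : realType}.

Definition bernstein (d : nat) (y : R) (k : nat) : R :=
  'C(d, k)%:R * (y ^+ k * (1 - y) ^+ (d - k)).

Lemma bernstein_ge0 d y k : 0 <= y <= 1 -> 0 <= bernstein d y k.
Proof. by case/andP=> y0 y1; rewrite !mulr_ge0// exprn_ge0// subr_ge0. Qed.

(** The factorial moments of the binomial law; orders 0, 1 and 2 give its total mass and its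
    variance. *)
Lemma bernstein_moment d y a : (a <= d)%N ->
  \sum_(k < d.+1) 'C(k, a)%:R * bernstein d y k = 'C(d, a)%:R * y ^+ a.
Proof.
move=> ad; have := bernstein_monomial y (1 - y) ad.
rewrite addrCA subrr addr0 expr1n mulr1 => <-.
by apply: eq_bigr => k _; rewrite /bernstein natrM mulrA.
Qed.

Lemma sum_bernstein d y : \sum_(k < d.+1) bernstein d y k = 1.
Proof.
transitivity ('C(d, 0)%:R * y ^+ 0); last by rewrite bin0 expr0 mulr1.
rewrite -(bernstein_moment y (leq0n d)).
by apply: eq_bigr => k _; rewrite bin0 mul1r.
Qed.

Lemma bernstein_variance d y : (1 < d)%N -> 0 <= y <= 1 ->
  \sum_(k < d.+1) (k%:R / d%:R - y) ^+ 2 * bernstein d y k <= d%:R^-1.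
Proof.
move=> d1 /andP[y0 y1]; have d0 : (d%:R : R) != 0 by rewrite pnatr_eq0 -lt0n ltnW.
have bin2 (k : nat) : 'C(k, 2)%:R = k%:R * (k%:R - 1) / 2 :> R.
  case: k => [|k]; first by rewrite bin0n !mul0r.
  apply: (@mulfI _ 2%:R) => //; rewrite -natrM (mul_bin_left k.+1 1) subn1 bin1 natrM -natr1/=.
  by field.
have h1 := bernstein_moment y (ltnW d1); have h2 := bernstein_moment y d1.
rewrite bin1 expr1 in h1.
have -> : \sum_(k < d.+1) (k%:R / d%:R - y) ^+ 2 * bernstein d y k =
   2 / d%:R ^+ 2 * (\sum_(k < d.+1) 'C(k, 2)%:R * bernstein d y k) +
   (d%:R ^- 2 - 2 * y / d%:R) * (\sum_(k < d.+1) 'C(k, 1)%:R * bernstein d y k) +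
   y ^+ 2 * \sum_(k < d.+1) bernstein d y k.
  rewrite !mulr_sumr -!big_split/=; apply: eq_bigr => k _.
  by rewrite bin1 bin2; field.
rewrite h1 h2 sum_bernstein bin2.
rewrite (_ : _ + _ = (y * (1 - y)) * d%:R^-1); last by field.
rewrite ler_piMl ?invr_ge0//; nra.
Qed.

(** F is put into the i-th factor of a product of sums; distributing the product gives the left
    side, and all other factors are 1. *)
Lemma sum_ffun_marginal (n d : nat) (b : 'I_n -> 'I_d.+1 -> R) (i : 'I_n) (F : 'I_d.+1 -> R) :
  (forall j, \sum_c b j c = 1) ->
  \sum_(k : {ffun 'I_n -> 'I_d.+1}) F (k i) * \prod_j b j (k j) = \sum_c F c * b i c.
Proof.
move=> b1; transitivity (\prod_j \sum_c (if j == i then F c else 1) * b j c).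
  rewrite bigA_distr_bigA/=; apply: eq_bigr => k _.
  rewrite big_split/=; congr (_ * _).
  by rewrite (bigD1 i)//= eqxx big1 ?mulr1// => j /negbTE ->.
rewrite (bigD1 i)//= eqxx [X in _ * X]big1 ?mulr1// => j /negbTE ->.
by rewrite -[RHS](b1 j); apply: eq_bigr => c _; rewrite mul1r.
Qed.

Lemma sum_ffun_prod1 (n d : nat) (b : 'I_n -> 'I_d.+1 -> R) :
  (forall j, \sum_c b j c = 1) ->
  \sum_(k : {ffun 'I_n -> 'I_d.+1}) \prod_j b j (k j) = 1.
Proof. by move=> b1; rewrite -bigA_distr_bigA big1. Qed.

(** The multivariate Bernstein polynomial of V averages V over random nodes with independent
    binomial coordinates; the mean distance from node to x is controlled by the coordinate
    variances. *)
Lemma lipschitz_poly_approx (n : nat) (V : 'rV[R]_n -> R) (r L e : R) :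
  0 < r -> 0 <= L -> 0 < e ->
  (forall x y, `|x| <= r -> `|y| <= r -> `|V x - V y| <= L * `|x - y|) ->
  exists Q : {mpoly R[n]}, forall x, `|x| <= r -> `|peval Q x - V x| <= e.
Proof.
move=> r0 L0 e0 VL.
(* The final error is at most 2 L [del]: one share from the threshold [del] on the distance, the
   other from the variance term A / d. *)
pose del := e / (2 * (L + 1)).
have del0 : 0 < del by rewrite divr_gt0// mulr_gt0// ltr_wpDl.
have di0 : 0 <= del^-1 by rewrite invr_ge0 ltW.
pose A := n%:R * (2 * r) ^+ 2 / del.
have A0 : 0 <= A by apply: divr_ge0; [rewrite mulr_ge0// sqr_ge0|exact: ltW].
(* The two successors give d > 1, which [bernstein_variance] requires. *)
pose d := (Num.truncn (A / del)).+2.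
have dA : A / d%:R <= del.
  rewrite ler_pdivrMr ?ltr0n// mulrC -ler_pdivrMr//.
  by rewrite (le_trans (ltW (truncnS_gt _)))// ler_nat.
pose node (k : {ffun 'I_n -> 'I_d.+1}) : 'rV[R]_n := \row_i (2 * r * (k i)%:R / d%:R - r).
pose Y i := (2 * r)^-1 *: (mpolyX R (mnm1 i) + mpolyC n r) : {mpoly R[n]}.
exists (\sum_k V (node k) *: \prod_i ('C(d, k i)%:R *: (Y i ^+ k i * (1 - Y i) ^+ (d - k i)))).
move=> x xr.
pose y i := (2 * r)^-1 * (x ord0 i + r).
have r20 : 0 < 2 * r by rewrite mulr_gt0.
have xi i : - r <= x ord0 i <= r by rewrite -ler_norml (le_trans (le_coord_norm _ _)).
have y01 i : 0 <= y i <= 1.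
  have /andP[xi0 xi1] := xi i; apply/andP; split.
    by apply: mulr_ge0; [rewrite invr_ge0 ltW|lra].
  by rewrite ler_pdivrMl// mulr1; lra.
have noder k : `|node k| <= r.
  apply: norm_rV_le; first exact: ltW.
  move=> i; rewrite mxE -mulrA ler_norml.
  have /andP[? ?] := @ratio01 R (k i) d (ltn_ord (k i)).
  by apply/andP; split; nra.
pose b i (c : 'I_d.+1) := bernstein d (y i) c.
have b1 j : \sum_c b j c = 1 by exact: sum_bernstein.
have b0 k : 0 <= \prod_i b i (k i : 'I_d.+1).
  by apply: prodr_ge0 => i _; exact: bernstein_ge0.
have -> : peval (\sum_k V (node k) *: \prod_i ('C(d, k i)%:R *: (Y i ^+ k i * (1 - Y i) ^+ (d - k i)))) x
    = \sum_k V (node k) * \prod_i b i (k i).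
  rewrite peval_sum; apply: eq_bigr => k _; rewrite pevalZ peval_prod; congr (_ * _).
  apply: eq_bigr => i _; rewrite pevalZ pevalM !pevalXn pevalB peval1.
  by rewrite pevalZ pevalD pevalXU pevalC.
rewrite -[V x]mulr1 -[X in V x * X](sum_ffun_prod1 b1) mulr_sumr -sumrB.
under eq_bigr do rewrite -mulrBl.
apply: (@le_trans _ _ (\sum_(k : {ffun 'I_n -> 'I_d.+1})
    (L * del * \prod_j b j (k j) +
    \sum_i L / del * (2 * r) ^+ 2 * (((k i)%:R / d%:R - y i) ^+ 2 * \prod_j b j (k j))))).
  rewrite (le_trans (ler_norm_sum _ _ _))//; apply: ler_sum => k _.
  rewrite normrM (ger0_norm (b0 k)).
  have -> : \sum_i L / del * (2 * r) ^+ 2 * (((k i)%:R / d%:R - y i) ^+ 2 * \prod_j b j (k j)) =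
      (\sum_i L / del * (2 * r) ^+ 2 * ((k i)%:R / d%:R - y i) ^+ 2) * \prod_j b j (k j).
    by rewrite mulr_suml; apply: eq_bigr => i _; rewrite mulrA.
  rewrite -mulrDl; apply: ler_wpM2r => //.
  rewrite (le_trans (VL _ _ (noder k) xr))//.
  have -> : L * del + \sum_i L / del * (2 * r) ^+ 2 * ((k i)%:R / d%:R - y i) ^+ 2 =
    L * (del + \sum_i del^-1 * ((node k - x) ord0 i) ^+ 2).
    rewrite mulrDr mulr_sumr; congr (_ + _); apply: eq_bigr => i _.
    have -> : (node k - x) ord0 i = 2 * r * ((k i)%:R / d%:R - y i).
      by rewrite !mxE /y; field; rewrite gt_eqF//= pnatr_eq0.
    by ring.
  apply: ler_wpM2l => //; apply: norm_rV_le.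
    by apply: addr_ge0; [exact: ltW|apply: sumr_ge0 => i _; rewrite mulr_ge0// sqr_ge0].
  move=> i; rewrite (bigD1 i)//= addrA ler_wpDr//.
    by apply: sumr_ge0 => j _; rewrite mulr_ge0// sqr_ge0.
  (* |t| <= del + t^2 / del trades the distance for a square, whose mean is a variance. *)
  move: ((node k - x) ord0 i) => t.
  rewrite -(ler_pM2l del0) mulrDr (mulrA del del^-1) (mulfV (lt0r_neq0 del0)) mul1r.
  by rewrite -(real_normK (num_real t)); move: `|t| (normr_ge0 t) => s s0; nra.
rewrite big_split/= -mulr_sumr sum_ffun_prod1// mulr1 exchange_big/=.
apply: (@le_trans _ _ (L * del + \sum_(i < n) L / del * (2 * r) ^+ 2 * d%:R^-1)).
  rewrite lerD2l; apply: ler_sum => i _; rewrite -mulr_sumr ler_wpM2l//.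
    by apply: mulr_ge0; [exact: mulr_ge0|exact: sqr_ge0].
  rewrite (sum_ffun_marginal i (fun c : 'I_d.+1 => (c%:R / d%:R - y i) ^+ 2) b1).
  exact: bernstein_variance.
rewrite sumr_const card_ord -mulr_natl.
rewrite (_ : _ + _ = L * (del + A / d%:R)); last first.
  by rewrite /A; ring.
apply: (@le_trans _ _ (L * (del + del))); first by rewrite ler_wpM2l// lerD2l.
rewrite /del (_ : _ * _ = L / (L + 1) * e); last by field; lra.
by rewrite ler_piMl//; [exact: ltW|rewrite ler_pdivrMr; lra].
Qed.

End bernstein_approximation.

(** * Averaging a polynomial over small cubes *)

Section averaging.
Context {R : realType} {n : nat}.
Variables (Q : {mpoly R[n]}) (e : R).
Hypothesis e0 : 0 < e.

Lemma is_derive_bigsum (I : Type) (s : seq I) (F : I -> R -> R) (dF : I -> R) (t : R) :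
  (forall i, is_derive t (1 : R) (F i) (dF i)) ->
  is_derive t (1 : R) (fun z => \sum_(i <- s) F i z) (\sum_(i <- s) dF i).
Proof.
move=> h; elim: s => [|i s ih].
  rewrite big_nil (_ : (fun z => _) = fun=> 0); first exact: is_derive_cst.
  by apply/funext => z; rewrite big_nil.
rewrite big_cons (_ : (fun z => _) = F i + (fun z => \sum_(i <- s) F i z)).
  exact: is_deriveD.
by apply/funext => z; rewrite big_cons.
Qed.

Lemma is_derive_shiftX (a t : R) (k : nat) :
  is_derive t (1 : R) (fun z => (a + z) ^+ k.+1) (k.+1%:R * (a + t) ^+ k).
Proof.
have h : is_derive t (1 : R) (fun z : R => a + z) 1.
  have := is_deriveD (is_derive_cst a t (1 : R)) (is_derive_id t (1 : R)).
  by rewrite add0r.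
have := is_deriveX k.+1 h; rewrite /GRing.scale/= mulr1.
rewrite (_ : (fun z => a + z) ^+ k.+1 = (fun z => (a + z) ^+ k.+1))//.
by apply/funext => z; rewrite exprfctE.
Qed.

(** The mean of s^k over the segment [t, t + e], in closed form so that averaging keeps polynomials
    polynomial. *)
Definition avg_monomial (k : nat) (t : R) : R :=
  ((t + e) ^+ k.+1 - t ^+ k.+1) / (e * k.+1%:R).

(* [avg_poly S] averages Q over the segment [x_j, x_j + e] for every j in S. *)
Definition avg_poly (S : pred 'I_n) : {mpoly R[n]} :=
  \sum_(m <- msupp Q) mcoeff m Q *: \prod_j
    (if S j then (e * (m j).+1%:R)^-1 *:
        ((mpolyX R (mnm1 j) + mpolyC n e) ^+ (m j).+1 - mpolyX R (mnm1 j) ^+ (m j).+1)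
     else mpolyX R (mnm1 j) ^+ m j).

Lemma peval_avg_poly S x : peval (avg_poly S) x =
  \sum_(m <- msupp Q) mcoeff m Q *
     \prod_j (if S j then avg_monomial (m j) (x ord0 j) else x ord0 j ^+ m j).
Proof.
rewrite /avg_poly peval_sum; apply: eq_bigr => m _; rewrite pevalZ peval_prod.
congr (_ * _); apply: eq_bigr => j _; case: ifP => _; last by rewrite pevalXn pevalXU.
by rewrite pevalZ pevalB !pevalXn pevalD pevalXU pevalC mulrC.
Qed.

Lemma avg_poly_nil x : peval (avg_poly (fun=> false)) x = peval Q x.
Proof. by rewrite peval_avg_poly pevalE. Qed.

Definition along (x : 'rV[R]_n) (j : 'I_n) (t : R) : 'rV[R]_n := x + t *: delta_mx ord0 j.

Lemma alongE x j t i : along x j t ord0 i = x ord0 i + (i == j)%:R * t.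
Proof. by rewrite !mxE eqxx/= mulrC. Qed.

(** The mean value theorem is applied to an antiderivative of the whole weighted sum rather than to
    each term, so one shift t serves all the points of s. *)
Lemma avg_poly_step (S S' : pred 'I_n) (j : 'I_n) (s : seq (R * 'rV[R]_n)) :
  ~~ S j -> (forall i, S' i = (i == j) || S i) ->
  exists2 t, 0 <= t <= e &
    \sum_(z <- s) z.1 * peval (avg_poly S') z.2 =
    \sum_(z <- s) z.1 * peval (avg_poly S) (along z.2 j t).
Proof.
move=> Sj S'E.
pose K (z : R * 'rV[R]_n) m := z.1 * (mcoeff m Q * \prod_(i | i != j)
  (if S i then avg_monomial (m i) (z.2 ord0 i) else z.2 ord0 i ^+ m i)).
pose F t := \sum_(z <- s) \sum_(m <- msupp Q)
  (K z m / (m j).+1%:R) *: (z.2 ord0 j + t) ^+ (m j).+1.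
pose f t := \sum_(z <- s) z.1 * peval (avg_poly S) (along z.2 j t).
have dF t : is_derive t (1 : R) F (f t).
  rewrite /F; have -> : f t = \sum_(z <- s) \sum_(m <- msupp Q)
      (K z m / (m j).+1%:R) *: ((m j).+1%:R * (z.2 ord0 j + t) ^+ m j).
    apply: eq_bigr => z _; rewrite peval_avg_poly mulr_sumr; apply: eq_bigr => m _.
    rewrite (bigD1 j)//= (negbTE Sj) alongE eqxx mul1r /GRing.scale/= [RHS]mulrA.
    rewrite divfK ?pnatr_eq0// /K.
    have -> : \prod_(i | i != j) (if S i then avg_monomial (m i) (along z.2 j t ord0 i)
        else along z.2 j t ord0 i ^+ m i) = \prod_(i | i != j)
        (if S i then avg_monomial (m i) (z.2 ord0 i) else z.2 ord0 i ^+ m i).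
      by apply: eq_bigr => i /negbTE ij; rewrite alongE ij mul0r addr0.
    by ring.
  apply: is_derive_bigsum => z; apply: is_derive_bigsum => m.
  exact: is_deriveZ (is_derive_shiftX _ _ _).
have [|c + hc] := @MVT R F f 0 e e0 (fun t _ => dF t).
  by apply: continuous_subspaceT => t; apply/differentiable_continuous/derivable1_diffP; case: (dF t).
rewrite in_itv/= => /andP[/ltW c0 /ltW c1].
exists c; first by rewrite c0.
apply: (@mulIf _ e); first by rewrite gt_eqF.
rewrite -/(f c) -[in RHS](subr0 e) -hc /F mulr_suml -sumrB; apply: eq_bigr => z _.
rewrite peval_avg_poly -sumrB -mulrA mulr_suml mulr_sumr; apply: eq_bigr => m _.
rewrite (bigD1 j)//= S'E eqxx /= /GRing.scale/= /K.
have -> : \prod_(i | i != j) (if S' i then avg_monomial (m i) (z.2 ord0 i)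
    else z.2 ord0 i ^+ m i) = \prod_(i | i != j)
    (if S i then avg_monomial (m i) (z.2 ord0 i) else z.2 ord0 i ^+ m i).
  by apply: eq_bigr => i /negbTE ij; rewrite S'E ij.
rewrite /avg_monomial addr0.
have := @pnatr_eq0 R (m j).+1; move: ((m j).+1%:R : R) => M /= /negbT M0.
by field; rewrite M0 gt_eqF.
Qed.

(** The averaged coordinates are undone one at a time; the shift found for j is absorbed into the
    sample points before the induction hypothesis is used. *)
Lemma avg_poly_mean (J : seq 'I_n) (s : seq (R * 'rV[R]_n)) : uniq J ->
  exists2 th : 'rV[R]_n, (forall i, 0 <= th ord0 i <= e) /\
      (forall i, i \notin J -> th ord0 i = 0) &
    \sum_(z <- s) z.1 * peval (avg_poly (mem J)) z.2 =
    \sum_(z <- s) z.1 * peval Q (z.2 + th).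
Proof.
elim: J s => [|j J ih] s; first move=> _.
  exists 0; first by split=> i; rewrite ?mxE// lexx ltW.
  by apply: eq_bigr => z _; rewrite addr0 -avg_poly_nil !peval_avg_poly.
move=> /= /andP[jJ uJ].
have [|t t01 ->] := @avg_poly_step (mem J) (mem (j :: J)) j s jJ; first by move=> i; rewrite inE.
have [th [th01 thJ] h] := ih [seq (z.1, along z.2 j t) | z <- s] uJ.
rewrite !big_map/= in h; rewrite h.
have thE i : along th j t ord0 i = if i == j then t else th ord0 i.
  rewrite alongE; case: eqVneq => [->|]; last by rewrite mul0r addr0.
  by rewrite mul1r thJ// add0r.
exists (along th j t); first split=> i.
- by rewrite thE; case: ifP.
- by rewrite inE negb_or thE => /andP[/negbTE -> /thJ].
- by apply: eq_bigr => z _; rewrite /along -addrA [in LHS](addrC _ th).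
Qed.

(** The fundamental theorem of calculus: differentiating an average over [x_i, x_i + e] gives a
    difference quotient with step e, the other averages being untouched. *)
Lemma mderiv_avg_poly (i : 'I_n) (S S' : pred 'I_n) x :
  S i -> (forall j, S' j = (j != i) && S j) ->
  e * peval (mderiv i (avg_poly S)) x =
    peval (avg_poly S') (along x i e) - peval (avg_poly S') x.
Proof.
move=> Si S'E.
pose K m := mcoeff m Q * \prod_(j | j != i)
  (if S j then avg_monomial (m j) (x ord0 j) else x ord0 j ^+ m j).
have d1 : is_derive (0 : R) (1 : R) (fun t => peval (avg_poly S) (along x i t))
    (peval (mderiv i (avg_poly S)) x).
  have h (j : 'I_n) : is_derive (0 : R) (1 : R) (fun t => along x i t ord0 j) (j == i)%:R.
    rewrite (_ : (fun t => _) = (fun t => cst (x ord0 j) t + ((j == i)%:R *: id) t)); last first.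
      by apply/funext => t; rewrite alongE.
    have := is_deriveD (is_derive_cst (x ord0 j) (0 : R) (1 : R))
      (is_deriveZ (j == i)%:R (is_derive_id (0 : R) (1 : R))).
    by rewrite add0r /GRing.scale/= mulr1.
  have := is_derive_peval (avg_poly S) h; rewrite (bigD1 i)//= eqxx mulr1 big1 ?addr0.
    by rewrite /along scale0r addr0.
  by move=> j /negbTE ->; rewrite mulr0.
pose G t := \sum_(m <- msupp Q) (K m / (e * (m i).+1%:R)) *:
    ((x ord0 i + e + t) ^+ (m i).+1 - (x ord0 i + t) ^+ (m i).+1).
have GE t : peval (avg_poly S) (along x i t) = G t.
  rewrite peval_avg_poly; apply: eq_bigr => m _.
  rewrite (bigD1 i)//= Si alongE eqxx mul1r /avg_monomial /GRing.scale/= addrAC.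
  have -> : \prod_(j | j != i) (if S j then ((along x i t ord0 j + e) ^+ (m j).+1 -
        along x i t ord0 j ^+ (m j).+1) / (e * (m j).+1%:R) else along x i t ord0 j ^+ m j) =
      \prod_(j | j != i) (if S j then avg_monomial (m j) (x ord0 j) else x ord0 j ^+ m j).
    by apply: eq_bigr => j /negbTE ji; rewrite alongE ji mul0r addr0.
  by rewrite /K; ring.
have d2 : is_derive (0 : R) (1 : R) G (\sum_(m <- msupp Q) (K m / (e * (m i).+1%:R)) *:
    ((m i).+1%:R * (x ord0 i + e + 0) ^+ (m i) - (m i).+1%:R * (x ord0 i + 0) ^+ (m i))).
  apply: is_derive_bigsum => m; apply: is_deriveZ.
  by apply: is_deriveB; exact: is_derive_shiftX.
have : peval (mderiv i (avg_poly S)) x = \sum_(m <- msupp Q) (K m / (e * (m i).+1%:R)) *: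
    ((m i).+1%:R * (x ord0 i + e + 0) ^+ (m i) - (m i).+1%:R * (x ord0 i + 0) ^+ (m i)).
  rewrite -(@derive_val _ _ _ _ _ _ _ d1) -(@derive_val _ _ _ _ _ _ _ d2).
  by have <- : (fun t => peval (avg_poly S) (along x i t)) = G by apply/funext.
move=> ->; rewrite !peval_avg_poly mulr_sumr -sumrB; apply: eq_bigr => m _.
rewrite [X in _ = _ * X - _](bigD1 i)//= [X in _ = _ - _ * X](bigD1 i)//= S'E eqxx/= alongE eqxx mul1r !addr0.
have h y : (forall j, j != i -> y ord0 j = x ord0 j) ->
   \prod_(j | j != i) (if S' j then avg_monomial (m j) (y ord0 j) else y ord0 j ^+ m j)
   = \prod_(j | j != i) (if S j then avg_monomial (m j) (x ord0 j) else x ord0 j ^+ m j).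
  by move=> yx; apply: eq_bigr => j ji; rewrite S'E ji yx.
rewrite !h//; last by move=> j /negbTE ji; rewrite alongE ji mul0r addr0.
rewrite /K /GRing.scale/=.
have := @pnatr_eq0 R (m i).+1; move: ((m i).+1%:R : R) => M /= /negbT M0.
by field; rewrite M0 gt_eqF.
Qed.

(** Stated for weighted lists of points so that differences of values, or of partial derivatives, of
    P become the same differences for Q at a common shift; separate shifts would cost an error of
    order e. *)
Lemma poly_mollification : exists P : {mpoly R[n]},
  (forall s : seq (R * 'rV[R]_n), exists2 th : 'rV[R]_n, forall i, 0 <= th ord0 i <= e &
    \sum_(z <- s) z.1 * peval P z.2 = \sum_(z <- s) z.1 * peval Q (z.2 + th)) /\
  (forall i (s : seq (R * 'rV[R]_n)), exists2 th : 'rV[R]_n, forall i, 0 <= th ord0 i <= e &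
    \sum_(z <- s) z.1 * (e * peval (mderiv i P) z.2) =
    \sum_(z <- s) z.1 * (peval Q (along (z.2 + th) i e) - peval Q (z.2 + th))).
Proof.
exists (avg_poly (mem (enum 'I_n))); split=> [s|i s].
  by have [th [h _] ->] := avg_poly_mean s (enum_uniq 'I_n); exists th.
pose J := rem i (enum 'I_n).
have uJ : uniq J by exact/rem_uniq/enum_uniq.
(* Doubling the list with opposite weights encodes the difference quotients, again with one shift
   for all. *)
have := @avg_poly_mean J ([seq (z.1, along z.2 i e) | z <- s] ++ [seq (- z.1, z.2) | z <- s]) uJ.
case=> th [h _]; rewrite !big_cat !big_map/= -!big_split/= => E.
exists th => //.
transitivity (\sum_(z <- s) (z.1 * peval (avg_poly (mem J)) (along z.2 i e) +
   - z.1 * peval (avg_poly (mem J)) z.2)).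
  apply: eq_bigr => z _; rewrite (@mderiv_avg_poly _ _ (mem J)); first by ring.
    by rewrite /= mem_enum.
  by move=> j /=; rewrite mem_rem_uniq ?enum_uniq// inE/= mem_enum.
rewrite E; apply: eq_bigr => z _.
by rewrite /along addrAC; ring.
Qed.

End averaging.

(** * Discounted value iteration *)

Section value_iteration.
Context {R : realType} {n : nat} {W : Type}.
Variables (F : 'rV[R]_n -> W -> 'rV[R]_n) (U : set W) (g : R) (c : 'rV[R]_n -> R) (K : R).

(* [value j x] is the supremum over controls of the minimum over i <= j of
   g ^+ i * c (x_i), computed by dynamic programming. *)
Fixpoint value (j : nat) (x : 'rV[R]_n) : R :=
  if j is k.+1 then Num.min (c x) (g * sup [set value k (F x u) | u in U]) else c x.

Hypotheses (U0 : U !=set0) (g0 : 0 < g) (g1 : g <= 1).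
Hypothesis cK : forall x, - K <= c x <= 0.

Lemma value_image_neq0 k x : [set value k (F x u) | u in U] !=set0.
Proof. by case: U0 => u Uu; exists (value k (F x u)), u. Qed.

Lemma value_bounds j x : - K <= value j x <= 0.
Proof.
elim: j x => [|j ih] x /=; first exact: cK.
have /andP[cx0 cx1] := cK x.
rewrite le_min cx0 /= ge_min cx1 /= andbT.
case: U0 => u Uu; have /andP[h0 h1] := ih (F x u).
have h : value j (F x u) <= sup [set value j (F x u) | u in U].
  apply: ub_le_sup; last by exists u.
  by exists 0 => _ [w _ <-]; case/andP: (ih (F x w)).
move: (sup _) h => s h; have K0 : 0 <= K by lra.
have [s0|s0] := leP 0 s; first by have := mulr_ge0 (ltW g0) s0; lra.
have : s <= g * s by rewrite -[leLHS]mul1r ler_nM2r.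
by lra.
Qed.

Lemma le_sup_value k x u : U u -> value k (F x u) <= sup [set value k (F x u) | u in U].
Proof.
move=> Uu; apply: ub_le_sup; last by exists u.
by exists 0 => _ [w _ <-]; case/andP: (value_bounds k (F x w)).
Qed.

Lemma sup_value_le k x b : (forall u, U u -> value k (F x u) <= b) ->
  sup [set value k (F x u) | u in U] <= b.
Proof. by move=> h; apply: ge_sup; [exact: value_image_neq0|move=> _ [u Uu <-]; exact: h]. Qed.

Lemma value_dec j x : value j.+1 x <= value j x.
Proof.
elim: j x => [|j ih] x; first by rewrite /= ge_min lexx.
rewrite (_ : value j.+2 x =
  Num.min (c x) (g * sup [set value j.+1 (F x u) | u in U]))//.
rewrite (_ : value j.+1 x = Num.min (c x) (g * sup [set value j (F x u) | u in U]))//.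
rewrite le_min ge_min lexx ge_min orTb andTb; apply/orP; right.
rewrite ler_pM2l//; apply: sup_value_le => u Uu.
exact: le_trans (ih _) (le_sup_value _ _ Uu).
Qed.

(** Where the cost vanishes the minimum reduces to the discounted supremum, and monotonicity in the
    horizon lets the same finite j stand on both sides. *)
Lemma value_supersolution j x u : c x = 0 -> U u -> g * value j (F x u) <= value j x.
Proof.
move=> cx Uu; have /andP[_ h0] := value_bounds j (F x u).
case: j h0 => [|j] h0; first by rewrite [leRHS]/= cx pmulr_rle0.
rewrite [leRHS]/= cx le_min; apply/andP; split; first by rewrite pmulr_rle0.
rewrite ler_pM2l//; apply: le_trans (value_dec _ _) _; exact: le_sup_value.
Qed.

(** The constant grows geometrically with the horizon; this is harmless because the horizon is fixed
    before the precision of the polynomial approximation. *)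
Lemma value_lipschitz (Lc La : R) : 0 <= Lc -> 1 <= La ->
  (forall x y, `|c x - c y| <= Lc * `|x - y|) ->
  (forall x y u, U u -> `|F x u - F y u| <= La * `|x - y|) ->
  forall j x y, `|value j x - value j y| <= Lc * La ^+ j * `|x - y|.
Proof.
move=> Lc0 La1 hc hF.
suff h j x y : value j x <= value j y + Lc * La ^+ j * `|x - y|.
  move=> j x y; rewrite ler_norml; apply/andP; split.
    by have := h j y x; rewrite distrC; lra.
  by have := h j x y; lra.
have La0 k : 0 <= La ^+ k by rewrite exprn_ge0//; lra.
elim: j x y => [|j ih] x y.
  by have := hc x y; rewrite expr0 mulr1 ler_norml /= => /andP[]; lra.
rewrite [leLHS]/= [value j.+1 y]/= addr_minl le_min !ge_min; apply/andP; split; apply/orP.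
  left; have := hc x y; rewrite ler_norml => /andP[_ h].
  have : Lc * `|x - y| <= Lc * La ^+ j.+1 * `|x - y|.
    by apply: ler_wpM2r => //; rewrite ler_peMr// exprn_ege1.
  by lra.
right.
have B0 : 0 <= Lc * La ^+ j.+1 * `|x - y| by rewrite !mulr_ge0.
set s := sup [set value j (F y u) | u in U].
have : sup [set value j (F x u) | u in U] <= s + Lc * La ^+ j.+1 * `|x - y|.
  apply: sup_value_le => u Uu; apply: le_trans (ih _ (F y u)) _; apply: lerD.
    exact: le_sup_value.
  rewrite exprSr mulrA -(mulrA _ La); apply: ler_wpM2l; first by rewrite mulr_ge0.
  exact: hF.
move: (sup _) B0; set B := Lc * _ * _; move=> t B0.
have gB : g * B <= B by rewrite ler_piMl.
by rewrite -(ler_pM2l g0) mulrDr; lra.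
Qed.

(** The strict bound lets a control be picked although the supremum may not be attained; after one
    step the threshold becomes a / g, which matches the discounting of later costs. *)
Lemma value_chain j x a : 0 < a -> - a < value j x ->
  exists (xs : nat -> 'rV[R]_n) (us : nat -> W), [/\ xs 0%N = x,
    forall i, (i < j)%N -> U (us i) /\ xs i.+1 = F (xs i) (us i) &
    forall i, (i <= j)%N -> - a < g ^+ i * c (xs i)].
Proof.
elim: j x a => [|j ih] x a a0.
  move=> h; case: U0 => u Uu; exists (fun=> x), (fun=> u); split => // i.
  by rewrite leqn0 => /eqP ->; rewrite expr0 mul1r.
rewrite /= lt_min => /andP[h1 h2].
have : - (a / g) < sup [set value j (F x u) | u in U].
  by rewrite -(ltr_pM2l g0) mulrN mulrCA mulfV ?gt_eqF// mulr1.
case/sup_gt; first exact: value_image_neq0.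
move=> _ [u Uu <-] h3.
have [ys [us [ys0 hys hc]]] := ih (F x u) (a / g) (divr_gt0 a0 g0) h3.
exists (fun i => if i is k.+1 then ys k else x), (fun i => if i is k.+1 then us k else u).
split=> // [[|i]|[|i]] ij.
- by split=> //; rewrite ys0.
- exact: hys.
- by rewrite expr0 mul1r.
- rewrite exprS -mulrA; have := hc i ij.
  by rewrite -(ltr_pM2l g0) mulrN mulrCA mulfV ?gt_eqF// mulr1.
Qed.

End value_iteration.

(** * Lipschitz and absolutely continuous functions *)

Section lipschitz_derivable.
Context {R : realType}.
Variables (f : R -> R).
Hypothesis f_lip : forall x y, `|f x - f y| <= `|x - y|.

Let lip_lo x y : x <= y -> f y - f x <= y - x /\ f x - f y <= y - x.
Proof.
move=> xy; have := f_lip y x; rewrite [leRHS]ger0_norm ?subr_ge0// ler_norml.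
by move=> /andP[? ?]; split; lra.
Qed.

Lemma lipschitz1_continuous : continuous f.
Proof.
move=> x; apply/cvgrPdist_lt => e e0; exists e => //= y /= xy.
exact: le_lt_trans (f_lip _ _) xy.
Qed.

(* Both functions are nondecreasing and sum to the identity, so their Stieltjes
   measures are dominated by the Lebesgue measure: Radon-Nikodym and the
   fundamental theorem of calculus then give the derivative of f. *)
Definition lip_up (t : R) : R := (t + f t) / 2.
Definition lip_down (t : R) : R := (t - f t) / 2.

Let up_nd : nondecreasing lip_up.
Proof. by move=> x y xy; have := lip_lo xy; rewrite /lip_up; lra. Qed.

Let down_nd : nondecreasing lip_down.
Proof. by move=> x y xy; have := lip_lo xy; rewrite /lip_down; lra. Qed.

Let up_rc : right_continuous lip_up.
Proof.
apply: right_continuousW => x; apply: cvgMl; apply: cvgD; first exact: cvg_id.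
exact: lipschitz1_continuous.
Qed.

Let down_rc : right_continuous lip_down.
Proof.
apply: right_continuousW => x; apply: cvgMl; apply: cvgB; first exact: cvg_id.
exact: lipschitz1_continuous.
Qed.

HB.instance Definition _ := isCumulative.Build R _ R lip_up up_nd up_rc.
HB.instance Definition _ := isCumulative.Build R _ R lip_down down_nd down_rc.

Let mu_up := lebesgue_stieltjes_measure (lip_up : cumulative R R).
Let mu_down := lebesgue_stieltjes_measure (lip_down : cumulative R R).

Let stieltjes_oc (g : cumulative R R) (a b : R) : a <= b ->
  lebesgue_stieltjes_measure g `]a, b]%classic = (g b - g a)%:E.
Proof.
move=> ab; rewrite /lebesgue_stieltjes_measure/= /measure_extension/=.
rewrite measurable_mu_extE/=; last exact: is_ocitv.
by rewrite wlength_itv_bnd.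
Qed.

Let lebesgue_sum A : measurable A -> lebesgue_measure A = (mu_up A + mu_down A)%E.
Proof.
move=> mA; rewrite (@lebesgue_measure_unique _ (measure_add mu_up mu_down))//.
  exact: measure_addE.
move=> X /ocitvP[->|[[a b] /= /ltW ab ->]]; first by rewrite measure0 [RHS]measure0.
apply: etrans (esym (measure_addE _ _ _)).
transitivity ((lip_up b - lip_up a)%:E + (lip_down b - lip_down a)%:E)%E; last first.
  by congr (_ + _)%E; apply: esym; exact: stieltjes_oc.
apply: etrans; first exact: (@lebesgue_measure_itv R `]a, b]).
rewrite /= lte_fin; move: ab; rewrite le_eqVlt => /predU1P[->|->].
  by rewrite ltxx !subrr adde0.
by rewrite -EFinD; congr EFin; rewrite /lip_up /lip_down; lra.
Qed.

Lemma lipschitz1_ae_derivable_itv (k : R) :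
  {ae lebesgue_measure, forall t, - k < t < k -> derivable f t 1}.
Proof.
have [k0|k0] := ltP k 0.
  by apply/aeW => t /andP[]; lra.
(* Restriction to a bounded interval makes the Stieltjes measure of [lip_up] finite. *)
pose D : set (measurableTypeR R) := `]-k, k]%classic.
have mD : measurable D by exact: measurable_itv.
have Dfin : (mu_up D < +oo)%E by rewrite /mu_up /D stieltjes_oc ?ltry//; lra.
pose nu := mfrestr mD Dfin.
have nu_dom : nu `<< (@lebesgue_measure R).
  apply/null_content_dominatesP => A mA A0.
  have mAD : measurable (A `&` D) by exact: measurableI.
  have : lebesgue_measure (A `&` D) = 0%E.
    by apply: subset_measure0 A0 => //; exact: subIsetl.
  rewrite lebesgue_sum// => /eqP; rewrite padde_eq0// => /andP[/eqP h _].
  by rewrite /nu /mfrestr /mrestr h.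
have [g [g0 gfin gint nuE]] := radon_nikodym_sigma_finite nu_dom.
have fgint : lebesgue_measure.-integrable setT (EFin \o (fine \o g)).
  apply: eq_integrable gint => // x _ /=; by rewrite fineK.
have gloc : locally_integrable setT (fine \o g) by exact: (open_integrable_locally openT fgint).
have fgintS y : lebesgue_measure.-integrable [set` Interval (BRight (- k)) (BRight y)]
    (EFin \o (fine \o g)).
  apply: (integrableS _ _ _ fgint) => //; exact: measurable_itv.
have := @FTC1 R (fine \o g) (BRight (- k)) fgintS gloc.
apply: filterS; first exact: (ae_filter_ringOfSetsType lebesgue_measure).
move=> t h /andP[kt tk].
have [ht _] := h (kt : BRight (-k) < BRight t)%O.
have upE y : -k < y -> y < k ->
    (\int[lebesgue_measure]_(t in [set` Interval (BRight (-k)) (BRight y)]) (fine \o g) t)%R =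
    lip_up y - lip_up (-k).
  move=> ky yk; apply: EFin_inj.
  rewrite /Rintegral fineK; last first.
    by apply: integrable_fin_num (fgintS y); exact: measurable_itv.
  rewrite (eq_integral g); last by move=> x _ /=; rewrite fineK.
  rewrite -nuE; last exact: measurable_itv.
  have E : (`]- k, y]%classic : set R) `&` D = `]- k, y]%classic.
    apply/seteqP; split=> [x []//|x]; rewrite /D /= !in_itv/= => /andP[kx xy].
    by rewrite kx xy (le_trans xy (ltW yk)).
  transitivity (mu_up ((`]- k, y]%classic : set R) `&` D)); first by [].
  by rewrite E; exact: stieltjes_oc (ltW ky).
pose h0 y := lip_up y - lip_up (- k).
have hu : derivable h0 t 1.
  apply: (near_eq_derivable _ ht); near=> y; apply: upE.
    by near: y; exact: lt_nbhsr.
  by near: y; exact: lt_nbhsl.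
(* f = 2 [lip_up] - id, so f is differentiable wherever [lip_up] is. *)
have -> : f = (2 *: h0) - (fun y => y - 2 * lip_up (- k)).
  by apply/funext => y; rewrite !fctE /h0 /lip_up /GRing.scale/=; field.
move: h0 hu => h0 hu.
apply: derivableB; first exact: derivableZ.
by apply: derivableB; [exact: derivable_id|exact: derivable_cst].
Unshelve. all: by end_near. Qed.

End lipschitz_derivable.

Lemma lipschitz_ae_derivable {R : realType} (f : R -> R) (M : R) :
  (forall x y, `|f x - f y| <= M * `|x - y|) ->
  {ae lebesgue_measure, forall t, derivable f t 1}.
Proof.
move=> fM; pose N := `|M| + 1; have N0 : 0 < N by rewrite ltr_wpDl.
pose h x := N^-1 * f x.
have hlip x y : `|h x - h y| <= `|x - y|.
  rewrite /h -mulrBr normrM gtr0_norm ?invr_gt0// ler_pdivrMl//.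
  apply: le_trans (fM x y) _; apply: ler_wpM2r => //.
  by rewrite /N (le_trans (ler_norm M))// lerDl.
have : {ae lebesgue_measure, forall t : R, forall k : nat, - (k%:R) < t < k%:R -> derivable h t 1}.
  by apply/ae_foralln => k; exact: lipschitz1_ae_derivable_itv.
apply: filterS; first exact: (ae_filter_ringOfSetsType lebesgue_measure).
move=> t ht.
have -> : f = N *: h.
  by apply/funext => x; rewrite /h /= !fctE /GRing.scale/= mulrA mulfV ?mul1r// gt_eqF.
apply: derivableZ; apply: (ht (Num.bound `|t|)).
by rewrite -ltr_norml; exact: archi_boundP.
Qed.

(** * Monotonicity of absolutely continuous functions *)

Section absolute_continuity.
Context {R : realType}.

(** P passes from points just left of t to t, so it holds at the supremum of the points of [0, b]
    satisfying it; P also passes from t to points just right of t, so this supremum cannot be below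
    b. *)
Lemma real_induction (P : R -> Prop) (b : R) : 0 <= b -> P 0 ->
  (forall t, 0 <= t <= b -> exists2 d, 0 < d & forall s s', 0 <= s -> s <= t ->
     t <= s' -> s' <= b -> t - s < d -> s' - t < d -> (P s -> P t) /\ (P t -> P s')) ->
  P b.
Proof.
move=> b0 P0 hP; pose S := [set t | 0 <= t <= b /\ P t].
have S0 : S 0 by split; rewrite // lexx.
have Sb : has_ubound S by exists b => t [/andP[]].
have sup0 : 0 <= sup S by exact: ub_le_sup.
have supb : sup S <= b by apply: ge_sup; [exists 0|move=> t [/andP[]]].
have sup0b : 0 <= sup S <= b by rewrite sup0.
have [d d0 hd] := hP _ sup0b.
have [s [/andP[s0 sb] Ps] sd] : exists2 s, S s & sup S - d < s.
  by apply: sup_adherent => //; split=> //; exists 0.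
have ss : s <= sup S by apply: ub_le_sup => //; split=> //; rewrite s0.
have Psup : P (sup S).
  by have [| |h _] := hd s (sup S) s0 ss (lexx _) supb; [lra|lra|exact: h].
have [|bsup] := leP b (sup S).
  by move=> h; have -> : b = sup S by apply/eqP; rewrite eq_le h.
pose s' := Num.min b (sup S + d / 2).
have s'sup : sup S < s' by rewrite lt_min bsup /=; lra.
have s'b : s' <= b by rewrite ge_min lexx.
have s'd : s' <= sup S + d / 2 by rewrite ge_min lexx orbT.
have : P s'.
  have [||_ h] := hd (sup S) s' sup0 (lexx _) (ltW s'sup) s'b; [lra|lra|exact: h].
move=> Ps'; have : s' <= sup S.
  by apply: ub_le_sup => //; split=> //; rewrite s'b andbT; lra.
by lra.
Qed.

Lemma derive_le0_local (F : R -> R) (t e : R) : 0 < e -> derivable F t 1 ->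
  derive1 F t <= 0 -> exists2 d, 0 < d & forall h, 0 < `|h| < d ->
    h^-1 * (F (t + h) - F t) <= e.
Proof.
move=> e0 dF F0.
have /cvgrPdist_lt/(_ _ e0) : h^-1 *: (F (h *: 1 + t) - F t) @[h --> 0^'] --> derive1 F t.
  by rewrite derive1E; exact: dF.
case=> d /= d0 hd; exists d => // h /andP[h0 hltd].
have := hd h; rewrite /= sub0r normrN hltd -normr_gt0 h0 => /(_ isT isT).
rewrite /GRing.scale/= mulr1 (addrC h) ltr_norml => /andP[+ _]; lra.
Qed.

Lemma le_lebesgue_measure (A B : set R) : measurable A -> measurable B -> A `<=` B ->
  (lebesgue_measure (A : set R) <= lebesgue_measure (B : set R))%E.
Proof. by move=> mA mB AB; apply: le_measure => //; exact: mem_set. Qed.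

(** The exceptional null set is covered by an open U of measure below the d of absolute continuity.
    Outside U, F grows locally with slope at most e; the increments made inside U add up to less
    than e. *)
Lemma ac_nonincreasing (F : R -> R) (b : R) : 0 <= b ->
  (forall e, 0 < e -> exists2 d, 0 < d &
    forall (N : nat) (s t : 'I_N -> R),
      (forall i, 0 <= s i /\ s i <= t i /\ t i <= b) ->
      trivIset setT (fun i => `](s i), (t i)[%classic) ->
      \sum_(i < N) (t i - s i) < d ->
      \sum_(i < N) `|F (t i) - F (s i)| < e) ->
  {ae lebesgue_measure, forall t, 0 < t < b -> derivable F t 1 /\ derive1 F t <= 0} ->
  F b <= F 0.
Proof.
move=> b0 ac [A [mA A0 subA]].
suff h e : 0 < e -> F b <= F 0 + e * b + e.
  apply/ler_addgt0Pr => e e0; have e1 : 0 < e / (b + 1) by rewrite divr_gt0//; lra.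
  have := h _ e1; have -> : F 0 + e / (b + 1) * b + e / (b + 1) = F 0 + e by field; lra.
  by [].
move=> e0; have [d d0 hd] := ac e e0.
(* The derivative is only controlled in the open interval, so its endpoints join the null set. *)
pose A' : set R := A `|` ([set 0] `|` [set b]).
have mA' : measurable A' by apply: measurableU => //; exact: measurableU.
have A'0 : lebesgue_measure A' = 0%E.
  apply/eqP; rewrite eq_le measure_ge0 andbT.
  apply: (le_trans (measureU2 _ _ _)) => //; first exact: measurableU.
  rewrite [X in (X + _)%E]A0 add0e.
  apply: (le_trans (measureU2 _ _ _)) => //.
  by rewrite [X in (X + _)%E]lebesgue_measure_set1 [X in (_ + X)%E]lebesgue_measure_set1 adde0.
have A'oo : (lebesgue_measure A' < +oo)%E by rewrite A'0.
have [U [oU A'U Ud]] := lebesgue_regularity_outer mA' A'oo d0.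
have mU : measurable U by exact: open_measurable.
have Ud' : (lebesgue_measure U < d%:E)%E.
  have -> : U = A' `|` (U `\` A').
    apply/seteqP; split=> x; last by case=> [/A'U|[]].
    by move=> Ux; have [xA|xA] := pselect (A' x); [left|right].
  rewrite measureU//; last 2 first.
    exact: measurableD.
    by apply/seteqP; split=> x // -[xA [_]].
  by rewrite [X in (X + _)%E]A'0 add0e.
pose UI t : set R := U `&` `[0, t]%classic.
have mUI t : measurable (UI t) by apply: measurableI => //; exact: measurable_itv.
have UIfin t : lebesgue_measure (UI t) \is a fin_num.
  rewrite ge0_fin_numE//; apply: le_lt_trans (lt_trans Ud' (ltry _)).
  by apply: le_lebesgue_measure => //; exact: subIsetl.
pose m t : R := fine (lebesgue_measure (UI t)).
have m_ge0 t : 0 <= m t by rewrite fine_ge0.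
have m_le s t : s <= t -> m s <= m t.
  move=> st; rewrite fine_le//; apply: le_lebesgue_measure => //.
  move=> x [Ux]; rewrite /= !in_itv/= => /andP[x0 xs]; split=> //=.
  by rewrite in_itv/= x0 (le_trans xs).
have m_add s t : 0 <= s -> s <= t -> `[s, t] `<=` U -> m s + (t - s) <= m t.
  move=> s0 st stU.
  rewrite -lee_fin EFinD /m !fineK//.
  have -> : (t - s)%:E = lebesgue_measure (`]s, t]%classic : set R).
    rewrite lebesgue_measure_itv/= lte_fin; move: st; rewrite le_eqVlt => /predU1P[->|->//].
    by rewrite ltxx subrr.
  rewrite -measureU//; last 2 first.
    exact: mUI.
    apply/seteqP; split=> x //= [[_ +]]; rewrite /= !in_itv/= => /andP[_ xs] /andP[sx _].
    by move: (le_lt_trans xs sx); rewrite ltxx.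
  apply: (@le_lebesgue_measure (UI s `|` `]s, t]%classic)) => //.
    by apply: measurableU => //; exact: measurable_itv.
  move=> x [[Ux]|]; rewrite /= !in_itv/= => /andP[x0 xs]; split=> //=; rewrite ?in_itv/=.
  - by rewrite x0 (le_trans xs).
  - by apply: stU; rewrite /= in_itv/= ltW.
  - by rewrite xs andbT (le_trans s0)// ltW.
(* The invariant of the real induction: F has grown up to t by at most e t plus its increments over
   finitely many ordered intervals, whose total length is bounded by the measure [m t] of U within
   [0, t]. *)
pose P t := exists N (s r : nat -> R), [/\
   forall i, (i < N)%N -> [/\ 0 <= s i, s i <= r i & r i <= t],
   forall i j, (i < j)%N -> (j < N)%N -> r i <= s j,
   \sum_(i < N) (r i - s i) <= m t &
   F t <= F 0 + e * t + \sum_(i < N) `|F (r i) - F (s i)|].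
have P0 : P 0.
  by exists 0%N, (fun=> 0), (fun=> 0); split=> //; rewrite !big_ord0// mulr0 !addr0.
have Pslope s t : P s -> s <= t -> F t <= F s + e * (t - s) -> P t.
  move=> [N [a [r [h1 h2 h3 h4]]]] st Fst; exists N, a, r; split=> //.
  - by move=> i /h1[? ? ?]; split=> //; lra.
  - exact: le_trans h3 (m_le _ _ st).
  - by apply: le_trans Fst _; rewrite mulrBr; lra.
have Pjump s t : 0 <= s -> P s -> s <= t -> `[s, t] `<=` U -> P t.
  move=> s0 [N [a [r [h1 h2 h3 h4]]]] st stU.
  exists N.+1, (fun i => if i == N then s else a i), (fun i => if i == N then t else r i).
  have lt_neq i : (i < N)%N -> (i == N) = false by move=> iN; rewrite ltn_eqF.
  split.
  - move=> i; rewrite ltnS leq_eqVlt => /predU1P[->|iN]; first by rewrite eqxx.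
    by rewrite lt_neq//; have [? ? ?] := h1 i iN; split=> //; lra.
  - move=> i j ij; rewrite ltnS leq_eqVlt => /predU1P[jN|jN].
      by move: ij; rewrite jN eqxx => iN; rewrite lt_neq//; case: (h1 i iN).
    by rewrite !lt_neq//; [exact: h2|exact: ltn_trans ij jN].
  - rewrite big_ord_recr/= eqxx; apply: le_trans (m_add _ _ s0 st stU); rewrite lerD2r.
    apply: le_trans h3; rewrite le_eqVlt; apply/orP; left.
    by apply/eqP; apply: eq_bigr => i _; rewrite lt_neq.
  - rewrite big_ord_recr/= eqxx.
    have -> : \sum_(i < N) `|F (if i == N :> nat then t else r i) - F (if i == N :> nat then s else a i)|
        = \sum_(i < N) `|F (r i) - F (a i)| by apply: eq_bigr => i _; rewrite lt_neq.
    have := ler_norm (F t - F s); have : e * s <= e * t by rewrite ler_pM2l.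
    by lra.
have : P b.
  apply: real_induction => // t /andP[t0 tb].
  have [Ut|nUt] := pselect (U t).
    have [r /= r0 hr] := (open_nbhs_nbhs (conj oU Ut) : nbhs t U).
    have inU x y : t - x < r -> y - t < r -> x <= t -> t <= y -> `[x, y] `<=` U.
      move=> tx yt xt ty z; rewrite /= in_itv/= => /andP[xz zy]; apply: hr => /=.
      by rewrite ltr_norml; lra.
    exists r => // s s' s0 st ts' s'b str s'tr; split=> Ps.
      by apply: (Pjump _ _ s0 Ps st); apply: inU => //; lra.
    by apply: (Pjump _ _ t0 Ps ts'); apply: inU => //; lra.
  have A't : ~ A' t by move=> /A'U.
  have t0b : 0 < t < b.
    rewrite !lt_neqAle t0 tb !andbT; apply/andP; split; apply/eqP => h; apply: A't; right; [left|right] => //.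
  have [dF F0] : derivable F t 1 /\ derive1 F t <= 0.
    apply: contrapT => h; apply: A't; left; apply: subA => /= h'; apply: h; exact: h'.
  have [r r0 hr] := derive_le0_local e0 dF F0.
  exists r => // s s' s0 st ts' s'b str s'tr; split=> Ps.
    apply: (Pslope _ _ Ps st); move: (st); rewrite le_eqVlt => /predU1P[->|{}st].
      by rewrite subrr mulr0 addr0.
    have := hr (s - t); rewrite ltr0_norm ?subr_lt0// opprB subr_gt0 st str => /(_ isT).
    have -> : t + (s - t) = s by ring.
    have st0 : s - t < 0 by lra.
    by rewrite -(ler_nM2l st0) mulVKf ?lt_eqF//; lra.
  apply: (Pslope _ _ Ps ts'); move: (ts'); rewrite le_eqVlt => /predU1P[->|{}ts'].
    by rewrite subrr mulr0 addr0.
  have := hr (s' - t); rewrite gtr0_norm ?subr_gt0// ts' s'tr => /(_ isT).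
  have -> : t + (s' - t) = s' by ring.
  have st0 : 0 < s' - t by lra.
  by rewrite -(ler_pM2l st0) mulVKf ?gt_eqF//; lra.
move=> [N [s [r [h1 h2 h3 h4]]]].
have : \sum_(i < N) `|F (r i) - F (s i)| < e.
  apply: (hd N (fun i => s i) (fun i => r i)).
  - by move=> i; have [? ? ?] := h1 i (ltn_ord i).
  - have key (i j : 'I_N) : (i < j)%N -> `](s i), (r i)[%classic `&` `](s j), (r j)[%classic = set0.
      move=> ij; apply/seteqP; split=> x //= []; rewrite !in_itv/= => /andP[_ xi] /andP[jx _].
      have := h2 i j ij (ltn_ord j); lra.
    apply/trivIsetP => i j _ _; rewrite neq_ltn => /orP[ij|ji]; first exact: key.
    by rewrite setIC; exact: key.
  - apply: (le_lt_trans h3); rewrite -lte_fin fineK//.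
    by apply: le_lt_trans Ud'; apply: le_lebesgue_measure => //; exact: subIsetl.
by lra.
Qed.

End absolute_continuity.

(** * Ultrafilter limits of trajectories *)

Section ultrafilter_limits.

Lemma ultra_fmap (S T : Type) (f : S -> T) (G : set_system S) :
  UltraFilter G -> UltraFilter (f @ G).
Proof.
move=> GU; split=> [|H HP GH]; first exact: fmap_proper_filter.
apply/seteqP; split=> A; last exact: GH.
move=> HA; have [//|GA] := in_ultra_setVsetC (f @^-1` A) GU.
have HA' : H (~` A) by exact: GH.
by case: (filter_not_empty H); rewrite -(setICr A); exact: filterI.
Qed.

Lemma ultra_compact_lim (S : Type) (T : topologicalType) (G : set_system S) (K : set T) (u : S -> T) :
  UltraFilter G -> compact K -> G [set l | K (u l)] -> exists2 p, K p & u @ G --> p.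
Proof.
move=> GU; rewrite compact_ultra => cK GK.
by have [p [Kp hp]] := cK _ (ultra_fmap u GU) GK; exists p.
Qed.

(** The trace of [\oo] on an infinite set is a proper filter, which extends to an ultrafilter. *)
Lemma ultra_natP (B : set nat) : (forall N, exists2 l, (N <= l)%N & B l) ->
  exists G : set_system nat, [/\ UltraFilter G, \oo `<=` G & G B].
Proof.
move=> hB.
have PF : ProperFilter (within B \oo).
  split; last exact: within_filter.
  by case=> N _ hN; have [l Nl Bl] := hB N; exact: (hN l Nl Bl).
have [G [GU hG]] := ultraFilterLemma PF; exists G; split=> //.
- by move=> A oA; apply: hG; apply: filterS oA => l Al _.
- by apply: hG; apply: filterS (filterT : \oo setT) => l _.
Qed.

End ultrafilter_limits.

(** * Convex hulls of compact sets *)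

Section convex_hulls.
Context {R : realType} {n : nat}.
Implicit Types (K : set 'rV[R]_n) (x y : 'rV[R]_n).

Lemma sub_conv_hull K : K `<=` conv_hull K.
Proof. exact: sub_smallest. Qed.

Lemma conv_hull_convex K x y (t : R) : 0 <= t -> t <= 1 ->
  conv_hull K x -> conv_hull K y -> conv_hull K (t *: x + (1 - t) *: y).
Proof.
move=> t0 t1 Kx Ky D [cD KD].
have := cD x y (Itv01 t0 t1); rewrite !inE; apply; [exact: Kx|exact: Ky].
Qed.

Lemma conv_hull_min K (D : set 'rV[R]_n) : K `<=` D ->
  (forall x y t, 0 <= t -> t <= 1 -> D x -> D y -> D (t *: x + (1 - t) *: y)) ->
  conv_hull K `<=` D.
Proof.
move=> KD cD; apply: smallest_sub => // x y t; rewrite !inE => Dx Dy.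
by apply: cD.
Qed.

Definition convex_comb K (k : nat) (x : 'rV[R]_n) : Prop :=
  exists (a : 'I_k -> R) (p : 'I_k -> 'rV[R]_n), [/\ forall i, 0 <= a i,
    \sum_i a i = 1, forall i, K (p i) & x = \sum_i a i *: p i].

Lemma convex_comb_hull K k x : convex_comb K k x -> conv_hull K x.
Proof.
case=> a [p [+ + Kp ->]]; elim: k a p Kp => [|k ih] a p Kp a0.
  by rewrite big_ord0 => /eqP; rewrite eq_sym oner_eq0.
rewrite !big_ord_recl => a1.
have s0 : 0 <= \sum_(i < k) a (lift ord0 i) by apply: sumr_ge0.
have [s|s] := eqVneq (\sum_(i < k) a (lift ord0 i)) 0.
  rewrite (_ : a ord0 = 1); last by move: a1; rewrite s addr0.
  rewrite scale1r big1 ?addr0; first exact: sub_conv_hull.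
  by move=> i _; rewrite (psumr_eq0P (fun j _ => a0 (lift ord0 j)) s) ?scale0r.
have {}s : 0 < \sum_(i < k) a (lift ord0 i) by rewrite lt_neqAle eq_sym s.
set S := \sum_(i < k) a (lift ord0 i) in a1 s.
have -> : \sum_(i < k) a (lift ord0 i) *: p (lift ord0 i) =
   (1 - a ord0) *: \sum_(i < k) (S^-1 * a (lift ord0 i)) *: p (lift ord0 i).
  have -> : 1 - a ord0 = S by rewrite -a1 addrC addKr.
  by rewrite scaler_sumr; apply: eq_bigr => i _; rewrite scalerA mulrA mulfV ?mul1r// gt_eqF.
apply: conv_hull_convex => //.
- by rewrite -a1 lerDl ltW.
- exact: sub_conv_hull.
- apply: (ih (fun i => S^-1 * a (lift ord0 i)) (fun i => p (lift ord0 i))) => //.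
    by move=> i; rewrite mulr_ge0// invr_ge0 ltW.
  by rewrite -mulr_sumr mulVf// gt_eqF.
Qed.

Lemma convex_comb_pad K k x : convex_comb K k x -> convex_comb K k.+1 x.
Proof.
case=> a [p [a0 a1 Kp xE]].
case: k a p a0 a1 Kp xE => [|k] a p a0 a1 Kp xE.
  by move: a1; rewrite big_ord0 => /eqP; rewrite eq_sym oner_eq0.
exists (fun i => if unlift ord0 i is Some j then a j else 0).
exists (fun i => if unlift ord0 i is Some j then p j else p ord0).
split.
- by move=> i; case: unlift.
- rewrite big_ord_recl unlift_none add0r -[RHS]a1.
  by apply: eq_bigr => i _; rewrite liftK.
- by move=> i; case: unlift.
- rewrite big_ord_recl unlift_none scale0r add0r xE.
  by apply: eq_bigr => i _; rewrite liftK.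
Qed.

(** More than n + 1 points are affinely dependent; moving the weights along a dependence until one
    of them vanishes removes a point. *)
Lemma caratheodory_step K k x : (n < k)%N -> convex_comb K k.+1 x -> convex_comb K k x.
Proof.
move=> nk [a [p [a0 a1 Kp xE]]].
(* Row i is (1, p_i), so the left kernel consists of the affine dependences; it is nonzero as there
   are more rows than columns. *)
pose A : 'M[R]_(k.+1, 1 + n) := \matrix_(i, j) row_mx (const_mx 1 : 'rV[R]_1) (p i) ord0 j.
have /rowV0Pn[c csub c0] : kermx A != 0.
  rewrite kermx_eq0 /row_free neq_ltn; apply/orP; left.
  by rewrite (leq_ltn_trans (rank_leq_col A)).
have cA : c *m A = 0 by exact/sub_kermxP.
have csum : \sum_i c ord0 i = 0.
  have := congr1 (fun B : 'rV[R]_(1 + n) => B ord0 (lshift n ord0)) cA; rewrite !mxE => h.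
  by rewrite -[RHS]h; apply: eq_bigr => i _; rewrite /A mxE row_mxEl mxE mulr1.
have cp : \sum_i c ord0 i *: p i = 0.
  apply/rowP => j.
  have := congr1 (fun B : 'rV[R]_(1 + n) => B ord0 (rshift 1 j)) cA; rewrite !mxE => h.
  rewrite -[RHS]h summxE; apply: eq_bigr => i _.
  by rewrite mxE /A mxE row_mxEr.
have [i1 ci1] : exists i, 0 < c ord0 i.
  apply: contrapT => /forallNP hc; move/eqP: c0; apply; apply/rowP => i; rewrite mxE.
  have cle j : c ord0 j <= 0 by rewrite leNgt; apply/negP; exact: hc.
  apply/eqP; rewrite -oppr_eq0; apply/eqP.
  have := @psumr_eq0P _ _ xpredT (fun i => - c ord0 i); apply => //.
    by move=> j _; rewrite oppr_ge0.
  by rewrite sumrN csum oppr0.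
(* The smallest ratio is the largest multiple of c that can be subtracted with all weights staying
   nonnegative; the weight of [i0] becomes 0. *)
pose i0 := [arg min_(i < i1 | 0 < c ord0 i) (a i / c ord0 i)]%O.
have [ci0 hmin] : 0 < c ord0 i0 /\ forall j, 0 < c ord0 j -> a i0 / c ord0 i0 <= a j / c ord0 j.
  by rewrite /i0; case: arg_minP => // i ci h; split.
pose t := a i0 / c ord0 i0.
have t0 : 0 <= t by rewrite divr_ge0// ltW.
pose b i := a i - t * c ord0 i.
have b0 i : 0 <= b i.
  rewrite subr_ge0; have [ci|ci] := leP (c ord0 i) 0.
    by rewrite (le_trans _ (a0 i))// mulr_ge0_le0.
  by rewrite -ler_pdivlMr// hmin.
have bi0 : b i0 = 0 by rewrite /b /t divfK ?subrr// gt_eqF.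
exists (fun j => b (lift i0 j)), (fun j => p (lift i0 j)); split=> //.
- have : \sum_i b i = 1 by rewrite sumrB a1 -mulr_sumr csum mulr0 subr0.
  by rewrite (bigD1_ord i0)//= bi0 add0r.
- have : \sum_i b i *: p i = x.
    rewrite /b; under eq_bigr do rewrite scalerBl -scalerA.
    by rewrite sumrB -scaler_sumr cp scaler0 subr0 xE.
  by rewrite (bigD1_ord i0)//= bi0 scale0r add0r.
Qed.

Lemma caratheodory K x : conv_hull K x -> convex_comb K n.+1 x.
Proof.
have red k y : convex_comb K k y -> convex_comb K n.+1 y.
  have [kn|nk] := leqP k n.+1.
    rewrite -(subnKC kn); elim: (n.+1 - k)%N => [|d ih]; first by rewrite addn0.
    by move=> h; rewrite addnS; apply: convex_comb_pad; exact: ih.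
  rewrite -(subnKC (ltnW nk)); elim: (k - n.+1)%N => [|d ih]; first by rewrite addn0.
  by rewrite addnS => h; apply: ih; apply: caratheodory_step h; rewrite addSn ltnS leq_addr.
have : conv_hull K `<=` [set y | exists k, convex_comb K k y].
  apply: conv_hull_min => [y Ky|y z t t0 t1 [k [a [p [a0 a1 Kp ->]]]] [l [b [q [b0 b1 Kq ->]]]]].
    exists 1%N, (fun=> 1), (fun=> y); split=> //; first by rewrite big_ord1.
    by rewrite big_ord1 scale1r.
  exists (k + l)%N, (fun i : 'I_(k + l) =>
    match fintype.split i with inl j => t * a j | inr j => (1 - t) * b j end).
  exists (fun i : 'I_(k + l) => match fintype.split i with inl j => p j | inr j => q j end); split.
  - move=> i; case: fintype.split => j; rewrite mulr_ge0//; lra.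
  - rewrite big_split_ord/=.
    under eq_bigr do rewrite (unsplitK (inl _)).
    under [X in _ + X]eq_bigr do rewrite (unsplitK (inr _)).
    by rewrite -!mulr_sumr a1 b1; ring.
  - by move=> i; case: fintype.split.
  - rewrite big_split_ord/= !scaler_sumr; congr (_ + _); apply: eq_bigr => i _.
      by rewrite (unsplitK (inl _)) scalerA.
    by rewrite (unsplitK (inr _)) scalerA.
by move=> /[apply] -[k]; exact: red.
Qed.

(** With the number of points fixed at n + 1, weights and points of a convergent sequence of
    combinations range over compact sets, and their ultrafilter limits represent the limit. *)
Lemma conv_hull_closed K : compact K -> closed (conv_hull K).
Proof.
move=> cK x clx.
have /choice[z hz] : forall l : nat, exists z, conv_hull K z /\ `|x - z| < l.+1%:R^-1.
  move=> l; have l0 : 0 < l.+1%:R^-1 :> R by rewrite invr_gt0.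
  have [z [Kz]] := clx _ (nbhsx_ballx x _ l0).
  by rewrite -ball_normE /= => xz; exists z.
have /choice[a /choice[p hp]] := fun l => caratheodory (hz l).1.
have [G [GU ooG _]] := @ultra_natP setT (fun N => ex_intro2 _ _ N (leqnn N) I).
have PG : ProperFilter G by exact: ultra_proper.
have /choice[b hb] : forall i, exists b : R, 0 <= b /\ (fun l => a l i) @ G --> b.
  move=> i; have [||b] := @ultra_compact_lim _ _ G (`[0, 1]%classic : set R) (fun l => a l i) GU.
  - exact: segment_compact.
  - apply: filterS filterT => l _ /=; rewrite in_itv/=; have [a0 a1 _ _] := hp l.
    rewrite a0 -a1 (bigD1 i)//= lerDl sumr_ge0//.
  - by rewrite /= in_itv/= => /andP[b0 _] hb; exists b.
have /choice[q hq] : forall i, exists q : 'rV[R]_n, K q /\ (fun l => p l i) @ G --> q.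
  move=> i; have [|q Kq hq] := @ultra_compact_lim _ _ G K (fun l => p l i) GU cK.
    by apply: filterS filterT => l _; have [_ _ Kp _] := hp l; exact: Kp.
  by exists q.
have zx : z @ G --> x.
  apply/cvgrPdist_lt => e e0; apply: ooG.
  exists (Num.truncn e^-1) => // l /= hl; apply: lt_trans (hz l).2 _.
  rewrite invf_plt ?posrE//; apply: lt_le_trans (truncnS_gt _) _.
  by rewrite ler_nat.
have zq : z @ G --> \sum_i b i *: q i.
  rewrite (_ : z = fun l => \sum_i a l i *: p l i); last by apply/funext => l; have [] := hp l.
  apply: cvg_big => [|i _]; first exact: add_continuous.
  by apply: cvgZ; [case: (hb i)|case: (hq i)].
have -> : x = \sum_i b i *: q i by exact: (cvg_unique _ zx zq).
apply: convex_comb_hull; exists b, q; split=> //.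
- by move=> i; case: (hb i).
- have h1 : (fun l => \sum_i a l i) @ G --> \sum_i b i.
    by apply: cvg_big => [|i _]; [exact: add_continuous|case: (hb i)].
  have h2 : (fun l => \sum_i a l i) @ G --> (1 : R).
    rewrite (_ : (fun l => _) = fun=> 1); first exact: cvg_cst.
    by apply/funext => l; have [] := hp l.
  exact: (cvg_unique _ h1 h2).
- by move=> i; case: (hq i).
Qed.

End convex_hulls.

(** * Globally Lipschitz extensions by clipping *)

Section clipping.
Context {R : realType} {n : nat}.
Implicit Types x y : 'rV[R]_n.

Definition clip (r : R) x : 'rV[R]_n := \row_i Num.max (- r) (Num.min (x ord0 i) r).

Lemma clip_norm_le r x : 0 <= r -> `|clip r x| <= r.
Proof.
move=> r0; apply: norm_rV_le => // i; rewrite mxE ler_norml le_max lexx/=.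
by rewrite ge_max ge_min lexx orbT andbT; lra.
Qed.

Lemma clip_id r x : `|x| <= r -> clip r x = x.
Proof.
move=> xr; apply/rowP => i; rewrite mxE.
have := le_trans (le_coord_norm x i) xr; rewrite ler_norml => /andP[h1 h2].
by rewrite min_l// max_r.
Qed.

Lemma normB_max_le (c a b : R) : `|Num.max c a - Num.max c b| <= `|a - b|.
Proof.
have := ler_norm (b - a); have := ler_norm (a - b); rewrite (distrC b a) ler_norml.
by case: (leP c a) => ?; case: (leP c b) => ? ? ?; apply/andP; lra.
Qed.

Lemma normB_min_le (a b c : R) : `|Num.min a c - Num.min b c| <= `|a - b|.
Proof.
have := ler_norm (b - a); have := ler_norm (a - b); rewrite (distrC b a) ler_norml.
by case: (leP a c) => ?; case: (leP b c) => ? ? ?; apply/andP; lra.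
Qed.

Lemma clip_lipschitz r x y : `|clip r x - clip r y| <= `|x - y|.
Proof.
apply: norm_rV_le => // i; apply: le_trans (le_coord_norm (x - y) i); rewrite !mxE.
exact: le_trans (normB_max_le _ _ _) (normB_min_le _ _ _).
Qed.

(** A coordinate that has been clipped has modulus |r|, which a norm bound s < r excludes. *)
Lemma clip_inside r s x : s < r -> `|clip r x| <= s -> clip r x = x.
Proof.
move=> sr cs; apply/rowP => i.
have := le_trans (le_coord_norm _ i) cs; rewrite mxE ler_norml.
by case: (leP (x ord0 i) r) => ?; [case: (leP (- r) (x ord0 i))|case: (leP (- r) r)]; lra.
Qed.

End clipping.

Section vector_fields.
Context {R : realType} {n m : nat}.
Variables (f : 'I_n -> {mpoly R[n + m]}).

Lemma norm_row_mx_le (x : 'rV[R]_n) (u : 'rV[R]_m) (r : R) :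
  `|x| <= r -> `|u| <= r -> `|row_mx x u| <= r.
Proof.
move=> xr ur; apply: norm_rV_le; first exact: le_trans xr.
move=> i; rewrite mxE; case: fintype.split => j.
  exact: le_trans (le_coord_norm _ _) xr.
exact: le_trans (le_coord_norm _ _) ur.
Qed.

Lemma norm_row_mxB_le (x x' : 'rV[R]_n) (u u' : 'rV[R]_m) :
  `|row_mx x u - row_mx x' u'| <= `|x - x'| + `|u - u'|.
Proof.
apply: norm_rV_le => [|i]; first exact: addr_ge0.
rewrite !mxE; case: fintype.split => j.
  by rewrite ler_wpDr// (le_trans _ (le_coord_norm _ j))// !mxE.
by rewrite ler_wpDl// (le_trans _ (le_coord_norm _ j))// !mxE.
Qed.

Lemma vfield_lipschitz_box (r : R) : exists L M : R, [/\ 0 <= L, 0 <= M,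
  forall x u, `|x| <= r -> `|u| <= r -> `|vfield f x u| <= M &
  forall x x' u u', `|x| <= r -> `|x'| <= r -> `|u| <= r -> `|u'| <= r ->
    `|vfield f x u - vfield f x' u'| <= L * (`|x - x'| + `|u - u'|)].
Proof.
have /choice[L /choice[M h]] := fun i => peval_lipschitz_box (f i) r.
have L0 i : 0 <= L i by case: (h i).
have M0 i : 0 <= M i by case: (h i).
have leL i : L i <= \sum_i L i by rewrite (bigD1 i)//= lerDl sumr_ge0.
have leM i : M i <= \sum_i M i by rewrite (bigD1 i)//= lerDl sumr_ge0.
exists (\sum_i L i), (\sum_i M i); split; rewrite ?sumr_ge0//.
  move=> x u xr ur; apply: norm_rV_le; first by rewrite sumr_ge0.
  move=> i; rewrite mxE; have [_ _ hM _] := h i.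
  by rewrite (le_trans (hM _ _))// norm_row_mx_le.
move=> x x' u u' xr xr' ur ur'; apply: norm_rV_le.
  by rewrite mulr_ge0 ?sumr_ge0// addr_ge0.
move=> i; rewrite !mxE; have [_ _ _ hL] := h i.
apply: le_trans (hL _ _ _ _) _; try exact: norm_row_mx_le.
by apply: ler_pM => //; exact: norm_row_mxB_le.
Qed.

Lemma continuous_vfield (x : 'rV[R]_n) : continuous (vfield f x).
Proof.
move=> u; pose r := `|x| + `|u| + 1.
have [L [_ [L0 _ _ hL]]] := vfield_lipschitz_box r.
apply/(@cvgrPdist_lt _ 'rV[R]_n _ (nbhs u) (nbhs_filter u)) => e e0.
apply/nbhs_ballP; exists (Num.min 1 (e / (L + 1))) => /=.
  by rewrite lt_min ltr01 divr_gt0// ltr_wpDl.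
move=> w; rewrite -ball_normE /= lt_min => /andP[uw1 uw2].
have ux := normr_ge0 x; have uu := normr_ge0 u.
have wr : `|w| <= r.
  rewrite -(subKr u w) (le_trans (ler_normB _ _))// /r; lra.
apply: le_lt_trans (hL x x u w _ _ _ wr) _; rewrite ?/r; try lra.
rewrite subrr normr0 add0r; move: uw2; rewrite ltr_pdivlMr ?ltr_wpDl// => uw2.
by apply: le_lt_trans uw2; rewrite mulrDr mulr1 mulrC lerDl.
Qed.

Lemma compact_vfield_image (x : 'rV[R]_n) (U : set 'rV[R]_m) : compact U ->
  compact [set vfield f x u | u in U].
Proof. by move=> cU; apply: continuous_compact => //; exact/continuous_subspaceT/continuous_vfield. Qed.

End vector_fields.

Section constraint_violation.
Context {R : realType} {n N : nat}.
Variables (g : 'I_N -> {mpoly R[n]}) (r0 : R).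
Hypotheses (r00 : 0 <= r0) (gr0 : forall x, semialg g x -> `|x| <= r0).

Let r := r0 + 2.

(** Clipping makes it bounded and globally Lipschitz. Since the clipping radius exceeds r0, a
    clipped point satisfying the constraints was not moved, so the zero set is still the state
    set. *)
Definition violation (x : 'rV[R]_n) : R := \sum_i Num.max 0 (- peval (g i) (clip r x)).

Lemma violation_ge0 x : 0 <= violation x.
Proof. by apply: sumr_ge0 => i _; rewrite le_max lexx. Qed.

Lemma violation_eq0 x : semialg g x -> violation x = 0.
Proof.
move=> gx; rewrite /violation big1// => i _; rewrite clip_id.
  by rewrite max_l// oppr_le0; exact: gx.
by rewrite (le_trans (gr0 gx))// /r lerDl.
Qed.

Lemma violation_le0 x : violation x <= 0 -> semialg g x.
Proof.
move=> h; have h0 : violation x = 0 by apply/eqP; rewrite eq_le h violation_ge0.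
have cx : semialg g (clip r x).
  move=> i; have : Num.max 0 (- peval (g i) (clip r x)) <= violation x.
    by rewrite /violation (bigD1 i)//= lerDl sumr_ge0// => j _; rewrite le_max lexx.
  rewrite h0 ge_max lexx/=.
  by rewrite oppr_le0.
by rewrite -(clip_inside (_ : r0 < r) (gr0 cx))// /r ltrDl.
Qed.

Lemma violation_lipschitz : exists L K : R, [/\ 0 <= L, 0 <= K,
  forall x, violation x <= K &
  forall x y, `|violation x - violation y| <= L * `|x - y|].
Proof.
have /choice[L /choice[K h]] := fun i => peval_lipschitz_box (g i) r.
have L0 i : 0 <= L i by case: (h i).
have K0 i : 0 <= K i by case: (h i).
have rr : 0 <= r by rewrite /r addr_ge0.
exists (\sum_i L i), (\sum_i K i); split; rewrite ?sumr_ge0//.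
  move=> x; apply: ler_sum => i _; rewrite ge_max K0/=.
  have [_ _ hK _] := h i; have := hK _ (clip_norm_le x rr).
  by rewrite ler_norml => /andP[]; lra.
move=> x y; rewrite -sumrB (le_trans (ler_norm_sum _ _ _))// mulr_suml.
apply: ler_sum => i _.
have [_ _ _ hL] := h i; have := hL _ _ (clip_norm_le x rr) (clip_norm_le y rr).
have : L i * `|clip r x - clip r y| <= L i * `|x - y|.
  by rewrite ler_wpM2l// clip_lipschitz.
move=> h1 h2; apply: le_trans (normB_max_le _ _ _) _.
by rewrite opprK addrC distrC (le_trans h2).
Qed.

End constraint_violation.

(** * Limits of discrete-time chains *)

Section trajectory_limits.
Context {R : realType} {n m nX nU : nat}.
Variables (f : 'I_n -> {mpoly R[n + m]}).
Variables (gX : 'I_nX -> {mpoly R[n]}) (gU : 'I_nU -> {mpoly R[m]}) (r0 rU : R).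
Hypotheses (r00 : 0 <= r0) (gXr0 : forall x, semialg gX x -> `|x| <= r0).
Hypotheses (gUrU : forall u, semialg gU u -> `|u| <= rU) (cU : compact (semialg gU)).

(* Globally Lipschitz in x, and equal to the vector field near the state set. *)
Definition clipped_field (x : 'rV[R]_n) (u : 'rV[R]_m) : 'rV[R]_n :=
  vfield f (clip (r0 + 2) x) u.

Lemma clipped_field_lipschitz : exists L M : R, [/\ 0 <= L, 0 <= M,
  forall x u, semialg gU u -> `|clipped_field x u| <= M &
  forall x x' u u', semialg gU u -> semialg gU u' ->
    `|clipped_field x u - clipped_field x' u'| <= L * (`|x - x'| + `|u - u'|)].
Proof.
have [L [M [L0 M0 hM hL]]] := vfield_lipschitz_box f (Num.max (r0 + 2) rU).
have rr : 0 <= r0 + 2 by exact: addr_ge0.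
have cl (x : 'rV[R]_n) : `|clip (r0 + 2) x| <= Num.max (r0 + 2) rU.
  by rewrite (le_trans (clip_norm_le _ rr))// le_max lexx.
have ul u : semialg gU u -> `|u| <= Num.max (r0 + 2) rU.
  by move=> /gUrU h; rewrite le_max h orbT.
exists L, M; split=> // [x u Uu|x x' u u' Uu Uu'].
  by apply: hM; [exact: cl|exact: ul].
apply: (le_trans (hL _ _ _ _ (cl x) (cl x') (ul _ Uu) (ul _ Uu'))).
by rewrite ler_wpM2l// lerD2r clip_lipschitz.
Qed.

Lemma clipped_fieldE x u : semialg gX x -> clipped_field x u = vfield f x u.
Proof. by move=> /gXr0 h; rewrite /clipped_field clip_id//; apply: (le_trans h); rewrite lerDl. Qed.

Lemma eq_of_dist_le (x y : 'rV[R]_n) : (forall e, 0 < e -> `|x - y| <= e) -> x = y.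
Proof.
move=> h; apply/eqP; rewrite -subr_eq0 -normr_le0.
by apply/ler_addgt0Pr => e e0; rewrite add0r; exact: h.
Qed.

Lemma cvg_dist_lt k (G : set_system nat) (u : nat -> 'rV[R]_k) (p : 'rV[R]_k) (e : R) :
  Filter G -> u @ G --> p -> 0 < e -> G [set l | `|p - u l| < e].
Proof. by move=> FG /cvgrPdist_lt h e0; exact: h. Qed.

Lemma violation_limit (G : set_system nat) (z : nat -> 'rV[R]_n) (p : 'rV[R]_n) :
  ProperFilter G -> z @ G --> p ->
  (forall e, 0 < e -> G [set l | violation gX r0 (z l) < e]) -> semialg gX p.
Proof.
move=> PG zp hz; apply: (violation_le0 gXr0).
have [L [K [L0 K0 _ hL]]] := violation_lipschitz gX r00.
apply/ler_addgt0Pr => e e0; rewrite add0r.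
have e1 : 0 < e / 2 / (L + 1) by rewrite divr_gt0 ?divr_gt0// ltr_wpDl.
have [l [h1 h2]] := filter_ex (filterI (cvg_dist_lt _ zp e1) (hz _ (divr_gt0 e0 (ltr0n _ 2)))).
have := hL p (z l); rewrite ler_norml => /andP[_ h3].
have : L * `|p - z l| <= e / 2.
  move: h1; rewrite /= ltr_pdivlMr ?ltr_wpDl// => /ltW; apply: le_trans.
  by rewrite mulrDr mulr1 mulrC lerDl.
by move: h2 => /=; lra.
Qed.

(** For each fixed time the states and controls lie in compact sets, so they converge along G
    simultaneously at all times, without extraction; joint Lipschitz continuity passes the dynamics
    to the limit. *)
Lemma discrete_limit (G : set_system nat) (x0 : 'rV[R]_n)
    (xs : nat -> nat -> 'rV[R]_n) (us : nat -> nat -> 'rV[R]_m) :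
  UltraFilter G -> (forall l, xs l 0%N = x0) ->
  (forall i, G [set l | semialg gU (us l i) /\ xs l i.+1 = clipped_field (xs l i) (us l i)]) ->
  (forall i e, 0 < e -> G [set l | violation gX r0 (xs l i) < e]) ->
  mci_discrete f (semialg gX) (semialg gU) x0.
Proof.
move=> GU xs0 step viol; have PG : ProperFilter G by exact: ultra_proper.
have [L [M [L0 M0 hM hL]]] := clipped_field_lipschitz.
have cy i : exists p : 'rV[R]_n, xs^~ i @ G --> p.
  have c0 : 0 <= `|x0| + M by exact: addr_ge0.
  have [|p _ hp] := @ultra_compact_lim _ _ G _ (xs^~ i) GU (@compact_norm_le R n _ c0).
    case: i => [|i].
      by apply: filterS filterT => l _ /=; rewrite xs0 lerDl.
    by apply: filterS (step i) => l [Ul /= ->]; rewrite (le_trans (hM _ _ Ul))// lerDr.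
  by exists p.
have [y hy] := choice cy.
have cu i : exists p : 'rV[R]_m, semialg gU p /\ us^~ i @ G --> p.
  have [|p Up hp] := @ultra_compact_lim _ _ G _ (us^~ i) GU cU.
    by apply: filterS (step i) => l [].
  by exists p.
have [u hu] := choice cu.
have yX i : semialg gX (y i) by exact: violation_limit (hy i) (viol i).
exists y, u; split.
  have h := hy 0%N; rewrite (_ : xs^~ 0%N = fun=> x0) in h; last by apply/funext => l; rewrite xs0.
  exact: (cvg_unique _ h (cvg_cst _)).
move=> i; split=> //; last by case: (hu i).
rewrite -clipped_fieldE//; apply: eq_of_dist_le => e e0.
pose e1 := e / (1 + 2 * L).
have d0 : 0 < 1 + 2 * L by rewrite ltr_pwDl// mulr_ge0.
have e10 : 0 < e1 by rewrite divr_gt0.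
have [Uu uu] := hu i.
have [l [[h1 h2] [h3 [Ul sl]]]] := filter_ex (filterI (filterI (cvg_dist_lt _ (hy i) e10)
   (cvg_dist_lt _ (hy i.+1) e10)) (filterI (cvg_dist_lt _ uu e10) (step i))).
have -> : y i.+1 - clipped_field (y i) (u i) = (y i.+1 - xs l i.+1) -
    (clipped_field (y i) (u i) - clipped_field (xs l i) (us l i)).
  by rewrite sl opprB addrA subrK.
apply: (le_trans (ler_normB _ _)).
have := hL (y i) (xs l i) (u i) (us l i) Uu Ul.
have : L * (`|y i - xs l i| + `|u i - us l i|) <= L * (e1 + e1).
  by rewrite ler_wpM2l// lerD// ltW.
have : e1 + L * (e1 + e1) = e by rewrite /e1; field; rewrite gt_eqF.
move: h2 => /=; lra.
Qed.

End trajectory_limits.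

Section lipschitz_curves.
Context {R : realType} {n : nat}.

Lemma lipschitz_abs_cont (y : R -> 'rV[R]_n) (M a b : R) :
  (forall s t, `|y s - y t| <= M * `|s - t|) -> abs_cont y a b.
Proof.
move=> yM e e0; pose M' := `|M| + 1; have M'0 : 0 < M' by rewrite ltr_wpDl.
exists (e / M') => [|N s t st _ sd]; first exact: divr_gt0.
apply: (@le_lt_trans _ _ (M' * \sum_(i < N) (t i - s i))).
  rewrite mulr_sumr; apply: ler_sum => i _; apply: le_trans (yM _ _) _.
  have [_ [h _]] := st i; rewrite ger0_norm ?subr_ge0//; apply: ler_wpM2r.
    by rewrite subr_ge0.
  by rewrite /M' (le_trans (ler_norm M))// lerDl.
by rewrite mulrC -ltr_pdivlMr.
Qed.

Lemma lipschitz_rV_ae_derivable (y : R -> 'rV[R]_n) (M : R) :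
  (forall s t, `|y s - y t| <= M * `|s - t|) ->
  {ae lebesgue_measure, forall t : R, derivable y t 1}.
Proof.
move=> yM.
have : {ae lebesgue_measure, forall t : R, forall k : nat, if insub k is Some i then
    derivable (fun s => y s ord0 (i : 'I_n)) t 1 else True}.
  apply/ae_foralln => k; case: insubP => [i _ _|_]; last exact: aeW.
  apply: (@lipschitz_ae_derivable _ _ M) => s t; apply: le_trans (yM s t).
  by apply: le_trans (le_coord_norm _ i); rewrite !mxE.
apply: filterS; first exact: (ae_filter_ringOfSetsType lebesgue_measure).
move=> t ht; apply/derivable_mxP => a i; rewrite (ord1 a).
by have := ht i; rewrite valK.
Qed.

End lipschitz_curves.

(** * Limits of Euler chains *)

Section euler_limits.
Context {R : realType} {n m nX nU : nat}.
Variables (f : 'I_n -> {mpoly R[n + m]}).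
Variables (gX : 'I_nX -> {mpoly R[n]}) (gU : 'I_nU -> {mpoly R[m]}) (r0 : R).
Hypothesis gXr0 : forall x, semialg gX x -> `|x| <= r0.

Lemma euler_increment (M tau : R) (xs : nat -> 'rV[R]_n) (us : nat -> 'rV[R]_m) (i j : nat) :
  0 <= tau -> (forall x u, semialg gU u -> `|clipped_field f r0 x u| <= M) ->
  (forall k, (k < j)%N -> semialg gU (us k) /\
     xs k.+1 = xs k + tau *: clipped_field f r0 (xs k) (us k)) ->
  (i <= j)%N -> `|xs j - xs i| <= M * ((j - i)%:R * tau).
Proof.
move=> t0 hM; elim: j => [|j ih] step.
  by rewrite leqn0 => /eqP ->; rewrite subrr normr0 mul0r mulr0.
rewrite leq_eqVlt => /predU1P[->|]; first by rewrite subrr subnn normr0 mul0r mulr0.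
rewrite ltnS => ij; have [Uj ->] := step j (ltnSn j).
rewrite addrAC (le_trans (ler_normD _ _))// subSn// -natr1 mulrDl mul1r mulrDr.
apply: lerD; first by apply: ih => // k kj; apply: step; exact: ltnW.
by rewrite normrZ ger0_norm// mulrC ler_wpM2r// hM.
Qed.

(** Here the convex hull arises: the displacement over a block of steps is its duration times the
    mean of the fields met, and replacing each state by x turns this mean into a convex combination
    at x, with error L rho per unit of time. *)
Lemma euler_average (x : 'rV[R]_n) (L rho tau : R) (xs : nat -> 'rV[R]_n)
    (us : nat -> 'rV[R]_m) (i j : nat) : 0 < tau -> 0 <= L -> semialg gX x ->
  (forall x x' u, semialg gU u ->
    `|clipped_field f r0 x u - clipped_field f r0 x' u| <= L * `|x - x'|) ->
  (forall k, (i <= k < j)%N -> [/\ semialg gU (us k), `|xs k - x| <= rho &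
     xs k.+1 = xs k + tau *: clipped_field f r0 (xs k) (us k)]) ->
  (i < j)%N -> exists2 a, conv_hull [set vfield f x u | u in semialg gU] a &
    `|xs j - xs i - ((j - i)%:R * tau) *: a| <= L * rho * ((j - i)%:R * tau).
Proof.
move=> t0 L0 Xx hL step ij.
pose N := (j - i)%N; have N0 : (0 < N%:R :> R) by rewrite ltr0n subn_gt0.
have stepN (k : 'I_N) : [/\ semialg gU (us (i + k)%N), `|xs (i + k)%N - x| <= rho &
    xs (i + k).+1 = xs (i + k)%N + tau *: clipped_field f r0 (xs (i + k)%N) (us (i + k)%N)].
  by apply: step; rewrite leq_addr/= -ltn_subRL.
exists (\sum_(k < N) N%:R^-1 *: vfield f x (us (i + k)%N)).
  apply: (@convex_comb_hull _ _ _ N); exists (fun=> N%:R^-1), (fun k => vfield f x (us (i + k)%N)).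
  split=> //.
  - by rewrite sumr_const card_ord -[LHS]mulr_natl mulfV// gt_eqF.
  - by move=> k; exists (us (i + k)%N) => //; case: (stepN k).
have -> : xs j - xs i = \sum_(k < N) tau *: clipped_field f r0 (xs (i + k)%N) (us (i + k)%N).
  have -> : \sum_(k < N) tau *: clipped_field f r0 (xs (i + k)%N) (us (i + k)%N) =
      \sum_(k < N) (xs (i + k).+1 - xs (i + k)%N).
    by apply: eq_bigr => k _; have [_ _ ->] := stepN k; rewrite addrC addKr.
  rewrite -(big_mkord xpredT (fun k => xs (i + k).+1 - xs (i + k)%N)).
  under eq_bigr do rewrite -addnS.
  by rewrite (telescope_sumr (fun k => xs (i + k)%N))// addn0 subnKC// ltnW.
rewrite scaler_sumr -sumrB (le_trans (ler_norm_sum _ _ _))//.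
apply: (@le_trans _ _ (\sum_(k < N) tau * (L * rho))); last first.
  by rewrite sumr_const card_ord -[leLHS]mulr_natl mulrA [leRHS]mulrC.
apply: ler_sum => k _; have [Uk kr _] := stepN k.
rewrite scalerA -mulrA mulrCA mulfV ?gt_eqF// mulr1 -scalerBr normrZ gtr0_norm//.
rewrite ler_pM2l// -(clipped_fieldE f gXr0 _ Xx) (le_trans (hL _ _ _ Uk))//.
by rewrite ler_wpM2l.
Qed.

End euler_limits.

Section continuous_limits.
Context {R : realType} {n m nX nU : nat}.
Variables (f : 'I_n -> {mpoly R[n + m]}).
Variables (gX : 'I_nX -> {mpoly R[n]}) (gU : 'I_nU -> {mpoly R[m]}) (r0 rU : R).
Hypotheses (r00 : 0 <= r0) (gXr0 : forall x, semialg gX x -> `|x| <= r0).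
Hypotheses (gUrU : forall u, semialg gU u -> `|u| <= rU) (cU : compact (semialg gU)).
Variables (G : set_system nat) (x0 : 'rV[R]_n) (tau : nat -> R).
Variables (xs : nat -> nat -> 'rV[R]_n) (us : nat -> nat -> 'rV[R]_m).
Hypotheses (GU : UltraFilter G) (tau0 : forall l, 0 < tau l).
Hypotheses (tau_small : forall e, 0 < e -> G [set l | tau l < e]).
Hypotheses (xs0 : forall l, xs l 0%N = x0).
Let good (T : R) (l : nat) : Prop := forall i, i%:R * tau l <= T ->
  semialg gU (us l i) /\ xs l i.+1 = xs l i + tau l *: clipped_field f r0 (xs l i) (us l i).
Hypotheses (steps : forall T, G [set l | good T l]).
Hypotheses (viol : forall T e, 0 < e ->
  G [set l | forall i, i%:R * tau l <= T -> violation gX r0 (xs l i) < e]).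

Let PG : ProperFilter G. Proof. exact: ultra_proper. Qed.

Let idx l (t : R) := Num.truncn (t / tau l).

Let idx_itv l t : 0 <= t -> (idx l t)%:R * tau l <= t < (idx l t)%:R * tau l + tau l.
Proof.
move=> t0; have h : 0 <= t / tau l by rewrite divr_ge0// ltW.
have /andP[h1 h2] := truncn_itv h.
by rewrite -ler_pdivlMr// h1 -[X in _ + X]mul1r -mulrDl natr1 -ltr_pdivrMr.
Qed.

(** The piecewise constant interpolation of the l-th Euler chain, of step [tau l]. *)
Let z l (t : R) := xs l (idx l t).

(** The interpolations are Lipschitz up to an error M tau, so the limit is Lipschitz and
    differentiable almost everywhere. Its difference quotients over [t, t + h] are within O(h) of
    the hull at y(t), which is closed. *)
Lemma continuous_limit : mci_continuous f (semialg gX) (semialg gU) x0.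
Proof.
have [L [M [L0 M0 hM hL]]] := clipped_field_lipschitz f r00 gUrU.
have zinc l T s t : good T l -> 0 <= s -> s <= t -> t <= T ->
    `|z l t - z l s| <= M * (t - s + tau l).
  move=> gT s0 st tT; have t0 := le_trans s0 st.
  have /andP[t1 t2] := idx_itv l t0; have /andP[s1 s2] := idx_itv l s0.
  have ij : (idx l s <= idx l t)%N by rewrite le_truncn// ler_pM2r// invr_gt0.
  apply: le_trans (euler_increment (ltW (tau0 l)) hM _ ij) _.
    move=> k kj; apply: gT; apply: le_trans tT; apply: le_trans t1.
    by rewrite ler_pM2r// ler_nat ltnW.
  rewrite ler_wpM2l// natrB// mulrBl; lra.
have z0 l : z l 0 = x0 by rewrite /z /idx mul0r truncn0.
(* Negative times are sent to 0, so that the limit curve is Lipschitz on the whole line, as the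
   differentiability lemma requires. *)
have cy t : exists p : 'rV[R]_n, z^~ (Num.max 0 t) @ G --> p.
  set t' := Num.max 0 t; have t'0 : 0 <= t' by rewrite le_max lexx.
  have c0 : 0 <= `|x0| + M * (t' + 1) by rewrite addr_ge0// mulr_ge0// addr_ge0.
  have [|p _ hp] := @ultra_compact_lim _ _ G _ (z^~ t') GU (@compact_norm_le R n _ c0).
  - apply: filterS (filterI (steps t') (tau_small ltr01)) => l [gl /= tl].
    have := zinc l t' 0 t' gl (lexx _) t'0 (lexx _); rewrite z0 subr0 => h.
    rewrite -(subrK x0 (z l t')) (le_trans (ler_normD _ _))// addrC lerD2l.
    by apply: (le_trans h); rewrite ler_wpM2l// lerD2l ltW.
  - by exists p.
have [y hy] := choice cy.
have hyp t : 0 <= t -> z^~ t @ G --> y t.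
  by move=> t0; have := hy t; rewrite max_r.
have near_l T e (ts : seq R) : 0 < e -> (forall t, t \in ts -> 0 <= t) ->
    exists l, [/\ good T l, tau l < e & forall t, t \in ts -> `|y t - z l t| < e].
  move=> e0 hts.
  have h : G [set l | forall t, t \in ts -> `|y t - z l t| < e].
    elim: ts hts => [|t ts ih] hts; first by apply: filterS filterT.
    have t0 : 0 <= t by apply: hts; rewrite inE eqxx.
    have hts' s : s \in ts -> 0 <= s by move=> sts; apply: hts; rewrite inE sts orbT.
    apply: filterS (filterI (cvg_dist_lt _ (hyp t t0) e0) (ih hts')) => l [h1 h2] s.
    by rewrite inE => /predU1P[->|]; [exact: h1|exact: h2].
  by have [l [h1 [h2 h3]]] := filter_ex (filterI (steps T) (filterI (tau_small e0) h)); exists l.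
have ylip s t : `|y s - y t| <= M * `|s - t|.
  have ymax a : y a = y (Num.max 0 a).
    have h := hy a; have h' := hyp (Num.max 0 a); rewrite le_max lexx in h'.
    exact: (cvg_unique _ h (h' isT)).
  have key a b : 0 <= a -> a <= b -> `|y b - y a| <= M * (b - a).
    move=> a0 ab; have b0 := le_trans a0 ab.
    apply/ler_addgt0Pr => e e0; pose e1 := e / (2 + M).
    have d0 : 0 < 2 + M by rewrite ltr_pwDl.
    have e10 : 0 < e1 by rewrite divr_gt0.
    have [|l [gl tl hl]] := near_l b e1 [:: a; b] e10.
      by move=> t'; rewrite !inE => /orP[/eqP ->|/eqP ->].
    have := zinc l b a b gl a0 ab (lexx _).
    have ha : `|y a - z l a| < e1 by apply: hl; rewrite inE eqxx.
    have hb : `|y b - z l b| < e1 by apply: hl; rewrite !inE eqxx orbT.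
    have : M * (b - a + tau l) <= M * (b - a) + M * e1 by rewrite -mulrDr ler_wpM2l// lerD2l ltW.
    have : e1 + e1 + M * e1 = e by rewrite /e1; field; rewrite gt_eqF.
    have -> : y b - y a = (y b - z l b) + (z l b - z l a) - (y a - z l a).
      by rewrite addrA subrK opprB addrA subrK.
    have := ler_normB (y b - z l b + (z l b - z l a)) (y a - z l a).
    have := ler_normD (y b - z l b) (z l b - z l a).
    lra.
  rewrite (ymax s) (ymax t); have [st|ts] := leP (Num.max 0 s) (Num.max 0 t).
    rewrite distrC; apply: (le_trans (key _ _ _ st)); first by rewrite le_max lexx.
    rewrite ler_wpM2l//; apply: le_trans (normB_max_le 0 s t).
    by rewrite distrC ler_norm.
  apply: (le_trans (key _ _ _ (ltW ts))); first by rewrite le_max lexx.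
  by rewrite ler_wpM2l//; apply: le_trans (normB_max_le 0 s t); exact: ler_norm.
have y0 : y 0 = x0.
  have h := hyp 0 (lexx _); rewrite (_ : z^~ 0 = fun=> x0) in h; last by apply/funext => l; rewrite z0.
  exact: (cvg_unique _ h (cvg_cst _)).
have yX t : 0 <= t -> semialg gX (y t).
  move=> t0; apply: (@violation_limit _ _ _ _ _ r00 gXr0 G _ _ PG (hyp t t0)) => e e0.
  apply: filterS (viol t e0) => l h; apply: h.
  by case/andP: (idx_itv l t0).
pose H t := conv_hull [set vfield f (y t) u | u in semialg gU].
(* Approximating y at both ends within h^2 / 2 leaves an error O(h) on the quotient; a step smaller
   than that also guarantees a nonempty block of steps between t and t + h. *)
have growth t h : 0 <= t -> 0 < h -> h < 1 -> exists2 a, H t a &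
    `|h^-1 *: (y (t + h) - y t) - a| <= (1 + M + 2 * (L * (2 * M + 1))) * h.
  move=> t0 h0 h1; pose e := h ^+ 2 / 2.
  have e0 : 0 < e by rewrite divr_gt0// exprn_gt0.
  have hh : h ^+ 2 <= h by rewrite expr2 ler_piMr// ltW.
  have eh : e <= h by rewrite /e; lra.
  have e2 : e < h by rewrite /e; lra.
  have [|l [gl tl hl]] := near_l (t + h) e [:: t; t + h] e0.
    by move=> t'; rewrite !inE => /orP[/eqP ->|/eqP ->]//; lra.
  have th0 : 0 <= t + h by lra.
  have /andP[i1 i2] := idx_itv l t0; have /andP[j1 j2] := idx_itv l th0.
  set i := idx l t in i1 i2; set j := idx l (t + h) in j1 j2.
  have ij : (i < j)%N.
    by rewrite -(ltr_nat R) -(ltr_pM2r (tau0 l)); lra.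
  have ha : `|y t - z l t| < e by apply: hl; rewrite inE eqxx.
  have hb : `|y (t + h) - z l (t + h)| < e by apply: hl; rewrite !inE eqxx orbT.
  have tl0 := tau0 l.
  pose d := (j - i)%:R * tau l.
  have dE : d = j%:R * tau l - i%:R * tau l by rewrite /d natrB ?mulrBl// ltnW.
  have d0 : 0 < d by rewrite dE; lra.
  have dh : `|d - h| <= e by rewrite dE ler_norml; apply/andP; lra.
  have [a Ha hd] : exists2 a, H t a & `|xs l j - xs l i - d *: a| <= L * (M * (h + e) + e) * d.
    apply: (@euler_average _ _ _ _ _ f gX gU r0 gXr0 (y t) L (M * (h + e) + e) (tau l) (xs l) (us l) i j) => //.
    - exact: yX.
    - move=> x x' u Uu; have := hL x x' u u Uu Uu; by rewrite subrr normr0 addr0.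
    - move=> k /andP[ik kj].
      have kt : k%:R * tau l <= t + h.
        by apply: le_trans j1; rewrite ler_pM2r// ler_nat ltnW.
      have [Uk sk] := gl k kt; split=> //.
      have -> : xs l k - y t = (xs l k - xs l i) - (y t - z l t).
        by rewrite opprB addrA subrK.
      apply: (le_trans (ler_normB _ _)); apply: lerD; last exact: ltW.
      apply: (le_trans (euler_increment (ltW tl0) hM _ ik)).
        move=> p pk; apply: gl; apply: le_trans kt.
        by rewrite ler_pM2r// ler_nat ltnW.
      rewrite ler_wpM2l// natrB// mulrBl.
      have : k%:R * tau l <= j%:R * tau l by rewrite ler_pM2r// ler_nat ltnW.
      lra.
  exists a => //.
  have aM : `|a| <= M.
    have : H t `<=` [set a | `|a| <= M].
      apply: conv_hull_min => [_ [u Uu <-]|p q s s0 s1 /= hp hq].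
        by rewrite /= -(clipped_fieldE f gXr0) ?hM//; exact: yX.
      rewrite (le_trans (ler_normD _ _))// !normrZ !ger0_norm ?subr_ge0//.
      have : s * `|p| <= s * M by rewrite ler_wpM2l.
      have : (1 - s) * `|q| <= (1 - s) * M by rewrite ler_wpM2l// subr_ge0.
      lra.
    exact.
  have hi0 : 0 < h^-1 by rewrite invr_gt0.
  rewrite -(ler_pM2l h0) -{1}(gtr0_norm h0) -normrZ scalerBr scalerA mulfV ?gt_eqF// scale1r.
  have -> : y (t + h) - y t - h *: a = (y (t + h) - z l (t + h)) - (y t - z l t) +
      (xs l j - xs l i - d *: a) + (d - h) *: a.
    rewrite -[z l (t + h)]/(xs l j) -[z l t]/(xs l i); apply/rowP => c; rewrite !mxE; ring.
  have n1 := ler_normD (y (t + h) - z l (t + h) - (y t - z l t) + (xs l j - xs l i - d *: a)) ((d - h) *: a).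
  have n2 := ler_normD (y (t + h) - z l (t + h) - (y t - z l t)) (xs l j - xs l i - d *: a).
  have n3 := ler_normB (y (t + h) - z l (t + h)) (y t - z l t).
  have n4 : `|(d - h) *: a| <= e * M by rewrite normrZ ler_pM.
  have n5 : L * (M * (h + e) + e) * d <= L * (M * (h + h) + h) * (2 * h).
    have dd : d <= 2 * h by move: dh; rewrite ler_norml => /andP[]; lra.
    apply: ler_pM => //; [|exact: ltW|].
      by rewrite mulr_ge0// addr_ge0 ?mulr_ge0// ?addr_ge0// ltW.
    by rewrite ler_wpM2l// lerD// ler_wpM2l// lerD2l.
  apply: (le_trans n1); apply: (le_trans (lerD n2 n4)).
  have n6 : `|y (t + h) - z l (t + h) - (y t - z l t)| <= h ^+ 2 by rewrite /e in ha hb *; lra.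
  have n7 : e * M <= h ^+ 2 * M by rewrite ler_wpM2r// /e; have := sqr_ge0 h; lra.
  have n8 := le_trans hd n5.
  rewrite (_ : L * (M * (h + h) + h) * (2 * h) = 2 * (L * (2 * M + 1)) * h ^+ 2) in n8; last by ring.
  have -> : h * ((1 + M + 2 * (L * (2 * M + 1))) * h) =
      h ^+ 2 + h ^+ 2 * M + 2 * (L * (2 * M + 1)) * h ^+ 2 by ring.
  lra.
exists y; split=> //.
- by move=> b b0; exact: lipschitz_abs_cont ylip.
- have h1 : {ae lebesgue_measure, forall t : R, t != 0}.
    exists [set 0]; split=> //; first exact: lebesgue_measure_set1.
    by move=> t /= /negP; rewrite negbK => /eqP.
  apply: (@filterS2 _ _ (ae_filter_ringOfSetsType lebesgue_measure) _ _ _ _ (lipschitz_rV_ae_derivable ylip) h1).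
  move=> t dy tn0 t0; split=> //.
  have cl : closed (H t) by apply: conv_hull_closed; exact: compact_vfield_image.
  apply: cl => B /nbhs_ballP[e /= e0 eB].
  pose C := 1 + M + 2 * (L * (2 * M + 1)).
  have C0 : 0 < C by rewrite /C -addrA ltr_pwDl// addr_ge0// mulr_ge0// mulr_ge0// addr_ge0// mulr_ge0.
  have dcv : (fun h : R => h^-1 *: (y (h *: 1 + t) - y t)) @ 0^' --> 'D_1 y t by exact: dy.
  have e20 : 0 < e / 2 by exact: divr_gt0.
  have /cvgrPdist_lt/(_ _ e20)/nbhs_ballP[d /= d0 hd] := dcv.
  (* Small enough for the quotient to be e/2-close to the derivative, for [growth] to apply, and for
     its bound C h to be at most e/2. *)
  pose h := Num.min (d / 2) (Num.min (1 / 2) (e / 2 / C)).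
  have h0 : 0 < h by rewrite !lt_min !divr_gt0.
  have hd2 : h <= d / 2 by rewrite /h ge_min lexx.
  have h12 : h <= 1 / 2 by rewrite /h !ge_min lexx orbT.
  have heC : h <= e / 2 / C by rewrite /h !ge_min lexx !orbT.
  have h1' : h < 1 by lra.
  have [a Ha ha] := growth t h t0 h0 h1'.
  exists a; split=> //; apply: eB; rewrite -ball_normE /= derive1E.
  have := hd h; rewrite -ball_normE /= sub0r normrN gtr0_norm// => /(_ ltac:(lra) (lt0r_neq0 h0)).
  rewrite -[h *: 1]/(h * 1) mulr1 (addrC h) => q1.
  have q2 : C * h <= e / 2 by rewrite mulrC -ler_pdivlMr.
  rewrite -(subrK (h^-1 *: (y (t + h) - y t)) ('D_1 y t)) -addrA.
  have := ler_normD ('D_1 y t - h^-1 *: (y (t + h) - y t)) (h^-1 *: (y (t + h) - y t) - a).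
  move: ha; rewrite -/C; move: q1 q2; lra.
Qed.

End continuous_limits.

(** * Invariance from a nonnegative Lv *)

Section certificates.
Context {R : realType}.

Lemma is_sos_peval_ge0 n (k : nat) (p : {mpoly R[n]}) x : is_sos k p -> 0 <= peval p x.
Proof.
move=> [s _ ->]; rewrite peval_sum; apply: sumr_ge0 => h _.
by rewrite pevalXn exprn_even_ge0.
Qed.

Context {n m nX nU : nat}.
Variables (f : 'I_n -> {mpoly R[n + m]}).
Variables (gX : 'I_nX -> {mpoly R[n]}) (gU : 'I_nU -> {mpoly R[m]}).

Lemma cert_x_peval_ge0 k p x : cert_x gX k p -> semialg gX x -> 0 <= peval p x.
Proof.
move=> [s0 [s [h0 h ->]]] Xx; rewrite pevalD peval_sum addr_ge0//.
  exact: is_sos_peval_ge0 h0.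
apply: sumr_ge0 => i _; rewrite pevalM mulr_ge0//; exact: is_sos_peval_ge0 (h i).
Qed.

Lemma cert_xu_peval_ge0 k p x u : cert_xu gX gU k p -> semialg gX x -> semialg gU u ->
  0 <= peval p (row_mx x u).
Proof.
move=> [q0 [q [r [h0 hq hr ->]]]] Xx Uu; rewrite !pevalD !peval_sum !addr_ge0//.
- exact: is_sos_peval_ge0 h0.
- apply: sumr_ge0 => i _; rewrite pevalM peval_lift_x mulr_ge0//.
  exact: is_sos_peval_ge0 (hq i).
- apply: sumr_ge0 => i _; rewrite pevalM peval_lift_u mulr_ge0//.
  exact: is_sos_peval_ge0 (hr i).
Qed.

Lemma peval_Lop_discrete a v x u :
  peval (Lop (DiscreteTime a) f v) (row_mx x u) = peval v x - a * peval v (vfield f x u).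
Proof. by rewrite /= pevalB pevalZ peval_lift_x peval_comp_vfield. Qed.

Lemma peval_Lop_continuous b v x u :
  peval (Lop (ContinuousTime b) f v) (row_mx x u) =
  b * peval v x - \sum_i peval (mderiv i v) x * vfield f x u ord0 i.
Proof.
rewrite /= pevalB pevalZ peval_lift_x peval_sum; congr (_ - _).
by apply: eq_bigr => i _; rewrite pevalM peval_lift_x mxE.
Qed.

End certificates.

Section invariance.
Context {R : realType} {n m nX nU : nat}.
Variables (f : 'I_n -> {mpoly R[n + m]}).
Variables (gX : 'I_nX -> {mpoly R[n]}) (gU : 'I_nU -> {mpoly R[m]}) (r0 : R).
Hypothesis gXr0 : forall x, semialg gX x -> `|x| <= r0.
Variable v : {mpoly R[n]}.

(** Along a trajectory alpha^t v(x_t) <= v(x_0); as v is bounded on the state set, the left side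
    tends to 0. *)
Lemma discrete_invariance alpha : 0 < alpha < 1 ->
  (forall x u, semialg gX x -> semialg gU u ->
     0 <= peval (Lop (DiscreteTime alpha) f v) (row_mx x u)) ->
  mci_discrete f (semialg gX) (semialg gU) `<=` [set x | 0 <= peval v x].
Proof.
move=> /andP[a0 a1] hv x0 [x [u [<- hx]]] /=.
have [L [K [_ K0 hK _]]] := peval_lipschitz_box v r0.
have dec t : alpha ^+ t * peval v (x t) <= peval v (x 0%N).
  elim: t => [|t ih]; first by rewrite expr0 mul1r.
  apply: le_trans ih; have [-> Uu Xx] := hx t.
  rewrite exprSr -mulrA ler_pM2l ?exprn_gt0//.
  by rewrite -subr_ge0 -peval_Lop_discrete hv.
rewrite leNgt; apply/negP => v0.
have e0 : 0 < - peval v (x 0%N) / (K + 1) by rewrite divr_gt0 ?oppr_gt0// ltr_wpDl.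
have a1' : `|alpha| < 1 by rewrite gtr0_norm.
have /cvgrPdist_lt/(_ _ e0)/filter_ex[t] := cvg_expr a1'.
rewrite sub0r normrN gtr0_norm ?exprn_gt0// ltr_pdivlMr ?ltr_wpDl// => ht.
have at0 : 0 < alpha ^+ t by rewrite exprn_gt0.
have := dec t; have := hK (x t) (gXr0 (let: And3 _ _ h := hx t in h)).
rewrite ler_norml => /andP[hKt _].
have : alpha ^+ t * - K <= alpha ^+ t * peval v (x t) by rewrite ler_pM2l.
move: ht at0; rewrite mulrDr mulr1; lra.
Qed.

Lemma expR_discount_dist (b s t : R) : 0 < b -> 0 <= s -> s <= t ->
  `|expR (- (b * t)) - expR (- (b * s))| <= b * (t - s).
Proof.
move=> b0 s0 st; rewrite distrC ger0_norm; last first.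
  by rewrite subr_ge0 ler_expR lerN2 ler_pM2l.
have -> : - (b * t) = - (b * s) + - (b * (t - s)) by ring.
rewrite expRD -[X in X - _]mulr1 -mulrBr.
have h1 : expR (- (b * s)) <= 1 by rewrite -expR0 ler_expR oppr_le0 mulr_ge0// ltW.
have h2 : 1 - expR (- (b * (t - s))) <= b * (t - s).
  by have := expR_ge1Dx (- (b * (t - s))); lra.
rewrite -[leRHS]mul1r ler_pM ?expR_ge0// subr_ge0 -expR0 ler_expR oppr_le0.
by rewrite mulr_ge0 ?subr_ge0// ltW.
Qed.

(** For fixed x the inequality is affine in the velocity, so it extends from the fields to their
    hull. *)
Lemma conv_hull_peval_deriv_le beta x : semialg gX x ->
  (forall u, semialg gU u -> 0 <= peval (Lop (ContinuousTime beta) f v) (row_mx x u)) ->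
  forall d, conv_hull [set vfield f x u | u in semialg gU] d ->
  \sum_i peval (mderiv i v) x * d ord0 i <= beta * peval v x.
Proof.
move=> Xx hv d.
have : conv_hull [set vfield f x u | u in semialg gU] `<=`
    [set d | \sum_i peval (mderiv i v) x * d ord0 i <= beta * peval v x]; last exact.
apply: conv_hull_min => [_ [u Uu <-]|p q s s0 s1 /= hp hq].
  by rewrite /= -subr_ge0 -peval_Lop_continuous hv.
rewrite (eq_bigr (fun i => s * (peval (mderiv i v) x * p ord0 i) +
    (1 - s) * (peval (mderiv i v) x * q ord0 i))); last by move=> i _; rewrite !mxE; ring.
rewrite big_split/= -!mulr_sumr.
rewrite -[leRHS](_ : s * (beta * peval v x) + (1 - s) * (beta * peval v x) = _); last by ring.
by rewrite lerD// ler_wpM2l// subr_ge0.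
Qed.

(** exp(- beta t) v(y(t)) is absolutely continuous with nonpositive derivative almost everywhere,
    hence nonincreasing, while v is bounded on the state set. *)
Lemma continuous_invariance beta : 0 < beta ->
  (forall x u, semialg gX x -> semialg gU u ->
     0 <= peval (Lop (ContinuousTime beta) f v) (row_mx x u)) ->
  mci_continuous f (semialg gX) (semialg gU) `<=` [set x | 0 <= peval v x].
Proof.
move=> b0 hv x0 [y [<- acy dy Xy]] /=.
have [L [K [L0 K0 hK hL]]] := peval_lipschitz_box v r0.
pose F t := expR (- (beta * t)) * peval v (y t).
have Fdist s t : 0 <= s -> s <= t ->
    `|F t - F s| <= beta * K * (t - s) + L * `|y t - y s|.
  move=> s0 st; have t0 := le_trans s0 st.
  have -> : F t - F s = (expR (- (beta * t)) - expR (- (beta * s))) * peval v (y t) +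
      expR (- (beta * s)) * (peval v (y t) - peval v (y s)) by rewrite /F; ring.
  apply: (le_trans (ler_normD _ _)); rewrite !normrM; apply: lerD.
    rewrite mulrAC ler_pM//; first exact: expR_discount_dist.
    exact/hK/gXr0/Xy.
  rewrite -[leRHS]mul1r ler_pM//.
    by rewrite ger0_norm ?expR_ge0// -expR0 ler_expR oppr_le0 mulr_ge0// ltW.
  by apply: hL; exact/gXr0/Xy.
have decF b : 0 <= b -> F b <= F 0.
  move=> bge0; apply: ac_nonincreasing => // [e e0|].
    have e1 : 0 < e / 2 / (L + 1) by rewrite divr_gt0 ?divr_gt0// ltr_wpDl.
    have bK0 : 0 <= beta * K by rewrite mulr_ge0// ltW.
    have e2 : 0 < e / 2 / (beta * K + 1) by rewrite divr_gt0 ?divr_gt0// ltr_wpDl.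
    have [d d0 hd] := acy b bge0 _ e1.
    exists (Num.min d (e / 2 / (beta * K + 1))); first by rewrite lt_min d0.
    move=> N s t st tr; rewrite lt_min => /andP[sd se].
    have h1 := hd N s t st tr sd.
    apply: (@le_lt_trans _ _ (\sum_(i < N) (beta * K * (t i - s i) + L * `|y (t i) - y (s i)|))).
      by apply: ler_sum => i _; have [? [? _]] := st i; exact: Fdist.
    rewrite big_split/= -!mulr_sumr.
    move: h1 se; rewrite !ltr_pdivlMr ?ltr_wpDl// !mulrDr !mulr1.
    set A := \sum_(i < N) (t i - s i); set B := \sum_(i < N) `|_|.
    have A0 : 0 <= A by apply: sumr_ge0 => i _; have [_ [? _]] := st i; rewrite subr_ge0.
    have B0 : 0 <= B by exact: sumr_ge0.
    rewrite (mulrC L B) (mulrC _ A); lra.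
  apply: filterS dy; first exact: (ae_filter_ringOfSetsType lebesgue_measure).
  move=> t ht /andP[t0 tb]; have [dyt hull] := ht (ltW t0).
  pose d i := derive1 y t ord0 i.
  have hd i : is_derive t 1 (fun s => y s ord0 i) (d i).
    have /derivable_mxP/(_ ord0 i) dyi := dyt.
    apply: DeriveDef; first exact: dyi.
    by rewrite /d derive1E derive_mx// mxE.
  have hp := is_derive_peval v hd.
  have he : is_derive t 1 (fun s : R => expR (- (beta * s))) (- beta * expR (- (beta * t))).
    have hl : is_derive t 1 (fun s : R => - (beta * s)) (- beta).
      have -> : (fun s : R => - (beta * s)) = - beta \*: id by apply/funext => s; rewrite /= -mulNr.
      by apply: is_derive_eq; rewrite -[RHS]mulr1.
    have := @is_derive1_comp R expR _ t _ _ (is_derive_expR _) hl.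
    by rewrite mulrC.
  have hF : is_derive t 1 F (expR (- (beta * t)) *
      (\sum_i peval (mderiv i v) (y t) * d i - beta * peval v (y t))).
    apply: (is_derive_eq (is_deriveM he hp)).
    by rewrite -[_ *: _ + _]/(_ * _ + _ * _); ring.
  split; first exact: ex_derive.
  rewrite derive1E derive_val pmulr_rle0 ?expR_gt0// subr_le0.
  apply: conv_hull_peval_deriv_le hull; first exact/Xy/ltW.
  by move=> u Uu; apply: hv => //; exact/Xy/ltW.
have F0 : F 0 = peval v (y 0) by rewrite /F mulr0 oppr0 expR0 mul1r.
rewrite leNgt; apply/negP => v0; set a := - peval v (y 0).
have a0 : 0 < a by rewrite oppr_gt0.
(* At this time exp(beta b) >= 1 + K / a, so the discounted lower bound - K exp(- beta b) exceeds -
   a = v(y(0)), a contradiction. *)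
pose b := K / (beta * a).
have bge0 : 0 <= b by rewrite divr_ge0// mulr_ge0// ltW.
have := decF b bge0; rewrite F0.
have hexp : 1 + K / a <= expR (beta * b).
  apply: le_trans (expR_ge1Dx _); rewrite lerD2l /b.
  by rewrite le_eqVlt; apply/orP; left; apply/eqP; field; rewrite !gt_eqF.
have := hK _ (gXr0 (Xy b bge0)); rewrite ler_norml => /andP[hKb _].
have E0 := expR_gt0 (- (beta * b)).
have : expR (- (beta * b)) * - K <= F b by rewrite ler_pM2l.
have : expR (- (beta * b)) * (a + K) <= a.
  rewrite expRN mulrC ler_pdivrMr ?expR_gt0//.
  have -> : a + K = a * (1 + K / a) by rewrite mulrDr mulr1 mulrC divfK// gt_eqF.
  by rewrite ler_pM2l.
have : 0 < expR (- (beta * b)) * a by exact: mulr_gt0.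
rewrite -[peval v (y 0)]opprK -/a mulrDr; lra.
Qed.

End invariance.

(** * Polynomial subsolutions *)

Lemma peval_mean_value {R : realType} n (P : {mpoly R[n]}) (x d : 'rV[R]_n) :
  exists2 s : R, 0 <= s <= 1 &
    peval P (x + d) - peval P x = \sum_i peval (mderiv i P) (x + s *: d) * d ord0 i.
Proof.
have hd (s : R) : is_derive s 1 (fun t : R => peval P (x + t *: d))
    (\sum_i peval (mderiv i P) (x + s *: d) * d ord0 i).
  apply: is_derive_peval => i.
  have -> : (fun t : R => (x + t *: d) ord0 i) = cst (x ord0 i) + (d ord0 i \*: id).
    by apply/funext => t; rewrite !mxE mulrC.
  by apply: is_derive_eq; rewrite add0r -[LHS]/(_ * _) mulr1.
have [|s + h] := @MVT R _ _ 0 1 ltr01 (fun s _ => hd s).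
  apply: derivable_within_continuous => t _; exact: ex_derive.
rewrite in_itv/= => /andP[s0 s1]; move: h.
rewrite scale1r scale0r addr0 subr0 mulr1 => ->; by exists s => //; rewrite !ltW.
Qed.

(** P averages over cubes of side e a polynomial Q that is e^4-close to V. Each e d_i P is a
    difference of Q at points e apart, so its oscillation is inherited from the Lipschitz bound of
    V. *)
Lemma smooth_lipschitz_approx {R : realType} n (V : 'rV[R]_n -> R) (r L e : R) :
  0 <= r -> 0 <= L -> 0 < e -> e <= 1 -> (forall x y, `|V x - V y| <= L * `|x - y|) ->
  exists P : {mpoly R[n]},
    (forall a b x y, `|x| <= r -> `|y| <= r -> exists2 th : 'rV[R]_n, `|th| <= e &
      `|a * peval P x + b * peval P y - (a * V (x + th) + b * V (y + th))|
        <= (`|a| + `|b|) * e ^+ 4) /\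
    (forall i x y, `|x| <= r -> `|y| <= r ->
      e * `|peval (mderiv i P) x - peval (mderiv i P) y| <= 2 * L * `|x - y| + 4 * e ^+ 4).
Proof.
move=> r0 L0 e0 e1 VL.
have e40 : 0 < e ^+ 4 by exact: exprn_gt0.
have r2 : 0 < r + 2 by rewrite ltr_wpDl.
have [Q hQ] := lipschitz_poly_approx r2 L0 e40 (fun x y _ _ => VL x y).
have [P [hP hdP]] := poly_mollification Q e0.
have thn (th : 'rV[R]_n) : (forall i, 0 <= th ord0 i <= e) -> `|th| <= e.
  move=> h; apply: norm_rV_le => [|i]; first exact: ltW.
  by have /andP[h1 h2] := h i; rewrite ger0_norm.
have shift (x th : 'rV[R]_n) : `|x| <= r -> `|th| <= e -> `|x + th| <= r + 2.
  by move=> h1 h2; apply: (le_trans (ler_normD _ _)); move: h1 h2 e1; lra.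
exists P; split=> [a b x y xr yr|i x y xr yr].
  have [th /thn th1] := hP [:: (a, x); (b, y)].
  rewrite !big_cons !big_nil /= !addr0 => ->; exists th => //.
  have -> : a * peval Q (x + th) + b * peval Q (y + th) - (a * V (x + th) + b * V (y + th)) =
    a * (peval Q (x + th) - V (x + th)) + b * (peval Q (y + th) - V (y + th)) by ring.
  rewrite (le_trans (ler_normD _ _))// !normrM mulrDl.
  by rewrite lerD// ler_wpM2l// hQ// shift.
have [th /thn th1] := hdP i [:: (1, x); (- 1, y)].
rewrite !big_cons !big_nil /= !addr0 !mul1r !mulN1r -mulrBr => h.
have -> : e * `|peval (mderiv i P) x - peval (mderiv i P) y| =
    `|e * (peval (mderiv i P) x - peval (mderiv i P) y)| by rewrite normrM gtr0_norm.
rewrite h {h}.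
have al z : `|z| <= r -> `|along (z + th) i e| <= r + 2.
  move=> zr; rewrite /along -addrA; apply: (le_trans (ler_normD _ _)).
  have : `|e *: (delta_mx ord0 i : 'rV[R]_n)| <= e.
    apply: norm_rV_le => [|k]; first exact: ltW.
    rewrite !mxE eqxx/= normrM gtr0_norm//; case: (k == i); rewrite ?normr0 ?normr1 ?mulr1//.
    by rewrite mulr0 ltW.
  have := ler_normD th (e *: (delta_mx ord0 i : 'rV[R]_n)).
  by move: zr th1 e1; lra.
have h1 := hQ _ (al x xr); have h2 := hQ _ (al y yr).
have h3 := hQ _ (shift x th xr th1); have h4 := hQ _ (shift y th yr th1).
have h5 := VL (along (x + th) i e) (along (y + th) i e).
have h6 := VL (x + th) (y + th).
rewrite (_ : along _ _ _ - along _ _ _ = x - y) in h5; last first.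
  by rewrite /along opprD addrACA subrr addr0 opprD addrACA subrr addr0.
rewrite (_ : _ - (y + th) = x - y) in h6; last by rewrite opprD addrACA subrr addr0.
move: h1 h2 h3 h4 h5 h6; rewrite !ler_norml.
move=> /andP[? ?] /andP[? ?] /andP[? ?] /andP[? ?] /andP[? ?] /andP[? ?].
apply/andP; split; lra.
Qed.

Lemma exists_small {R : realType} (s : seq (R * R)) :
  (forall z, z \in s -> 0 <= z.1 /\ 0 < z.2) ->
  exists2 e : R, 0 < e & forall z, z \in s -> z.1 * e < z.2.
Proof.
elim: s => [|z s ih] hs; first by exists 1.
have [|e e0 he] := ih; first by move=> w ws; apply: hs; rewrite inE ws orbT.
have [z1 z2] := hs z (mem_head _ _).
have w0 : 0 < z.1 + 1 by rewrite ltr_wpDl.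
pose d := z.2 / (z.1 + 1); have d0 : 0 < d by rewrite divr_gt0.
exists (Num.min e d) => [|w]; first by rewrite lt_min e0.
rewrite inE => /predU1P[->|ws]; last first.
  apply: le_lt_trans (he w ws); apply: ler_wpM2l; last by rewrite ge_min lexx.
  by have [] := hs w; rewrite // inE ws orbT.
apply: (@le_lt_trans _ _ (z.1 * d)); first by rewrite ler_wpM2l// ge_min lexx orbT.
by rewrite /d mulrA ltr_pdivrMr// mulrC ltr_pM2l// ltrDl.
Qed.

Section subsolutions.
Context {R : realType} {n m nX nU : nat}.
Variables (f : 'I_n -> {mpoly R[n + m]}).
Variables (gX : 'I_nX -> {mpoly R[n]}) (gU : 'I_nU -> {mpoly R[m]}) (r0 rU : R).
Hypotheses (r00 : 0 <= r0) (gXr0 : forall x, semialg gX x -> `|x| <= r0).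
Hypotheses (gUrU : forall u, semialg gU u -> `|u| <= rU) (U0 : semialg gU !=set0).

Local Notation viol := (violation gX r0).

(* Vanishes near the state set, so that [value] satisfies the dynamic programming
   inequality on a neighbourhood of it. *)
Definition cost (N : nat) (x : 'rV[R]_n) : R := - (N%:R * Num.max 0 (viol x - N%:R^-1)).

Lemma cost_lipschitz : exists L K : R, [/\ 0 <= L, 0 <= K,
  forall x y, `|viol x - viol y| <= L * `|x - y|,
  forall N x, - (N%:R * K) <= cost N x <= 0 &
  forall N x y, `|cost N x - cost N y| <= N%:R * L * `|x - y|].
Proof.
have [L [K [L0 K0 hK hL]]] := violation_lipschitz gX r00.
exists L, K; split=> // [N x|N x y]; rewrite /cost.
  rewrite oppr_le0 lerN2 mulr_ge0 ?ler0n ?le_max ?lexx// andbT.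
  rewrite ler_wpM2l ?ler0n// ge_max K0 lerBlDr (le_trans (hK x))// lerDl invr_ge0 ler0n//.
rewrite -opprD normrN -mulrBr normrM ger0_norm ?ler0n// -mulrA ler_wpM2l ?ler0n//.
apply: (le_trans (normB_max_le 0 _ _)).
by rewrite opprB addrA addrNK.
Qed.

Lemma cost_eq0 N x : viol x <= N%:R^-1 -> cost N x = 0.
Proof. by move=> h; rewrite /cost max_l ?subr_le0// mulr0 oppr0. Qed.

Lemma cost_violation_lt (N : nat) (g : R) x : (0 < N)%N -> 0 < g ->
  - 2 < g * cost N x -> viol x < (1 + 2 / g) / N%:R.
Proof.
move=> N0 g0; rewrite /cost mulrN ltrN2 => h.
have N1 : 0 < N%:R :> R by rewrite ltr0n.
rewrite ltr_pdivlMr//.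
have : g * (N%:R * (viol x - N%:R^-1)) < 2.
  apply: le_lt_trans h; rewrite ler_pM2l// ler_pM2l// le_max lexx orbT//.
rewrite mulrBr mulfV ?gt_eqF// [N%:R * _]mulrC [g * _]mulrC => h2.
by rewrite -ltrBlDl ltr_pdivlMr.
Qed.

(** P is an e-approximation of the value of horizon l and cost factor l + 1, raised by d. P > -1
    forces the value above -1 - d - e >= -2, so a chain exists. *)
Lemma discrete_subsolution alpha (l : nat) : 0 < alpha < 1 -> exists P : {mpoly R[n]},
  [/\ forall x u, semialg gX x -> semialg gU u ->
        0 < peval (Lop (DiscreteTime alpha) f P) (row_mx x u),
      forall x, semialg gX x -> peval P x <= l.+1%:R^-1 &
      forall x, semialg gX x -> - 1 < peval P x -> exists xs us,
        [/\ xs 0%N = x,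
            forall i, (i < l)%N -> semialg gU (us i) /\ xs i.+1 = clipped_field f r0 (xs i) (us i) &
            forall i, (i <= l)%N -> viol (xs i) < (1 + 2 / alpha ^+ i) / l.+1%:R]].
Proof.
move=> /andP[a0 a1].
have [Lf [M [Lf0 M0 hM hLf]]] := clipped_field_lipschitz f r00 gUrU.
have [L [K [L0 K0 _ cK cL]]] := cost_lipschitz.
have cK' := cK l.+1; have cL' := cL l.+1.
pose V := value (clipped_field f r0) (semialg gU) alpha (cost l.+1) l.
have La1 : 1 <= 1 + Lf by rewrite lerDl.
have FL x y u : semialg gU u ->
    `|clipped_field f r0 x u - clipped_field f r0 y u| <= (1 + Lf) * `|x - y|.
  move=> Uu; have := hLf x y u u Uu Uu; rewrite subrr normr0 addr0 => h.
  by apply: (le_trans h); rewrite ler_wpM2r// lerDr.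
have LV := value_lipschitz U0 a0 (ltW a1) cK' (mulr_ge0 (ler0n _ l.+1) L0) La1 cL' FL l.
have Vb := value_bounds (clipped_field f r0) U0 a0 (ltW a1) cK' l.
have N1 : 0 < l.+1%:R :> R by rewrite ltr0n.
pose d : R := l.+1%:R^-1 / 2; have d0 : 0 < d by rewrite divr_gt0// invr_gt0.
have d12 : d <= 1 / 2.
  by rewrite /d ler_pM2r ?invr_gt0// invf_le1// ler1n.
(* Raising by d contributes (1 - alpha) d = 4 e to LP, while the approximation costs at most (1 +
   alpha) e < 2 e. *)
pose e := (1 - alpha) * d / 4.
have e0 : 0 < e by rewrite divr_gt0// mulr_gt0// subr_gt0.
have ed : e <= d.
  have : 0 < alpha * d by exact: mulr_gt0.
  by rewrite /e; lra.
(* This radius covers both the state set and its image under the dynamics. *)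
have r1 : 0 < r0 + M + 1 by rewrite ltr_wpDl// addr_ge0.
have LL0 : 0 <= l.+1%:R * L * (1 + Lf) ^+ l.
  by rewrite !mulr_ge0// exprn_ge0// (le_trans ler01).
have [Q hQ] := lipschitz_poly_approx r1 LL0 e0 (fun x y _ _ => LV x y).
have Xbox x : semialg gX x -> `|x| <= r0 + M + 1.
  move=> /gXr0 h; apply: (le_trans h); rewrite -addrA lerDl addr_ge0//.
exists (Q + mpolyC n d); split=> [x u Xx Uu|x Xx|x Xx].
- rewrite peval_Lop_discrete !pevalD !pevalC.
  have fE := clipped_fieldE f gXr0 u Xx.
  have := value_supersolution (clipped_field f r0) U0 a0 (ltW a1) cK' l _ Uu.
  move=> /(_ x); rewrite cost_eq0 ?(violation_eq0 gXr0 Xx) ?invr_ge0 ?ler0n// => /(_ erefl).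
  rewrite fE -/V; have := hQ x (Xbox x Xx).
  have := hQ (vfield f x u) _; rewrite -/V.
  have -> : `|vfield f x u| <= r0 + M + 1.
    rewrite -fE (le_trans (hM _ _ Uu))// addrAC lerDr addr_ge0//.
  move=> /(_ isT); rewrite !ler_norml => /andP[_ h1] /andP[h2 _] h3.
  have : alpha * (peval Q (vfield f x u) - V (vfield f x u)) <= alpha * e by rewrite ler_pM2l.
  have : alpha * e < e by rewrite -[ltRHS]mul1r ltr_pM2r.
  have : (1 - alpha) * d = 4 * e by rewrite /e; field.
  move: h2 h3 e0; lra.
- rewrite pevalD pevalC; have := hQ x (Xbox x Xx); have /andP[_] := Vb x.
  have : d + d = l.+1%:R^-1 by rewrite /d -splitr.
  by rewrite ler_norml -/V => <- h1 /andP[_ h2]; move: h1 h2 ed; lra.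
- rewrite pevalD pevalC => h.
  have hV : - 2 < V x by have := hQ x (Xbox x Xx); rewrite ler_norml -/V => /andP[_]; move: h d12 ed; lra.
  have [xs [us [h1 h2 h3]]] := value_chain U0 a0 (ltr0n _ 2) hV.
  exists xs, us; split=> // i il.
  by apply: cost_violation_lt => //; [exact: exprn_gt0|exact: h3].
Qed.

End subsolutions.

Section continuous_subsolutions.
Context {R : realType} {n m nX nU : nat}.
Variables (f : 'I_n -> {mpoly R[n + m]}).
Variables (gX : 'I_nX -> {mpoly R[n]}) (gU : 'I_nU -> {mpoly R[m]}) (r0 rU : R).
Hypotheses (r00 : 0 <= r0) (gXr0 : forall x, semialg gX x -> `|x| <= r0).
Hypotheses (gUrU : forall u, semialg gU u -> `|u| <= rU) (U0 : semialg gU !=set0).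

(* [tau = e ^+ 2] is the Euler step and [e] the width of the mollification that
   turns an e^4-approximation of V into P: both the error on the Euler
   difference quotient of V and the oscillation of the gradient of P over one
   step are then O(e). *)
Lemma continuous_subsolution_gap beta tau L M Lf e (P : {mpoly R[n]}) (V : 'rV[R]_n -> R) x u :
  0 < beta -> 0 < e -> e <= 1 -> tau = e ^+ 2 -> 0 <= L -> 0 <= M -> 0 <= Lf -> beta * tau < 1 ->
  (forall x u, semialg gU u -> `|clipped_field f r0 x u| <= M) ->
  (forall x y u, semialg gU u ->
    `|clipped_field f r0 x u - clipped_field f r0 y u| <= Lf * `|x - y|) ->
  (forall x y, `|V x - V y| <= L * `|x - y|) -> (forall x, V x <= 0) ->
  (forall x y u, semialg gX x -> `|y - x| <= e -> semialg gU u ->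
    (1 - beta * tau) * V (y + tau *: clipped_field f r0 y u) <= V y) ->
  (forall a b x y, `|x| <= r0 + M -> `|y| <= r0 + M -> exists2 th : 'rV[R]_n, `|th| <= e &
      `|a * peval P x + b * peval P y - (a * V (x + th) + b * V (y + th))|
        <= (`|a| + `|b|) * e ^+ 4) ->
  (forall i x y, `|x| <= r0 + M -> `|y| <= r0 + M ->
      e * `|peval (mderiv i P) x - peval (mderiv i P) y| <= 2 * L * `|x - y| + 4 * e ^+ 4) ->
  semialg gX x -> semialg gU u ->
  - (((2 + beta) + L * Lf + n%:R * (M * (2 * L * M + 4))) * e) <=
     peval (Lop (ContinuousTime beta) f P) (row_mx x u).
Proof.
move=> b0 e0 e1 tauE L0 M0 Lf0 bt hM hLf VL V0 super hP hdP Xx Uu.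
have t0 : 0 < tau by rewrite tauE exprn_gt0.
have te : tau <= e by rewrite tauE expr2 ler_piMr// ltW.
have t1 : tau <= 1 by exact: le_trans te e1.
have bt0 : 0 < beta * tau by exact: mulr_gt0.
set xi := vfield f x u.
have fE := clipped_fieldE f gXr0 u Xx; rewrite -/xi in fE.
have xiM : `|xi| <= M by rewrite -fE hM.
have xr := gXr0 Xx.
have box (s : R) : 0 <= s <= 1 -> `|x + s *: (tau *: xi)| <= r0 + M.
  move=> /andP[s0 s1]; rewrite (le_trans (ler_normD _ _))// lerD// !normrZ !ger0_norm ?(ltW t0)//.
  rewrite -[leRHS]mul1r ler_pM ?mulr_ge0 ?(ltW t0)//.
  by rewrite -[leRHS]mul1r ler_pM ?(ltW t0).
have xb : `|x| <= r0 + M by have := box 0; rewrite scale0r addr0 lexx ler01 => /(_ isT).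
have xtb : `|x + tau *: xi| <= r0 + M by have := box 1; rewrite scale1r lexx ler01 => /(_ isT).
(* tau LP equals (1 + beta tau) P(x) - P(x + tau xi) plus a first-order Taylor remainder; the common
   shift th compares the combination with V at the shifted points. *)
have [th the] := hP (1 + beta * tau) (- 1) _ _ xb xtb.
rewrite normrN1 (gtr0_norm (_ : 0 < 1 + beta * tau)) ?addr_gt0// => hth.
have sup : V (x + tau *: xi + th) <= (1 + beta * tau) * V (x + th) + L * Lf * tau * e.
  (* The factor 1 / (1 - beta tau) is replaced by 1 + beta tau; the second-order discrepancy has the
     right sign because V <= 0. *)
  have h1 : V (x + th + tau *: clipped_field f r0 (x + th) u) <= (1 + beta * tau) * V (x + th).
    have h := super x (x + th) u Xx; rewrite addrAC subrr add0r in h.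
    have {}h := h the Uu.
    have g0 : 0 < 1 - beta * tau by rewrite subr_gt0.
    rewrite -(ler_pM2l g0); apply: le_trans h _; rewrite mulrA.
    have : 0 <= (beta * tau) ^+ 2 * - V (x + th) by rewrite mulr_ge0 ?sqr_ge0// oppr_ge0.
    lra.
  have h2 := VL (x + tau *: xi + th) (x + th + tau *: clipped_field f r0 (x + th) u).
  have h3 : `|x + tau *: xi + th - (x + th + tau *: clipped_field f r0 (x + th) u)| <= tau * (Lf * e).
    have -> : x + tau *: xi + th - (x + th + tau *: clipped_field f r0 (x + th) u) =
        tau *: (clipped_field f r0 x u - clipped_field f r0 (x + th) u).
      by rewrite fE; apply/rowP => i; rewrite !mxE; ring.
    rewrite normrZ gtr0_norm// ler_pM2l//.
    apply: (le_trans (hLf _ _ _ Uu)); rewrite ler_wpM2l// opprD addrA subrr add0r normrN//.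
  have h4 : L * `|x + tau *: xi + th - (x + th + tau *: clipped_field f r0 (x + th) u)| <=
      L * (tau * (Lf * e)) by rewrite ler_wpM2l.
  move: h2; rewrite ler_norml => /andP[_].
  have -> : L * Lf * tau * e = L * (tau * (Lf * e)) by ring.
  move: h1 h4; lra.
have [s s01 mv] := peval_mean_value P x (tau *: xi).
have dP i : `|peval (mderiv i P) (x + s *: (tau *: xi)) - peval (mderiv i P) x| <= (2 * L * M + 4) * e.
  rewrite -(ler_pM2l e0); apply: (le_trans (hdP i _ _ (box s s01) xb)).
  rewrite addrAC subrr add0r.
  have : 2 * L * `|s *: (tau *: xi)| <= 2 * L * (tau * M).
    rewrite ler_wpM2l ?mulr_ge0// !normrZ (gtr0_norm t0).
    have /andP[s0 s1] := s01; rewrite ger0_norm// -[leRHS]mul1r ler_pM ?mulr_ge0// ?(ltW t0)//.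
    by rewrite ler_pM2l.
  have : e ^+ 4 <= e ^+ 2.
    have e20 : 0 < e ^+ 2 by exact: exprn_gt0.
    by rewrite (exprM e 2 2) -[leRHS]expr1 -tauE ler_wiXn2l// ltW.
  rewrite tauE; have -> : e * ((2 * L * M + 4) * e) = 2 * L * (e ^+ 2 * M) + 4 * e ^+ 2 by ring.
  by lra.
have sumB : - (n%:R * (M * (2 * L * M + 4)) * e * tau) <=
    peval P (x + tau *: xi) - peval P x - tau * \sum_i peval (mderiv i P) x * xi ord0 i.
  rewrite mv mulr_sumr -sumrB.
  have -> : - (n%:R * (M * (2 * L * M + 4)) * e * tau) =
      \sum_(i < n) - ((M * (2 * L * M + 4)) * e * tau).
    by rewrite sumr_const card_ord -mulr_natl; ring.
  apply: ler_sum => i _; rewrite mxE.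
  have -> : peval (mderiv i P) (x + s *: (tau *: xi)) * (tau * xi ord0 i) -
      tau * (peval (mderiv i P) x * xi ord0 i) =
      (peval (mderiv i P) (x + s *: (tau *: xi)) - peval (mderiv i P) x) * xi ord0 i * tau by ring.
  rewrite -mulNr ler_pM2r// lerNl.
  apply: le_trans (ler_norm _) _; rewrite normrN normrM.
  rewrite -mulrA [leRHS]mulrC; apply: ler_pM => //.
  exact: le_trans (le_coord_norm _ _) xiM.
rewrite peval_Lop_continuous -/xi -(ler_pM2r t0).
have -> : (beta * peval P x - \sum_i peval (mderiv i P) x * xi ord0 i) * tau =
   ((1 + beta * tau) * peval P x + - 1 * peval P (x + tau *: xi)) +
   (peval P (x + tau *: xi) - peval P x - tau * \sum_i peval (mderiv i P) x * xi ord0 i) by ring.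
have e4 : (1 + beta * tau + 1) * e ^+ 4 <= (2 + beta) * e * tau.
  have -> : e ^+ 4 = e * (e * tau) by rewrite tauE; ring.
  rewrite -[leRHS]mulrA; apply: ler_pM; rewrite ?mulr_ge0 ?addr_ge0 ?(ltW t0) ?(ltW e0) ?(ltW bt0)//.
    have : beta * tau <= beta by rewrite ler_piMr// ltW.
    lra.
  by rewrite -[leRHS]mul1r ler_wpM2r// mulr_ge0// ltW.
move: hth; rewrite ler_norml => /andP[hth _].
move: hth sup sumB e4.
set S := \sum_i _ => hth sup sumB e4.
have -> : - ((2 + beta + L * Lf + n%:R * (M * (2 * L * M + 4))) * e) * tau =
  - ((2 + beta) * e * tau) - L * Lf * tau * e - n%:R * (M * (2 * L * M + 4)) * e * tau by ring.
lra.
Qed.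

(** The same scheme for the Euler map with discount 1 - beta tau: raising by d contributes beta d to
    LP, which exceeds the gap C e. *)
Lemma continuous_subsolution beta (l : nat) : 0 < beta -> exists (P : {mpoly R[n]}) (tau : R),
  [/\ 0 < tau <= l.+1%:R^-1,
      forall x u, semialg gX x -> semialg gU u ->
        0 < peval (Lop (ContinuousTime beta) f P) (row_mx x u),
      forall x, semialg gX x -> peval P x <= l.+1%:R^-1 &
      forall x, semialg gX x -> - 1 < peval P x -> exists xs us,
        [/\ xs 0%N = x,
            forall i, i%:R * tau <= l%:R -> semialg gU (us i) /\
              xs i.+1 = xs i + tau *: clipped_field f r0 (xs i) (us i) &
            forall i, i%:R * tau <= l%:R ->
              violation gX r0 (xs i) < (1 + 2 * expR (2 * beta * (i%:R * tau))) / l.+1%:R]].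
Proof.
move=> b0.
have [Lf [M [Lf0 M0 hM hLf']]] := clipped_field_lipschitz f r00 gUrU.
have hLf x y u : semialg gU u ->
    `|clipped_field f r0 x u - clipped_field f r0 y u| <= Lf * `|x - y|.
  by move=> Uu; have := hLf' x y u u Uu Uu; rewrite subrr normr0 addr0.
have [Lv [K [Lv0 K0 vL cK cL]]] := cost_lipschitz gX r00.
have cK' := cK l.+1; have cL' := cL l.+1.
have N1 : 0 < l.+1%:R :> R by rewrite ltr0n.
have iN0 : 0 < l.+1%:R^-1 :> R by rewrite invr_gt0.
have iN1 : l.+1%:R^-1 <= 1 :> R by rewrite invf_le1// ler1n.
(* A Lipschitz constant for V valid for all small steps: (1 + tau Lf)^J <= exp(tau Lf J) and tau J
   <= l + 1. It must precede e, which is chosen in terms of it. *)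
pose L := l.+1%:R * Lv * expR (Lf * l.+1%:R).
have L0 : 0 <= L by rewrite !mulr_ge0// expR_ge0.
pose d : R := l.+1%:R^-1 / 2; have d0 : 0 < d by rewrite divr_gt0.
pose C := (2 + beta) + L * Lf + n%:R * (M * (2 * L * M + 4)).
have C0 : 0 <= C.
  rewrite /C addr_ge0// ?mulr_ge0// ?addr_ge0// ?mulr_ge0//; exact: ltW.
(* In order: the mollification needs e <= 1; the step stays below 1 / (l + 1); the discount factor
   exceeds 1/2; the cost vanishes within e of the state set; P is d-close to V; the gap is below
   beta d. *)
have [|e e0 he] := @exists_small R [:: (1, 1); (1, l.+1%:R^-1); (beta, 1 / 2);
    (Lv, l.+1%:R^-1); (1 + L, d); (C, beta * d)].
  move=> z; rewrite !inE.
  by move=> /orP[/eqP->|/orP[/eqP->|/orP[/eqP->|/orP[/eqP->|/orP[/eqP->|/eqP->]]]]];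
    split=> //=; rewrite ?addr_ge0 ?mulr_gt0 ?divr_gt0 ?(ltW b0).
have e1 : e <= 1 by apply: ltW; have := he (1, 1); rewrite !inE eqxx /= mul1r; exact.
have eN : e <= l.+1%:R^-1.
  by apply: ltW; have := he (1, l.+1%:R^-1); rewrite !inE eqxx ?orbT /= mul1r; exact.
have eb : beta * e < 1 / 2 by have := he (beta, 1 / 2); rewrite !inE eqxx ?orbT /=; exact.
have eLv : Lv * e < l.+1%:R^-1 by have := he (Lv, l.+1%:R^-1); rewrite !inE eqxx ?orbT /=; exact.
have eL : (1 + L) * e < d by have := he (1 + L, d); rewrite !inE eqxx ?orbT /=; exact.
have eC : C * e < beta * d by have := he (C, beta * d); rewrite !inE eqxx ?orbT /=; exact.
clear he.
pose tau := e ^+ 2.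
have t0 : 0 < tau by rewrite exprn_gt0.
have te : tau <= e by rewrite /tau expr2 ler_piMr// ltW.
have bt0 : 0 < beta * tau by exact: mulr_gt0.
have bt : beta * tau < 1 / 2 by apply: le_lt_trans eb; rewrite ler_pM2l.
have bt1 : beta * tau < 1 by lra.
pose g := 1 - beta * tau.
have g0 : 0 < g by rewrite subr_gt0.
have g1 : g <= 1 by rewrite /g; lra.
(* Enough Euler steps for the chain to cover the time interval [0, l], which grows with l. *)
pose J := (Num.truncn (l%:R / tau)).+1.
have lt0 : 0 <= l%:R / tau by rewrite divr_ge0// ltW.
have /andP[J1 J2] := truncn_itv lt0.
pose F (x : 'rV[R]_n) u := x + tau *: clipped_field f r0 x u.
have FL x y u : semialg gU u -> `|F x u - F y u| <= (1 + tau * Lf) * `|x - y|.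
  move=> Uu; rewrite /F opprD addrACA -scalerBr (le_trans (ler_normD _ _))//.
  by rewrite mulrDl mul1r lerD2l normrZ gtr0_norm// -mulrA ler_pM2l// hLf.
have La1 : 1 <= 1 + tau * Lf by rewrite lerDl mulr_ge0// ltW.
pose V := value F (semialg gU) g (cost gX r0 l.+1) J.
have VL x y : `|V x - V y| <= L * `|x - y|.
  have := value_lipschitz U0 g0 g1 cK' (mulr_ge0 (ler0n _ l.+1) Lv0) La1 cL' FL J x y.
  move=> h; apply: (le_trans h); rewrite ler_wpM2r// /L ler_wpM2l ?mulr_ge0//.
  apply: (@le_trans _ _ (expR (tau * Lf) ^+ J)).
    rewrite lerXn2r ?nnegrE ?expR_ge0 ?expR_ge1Dx//.
    by rewrite (le_trans ler01).
  rewrite -expRM_natl ler_expR mulrCA mulrA mulrC ler_wpM2l//.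
  rewrite /J mulrC -natr1 mulrDl mul1r -natr1 lerD//; last exact: le_trans te e1.
  by rewrite -ler_pdivlMr.
have Vb := value_bounds F U0 g0 g1 cK' J.
have V0 x : V x <= 0 by have /andP[] := Vb x.
have super x y u : semialg gX x -> `|y - x| <= e -> semialg gU u -> g * V (F y u) <= V y.
  move=> Xx yx Uu; apply: (value_supersolution F U0 g0 g1 cK' J) => //.
  apply: cost_eq0; have := vL y x; rewrite (violation_eq0 gXr0 Xx) subr0 => h.
  apply: le_trans (ler_norm _) _; apply: (le_trans h); apply: ltW.
  by apply: le_lt_trans eLv; rewrite ler_wpM2l.
have r0M : 0 <= r0 + M by exact: addr_ge0.
have [P [hP hdP]] := smooth_lipschitz_approx r0M L0 e0 e1 VL.
have gap x u := @continuous_subsolution_gap beta tau L M Lf e P V x u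
  b0 e0 e1 erefl L0 M0 Lf0 bt1 hM hLf VL V0 super hP hdP.
have PV x : semialg gX x -> `|peval P x - V x| <= d.
  move=> /gXr0 xr; have xb : `|x| <= r0 + M by apply: (le_trans xr); rewrite lerDl.
  have [th the] := hP 1 0 x x xb xb.
  rewrite !mul0r !addr0 !mul1r normr1 normr0 addr0 mul1r => h.
  have h2 := VL (x + th) x; rewrite addrAC subrr add0r in h2.
  have h3 : L * `|th| <= L * e by rewrite ler_wpM2l.
  have h4 : e ^+ 4 <= e by rewrite -[leRHS]expr1 ler_wiXn2l// ltW.
  rewrite -(subrK (V (x + th)) (peval P x)) -addrA (le_trans (ler_normD _ _))//.
  apply: le_trans (ltW eL); rewrite mulrDl mul1r lerD//; first exact: le_trans h h4.
  exact: le_trans h2 h3.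
have d12 : d <= 1 / 2 by rewrite /d ler_pM2r ?invr_gt0.
have dd : d + d = l.+1%:R^-1 by rewrite /d -splitr.
exists (P + mpolyC n d), tau; split=> [|x u Xx Uu|x Xx|x Xx].
- by rewrite t0/= (le_trans te).
- have -> : peval (Lop (ContinuousTime beta) f (P + mpolyC n d)) (row_mx x u) =
     peval (Lop (ContinuousTime beta) f P) (row_mx x u) + beta * d.
    rewrite !peval_Lop_continuous pevalD pevalC.
    under [X in _ - X = _]eq_bigr do rewrite mderivD mderivC addr0.
    by ring.
  by have := gap x u Xx Uu; rewrite -/C; move: eC; lra.
- rewrite pevalD pevalC -dd; have := PV x Xx; have := V0 x.
  by rewrite ler_norml => h1 /andP[_ h2]; move: h1 h2; lra.
- rewrite pevalD pevalC => h.
  have hV : - 2 < V x.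
    have := PV x Xx; rewrite ler_norml => /andP[_]; move: h d12; lra.
  have [xs [us [h1 h2 h3]]] := value_chain U0 g0 (ltr0n _ 2) hV.
  have iJ i : i%:R * tau <= l%:R -> (i < J)%N.
    by rewrite -ler_pdivlMr// => hi; rewrite -(ltr_nat R) (le_lt_trans hi).
  exists xs, us; split=> // i il; first by exact/h2/iJ.
  apply: lt_le_trans (cost_violation_lt (ltn0Sn l) (exprn_gt0 i g0) (h3 i (ltnW (iJ i il)))) _.
  rewrite ler_pM2r// lerD2l ler_pM2l// -exprVn.
  have -> : 2 * beta * (i%:R * tau) = i%:R * (2 * (beta * tau)) by ring.
  rewrite expRM_natl lerXn2r ?nnegrE ?invr_ge0 ?expR_ge0 ?(ltW g0)//.
  (* 1 / (1 - s) <= 1 + 2 s <= exp(2 s) for s = beta tau <= 1/2, whence the rate 2 beta, which does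
     not depend on the step. *)
  apply: le_trans (expR_ge1Dx _).
  rewrite -[leLHS]mul1r ler_pdivrMr// /g.
  have : 0 <= (beta * tau) * (1 - 2 * (beta * tau)).
    by rewrite mulr_ge0 ?(ltW bt0)// subr_ge0; lra.
  lra.
Qed.

End continuous_subsolutions.

(** * Subsolutions that detect the invariant set *)

Section subsolution_sequence.
Context {R : realType} {n m nX nU : nat}.
Variables (f : 'I_n -> {mpoly R[n + m]}).
Variables (gX : 'I_nX -> {mpoly R[n]}) (gU : 'I_nU -> {mpoly R[m]}) (r0 rU : R).
Hypotheses (r00 : 0 <= r0) (gXr0 : forall x, semialg gX x -> `|x| <= r0).
Hypotheses (gUrU : forall u, semialg gU u -> `|u| <= rU) (cU : compact (semialg gU)).

Lemma divn_small (c e : R) : 0 < e -> exists N, forall l, (N <= l)%N -> c / l.+1%:R < e.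
Proof.
move=> e0; exists (Num.truncn (`|c| / e)) => l Nl.
have c0 : 0 <= `|c| / e by rewrite divr_ge0// ltW.
have /andP[_ h] := truncn_itv c0.
rewrite ltr_pdivrMr ?ltr0n// mulrC -ltr_pdivrMr//.
apply: le_lt_trans (_ : `|c| / e < _); first by rewrite ler_pM2r ?invr_gt0// ler_norm.
by apply: (lt_le_trans h); rewrite ler_nat.
Qed.

Let eventually_ge (G : set_system nat) N : \oo `<=` G -> G [set l | (N <= l)%N].
Proof. by apply; exact: nbhs_infty_ge. Qed.

Lemma subsolution_sequence T : valid_discount T -> exists P : nat -> {mpoly R[n]},
  [/\ forall l x u, semialg gX x -> semialg gU u -> 0 < peval (Lop T f (P l)) (row_mx x u),
      forall l x, semialg gX x -> peval (P l) x <= l.+1%:R^-1 &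
      forall x, semialg gX x -> (forall N, exists2 l, (N <= l)%N & - 1 < peval (P l) x) ->
        max_controlled_invariant T f (semialg gX) (semialg gU) x].
Proof.
move=> hT; have [U0|] := pselect (semialg gU !=set0); last first.
  (* Without controls the first requirement is vacuous, and the constant -2 never exceeds -1. *)
  move=> U0; exists (fun=> mpolyC n (- 2)); split=> [l x u Xx Uu|l x Xx|x Xx /(_ 0%N)[l _]].
  - by exfalso; apply: U0; exists u.
  - by rewrite pevalC (le_trans (_ : _ <= 0)) ?oppr_le0 ?invr_ge0.
  - by rewrite pevalC ltrN2 ltNge ler1n.
case: T hT => [alpha|beta] hT.
  have [P hP] := choice (fun l => discrete_subsolution f r00 gXr0 gUrU U0 l hT).
  exists P; split=> [l|l|x Xx often]; [by case: (hP l)|by case: (hP l)|].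
  have [G [UG ooG GB]] := ultra_natP often.
  have PG : ProperFilter G by exact: ultra_proper.
  (* Where P_l(x) <= -1 a constant chain is a mere default: the ultrafilter contains the set of the
     other indices. *)
  have chains l : exists z : (nat -> 'rV[R]_n) * (nat -> 'rV[R]_m), z.1 0%N = x /\
     (- 1 < peval (P l) x -> (forall i, (i < l)%N -> semialg gU (z.2 i) /\
        z.1 i.+1 = clipped_field f r0 (z.1 i) (z.2 i)) /\
      forall i, (i <= l)%N -> violation gX r0 (z.1 i) < (1 + 2 / alpha ^+ i) / l.+1%:R).
    have [h|h] := pselect (- 1 < peval (P l) x); last by exists (fun=> x, fun=> 0).
    by have [_ _ /(_ x Xx h)[xs [us [? ? ?]]]] := hP l; exists (xs, us).
  have [z hz] := choice chains.
  apply: (@discrete_limit _ _ _ _ _ f gX gU r0 rU r00 gXr0 gUrU cU G x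
    (fun l => (z l).1) (fun l => (z l).2) UG) => [l|i|i e e0]; first by case: (hz l).
    apply: filterS (filterI GB (eventually_ge i.+1 ooG)) => l [Bl il].
    by have [_ /(_ Bl)[h _]] := hz l; exact: h.
  have [N hN] := divn_small (1 + 2 / alpha ^+ i) e0.
  apply: filterS (filterI GB (filterI (eventually_ge i ooG) (eventually_ge N ooG))) => l [Bl [il Nl]].
  by have [_ /(_ Bl)[_ h]] := hz l; apply: lt_trans (h i il) (hN l Nl).
have [z1 hz1] := choice (fun l => continuous_subsolution f r00 gXr0 gUrU U0 l hT).
have [tau hP] := choice hz1.
exists z1; split=> [l|l|x Xx often]; [by case: (hP l)|by case: (hP l)|].
have [G [UG ooG GB]] := ultra_natP often.
have PG : ProperFilter G by exact: ultra_proper.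
have chains l : exists z : (nat -> 'rV[R]_n) * (nat -> 'rV[R]_m), z.1 0%N = x /\
   (- 1 < peval (z1 l) x -> (forall i, i%:R * tau l <= l%:R -> semialg gU (z.2 i) /\
      z.1 i.+1 = z.1 i + tau l *: clipped_field f r0 (z.1 i) (z.2 i)) /\
    forall i, i%:R * tau l <= l%:R ->
      violation gX r0 (z.1 i) < (1 + 2 * expR (2 * beta * (i%:R * tau l))) / l.+1%:R).
  have [h|h] := pselect (- 1 < peval (z1 l) x); last by exists (fun=> x, fun=> 0).
  by have [_ _ _ /(_ x Xx h)[xs [us [? ? ?]]]] := hP l; exists (xs, us).
have [z hz] := choice chains.
have big (t : R) : G [set l | t <= l%:R].
  apply: filterS (eventually_ge (Num.truncn `|t|).+1 ooG) => l /= tl.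
  have /andP[_ h] := truncn_itv (normr_ge0 t).
  by rewrite (le_trans (ler_norm t))// (le_trans (ltW h))// ler_nat.
apply: (@continuous_limit _ _ _ _ _ f gX gU r0 rU r00 gXr0 gUrU cU G x tau
  (fun l => (z l).1) (fun l => (z l).2) UG) => [l|e e0|l|t|t e e0].
- by have [/andP[]] := hP l.
- have [N hN] := divn_small 1 e0.
  apply: filterS (eventually_ge N ooG) => l Nl; have [/andP[_ h] _ _ _] := hP l.
  by apply: (le_lt_trans h); rewrite -[X in X < _]mul1r; exact: hN.
- by case: (hz l).
- apply: filterS (filterI GB (big t)) => l [Bl tl] i it.
  by have [_ /(_ Bl)[h _]] := hz l; apply: h; exact: le_trans tl.
- have [N hN] := divn_small (1 + 2 * expR (2 * beta * t)) e0.
  apply: filterS (filterI GB (filterI (big t) (eventually_ge N ooG))) => l [Bl [tl Nl]] i it.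
  have [_ /(_ Bl)[_ h]] := hz l; apply: lt_trans (h i (le_trans it tl)) _.
  apply: le_lt_trans (hN l Nl); rewrite ler_pM2r ?invr_gt0 ?ltr0n// lerD2l ler_pM2l//.
  by rewrite ler_expR ler_pM2l// mulr_gt0.
Qed.

End subsolution_sequence.

(** * Certificates and the measure of the outer sets *)

Section certificate_modules.
Context {R : realType}.

Lemma mpdegM n (p q : {mpoly R[n]}) : (mpdeg (p * q)%R <= mpdeg p + mpdeg q)%N.
Proof.
rewrite /mpdeg; have [->|p0] := eqVneq p 0; first by rewrite mul0r mmeasure0.
have [->|q0] := eqVneq q 0; first by rewrite mulr0 mmeasure0.
by rewrite msizeM//; move: (mmeasure _ p) (mmeasure _ q) => [|a] [|b] //=; lia.
Qed.

Lemma is_sos_leq n k l (p : {mpoly R[n]}) : (k <= l)%N -> is_sos k p -> is_sos l p.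
Proof. by move=> kl [s hs ->]; exists s => //; apply: sub_all hs => h /leq_trans; exact. Qed.

Lemma is_sosD n k (p q : {mpoly R[n]}) : is_sos k p -> is_sos k q -> is_sos k (p + q).
Proof.
by move=> [s hs ->] [t ht ->]; exists (s ++ t); rewrite ?all_cat ?hs// big_cat.
Qed.

Lemma is_sos0 n k : is_sos k (0 : {mpoly R[n]}).
Proof. by exists [::]; rewrite ?big_nil. Qed.

Lemma is_sos1 n k : is_sos k (1 : {mpoly R[n]}).
Proof. by exists [:: 1]; rewrite ?big_seq1 ?expr1n//= /mpdeg mmeasure1. Qed.

Lemma is_sosM_sqr n k (h p : {mpoly R[n]}) : is_sos k p -> is_sos (k + mpdeg h) (h ^+ 2 * p).
Proof.
move=> [s hs ->]; exists [seq h * q | q <- s].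
  rewrite all_map; apply: sub_all hs => q qk /=.
  by rewrite (leq_trans (mpdegM _ _))// addnC leq_add2r.
by rewrite mulr_sumr big_map; apply: eq_bigr => q _; rewrite exprMn.
Qed.

(** The common form of [cert_x] and [cert_xu]: for the latter, the constraints on x and on u form
    one family. *)
Definition certificate n (I : finType) (g : I -> {mpoly R[n]}) (d : I -> nat) (k : nat) p :=
  exists (s0 : {mpoly R[n]}) (s : I -> {mpoly R[n]}),
    [/\ is_sos k s0, forall i, is_sos (k - d i) (s i) & p = s0 + \sum_i s i * g i].

Lemma certificate_quadratic_module n (I : finType) (g : I -> {mpoly R[n]}) (d : I -> nat) :
  quadratic_module (fun p => exists k0, forall k, (k0 <= k)%N -> certificate g d k p).
Proof.
split=> [|p q [k1 h1] [k2 h2]|h p [k0 hp]].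
- exists 0%N => k _; exists 1, (fun=> 0); split; [exact: is_sos1|by move=> i; exact: is_sos0|].
  by rewrite big1 ?addr0// => i _; rewrite mul0r.
- exists (maxn k1 k2) => k; rewrite geq_max => /andP[/h1 + /h2].
  move=> [s0 [s [s0k sk ->]]] [t0 [t [t0k tk ->]]].
  exists (s0 + t0), (fun i => s i + t i); split=> [|i|]; [exact: is_sosD|exact: is_sosD|].
  by under [X in _ = _ + X]eq_bigr do rewrite mulrDl; rewrite big_split addrACA.
(* The maximum of the d i keeps the truncated subtraction k - mpdeg h - d i exact, so multiplying by
   h restores the bound k - d i. *)
- exists (k0 + \max_i d i + mpdeg h)%N => k kk.
  have [|s0 [s [s0k sk ->]]] := hp (k - mpdeg h)%N; first by lia.
  exists (h ^+ 2 * s0), (fun i => h ^+ 2 * s i); split=> [|i|].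
  + by apply: is_sos_leq (is_sosM_sqr _ s0k); lia.
  + apply: is_sos_leq (is_sosM_sqr _ (sk i)).
    by have : (d i <= \max_j d j)%N; [exact: leq_bigmax|lia].
  + by rewrite mulrDr mulr_sumr; congr (_ + _); apply: eq_bigr => i _; rewrite mulrA.
Qed.

Lemma certificate_generator n (I : finType) (g : I -> {mpoly R[n]}) (d : I -> nat) i :
  exists k0, forall k, (k0 <= k)%N -> certificate g d k (g i).
Proof.
exists 0%N => k _; exists 0, (fun j => if j == i then 1 else 0); split; first exact: is_sos0.
  by move=> j; case: eqP => _; [exact: is_sos1|exact: is_sos0].
rewrite add0r (bigD1 i)//= eqxx mul1r big1 ?addr0// => j /negbTE ->; exact: mul0r.
Qed.

Lemma cert_x_eventually n N (g : 'I_N -> {mpoly R[n]}) i r p : g i = ball_poly n r ->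
  (forall x, semialg g x -> 0 < peval p x) -> exists k0, forall k, (k0 <= k)%N -> cert_x g k p.
Proof.
move=> gi hp; have QM := certificate_quadratic_module g (fun i => half_deg (g i)).
apply: (putinar (r := r) QM _ _ hp); first exact: certificate_generator.
by rewrite -gi; exact: certificate_generator.
Qed.

Lemma lift_x_ball_poly n m r :
  lift_x m (ball_poly n r) = mpolyC (n + m) (r ^+ 2) - \sum_j mpolyX R (mnm1 (lshift m j)) ^+ 2.
Proof.
rewrite /lift_x /ball_poly comp_mpolyB comp_mpolyC; congr (_ - _).
rewrite raddf_sum/=.
apply: eq_bigr => j _; rewrite !expr2 (comp_mpoly_is_multiplicative _).1 comp_mpolyXU.
by rewrite (nth_map j) ?size_enum_ord// nth_ord_enum.
Qed.

Lemma lift_u_ball_poly n m r :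
  lift_u n (ball_poly m r) = mpolyC (n + m) (r ^+ 2) - \sum_j mpolyX R (mnm1 (rshift n j)) ^+ 2.
Proof.
rewrite /lift_u /ball_poly comp_mpolyB comp_mpolyC; congr (_ - _).
rewrite raddf_sum/=.
apply: eq_bigr => j _; rewrite !expr2 (comp_mpoly_is_multiplicative _).1 comp_mpolyXU.
by rewrite (nth_map j) ?size_enum_ord// nth_ord_enum.
Qed.

(** The sum of the two lifted ball constraints is the ball constraint in (x, u) of radius sqrt(r^2 +
    s^2), as the Positivstellensatz requires. *)
Lemma cert_xu_eventually n m nX nU (gX : 'I_nX -> {mpoly R[n]}) (gU : 'I_nU -> {mpoly R[m]})
    i j r s p : gX i = ball_poly n r -> gU j = ball_poly m s ->
  (forall x u, semialg gX x -> semialg gU u -> 0 < peval p (row_mx x u)) ->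
  exists k0, forall k, (k0 <= k)%N -> cert_xu gX gU k p.
Proof.
move=> gXi gUj hp.
pose g (k : 'I_(nX + nU)) := match fintype.split k with
  inl a => lift_x m (gX a) | inr b => lift_u n (gU b) end.
pose d (k : 'I_(nX + nU)) := match fintype.split k with
  inl a => half_deg (gX a) | inr b => half_deg (gU b) end.
have gl a : g (lshift nU a) = lift_x m (gX a) by rewrite /g (unsplitK (inl a)).
have gr a : g (rshift nX a) = lift_u n (gU a) by rewrite /g (unsplitK (inr a)).
have QM := certificate_quadratic_module g d; set M := (X in quadratic_module X) in QM.
suff [k0 h] : M p.
  exists k0 => k /h[s0 [q [h0 hq ->]]].
  exists s0, (fun a => q (lshift nU a)), (fun b => q (rshift nX b)); split=> // [a|b|].
  - by have := hq (lshift nU a); rewrite /d (unsplitK (inl a)).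
  - by have := hq (rshift nX b); rewrite /d (unsplitK (inr b)).
  - rewrite big_split_ord/= addrA; congr (_ + _ + _).
      by apply: eq_bigr => a _; rewrite gl.
    by apply: eq_bigr => b _; rewrite gr.
apply: (putinar (g := g) (r := Num.sqrt (r ^+ 2 + s ^+ 2)) QM) => [k||z hz].
- exact: certificate_generator.
- have -> : ball_poly (n + m) (Num.sqrt (r ^+ 2 + s ^+ 2)) = g (lshift nU i) + g (rshift nX j).
    rewrite gl gr gXi gUj lift_x_ball_poly lift_u_ball_poly /ball_poly.
    rewrite sqr_sqrtr ?addr_ge0 ?sqr_ge0// big_split_ord/= mpolyCD.
    by rewrite opprD addrACA.
  by case: QM => _ MD _; apply: MD; exact: certificate_generator.
- rewrite -(hsubmxK z); apply: hp => a.
    by have := hz (lshift nU a); rewrite gl -{1}(hsubmxK z) peval_lift_x.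
  by have := hz (rshift nX a); rewrite gr -{1}(hsubmxK z) peval_lift_u.
Qed.

End certificate_modules.

Section semialgebraic_measure.
Context {R : realType} {n : nat}.

Lemma measurable_peval_ge0 (p : {mpoly R[n]}) : measurable [set x | 0 <= peval p x].
Proof.
rewrite (_ : mkset _ = [set: 'rV[R]_n] `&` (peval p : _ -> measurableTypeR R) @^-1` `[0, +oo[%classic).
  by apply: measurable_peval => //; exact: measurable_itv.
by rewrite setTI; apply/seteqP; split=> x /=; rewrite in_itv/= andbT.
Qed.

Lemma measurable_semialg N (g : 'I_N -> {mpoly R[n]}) : measurable (semialg g).
Proof.
rewrite (_ : semialg g = \bigcap_(i in [set: 'I_N]) [set x | 0 <= peval (g i) x]).
  by apply: fin_bigcap_measurable => // i _; exact: measurable_peval_ge0.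
by apply/seteqP; split=> x /= h i; [move=> _; exact: h|exact: h i I].
Qed.

Lemma lebesgue_rV_bounded_lty (A : set 'rV[R]_n) (r : R) : 0 <= r -> measurable A ->
  (forall x, A x -> `|x| <= r) -> (lebesgue_rV A < +oo)%E.
Proof.
move=> r0 mA Ar; pose B := [set x : 'rV[R]_n |
  forall i, (const_mx (- r) : 'rV[R]_n) ord0 i <= x ord0 i <= (const_mx r : 'rV[R]_n) ord0 i].
have mB : measurable B.
  rewrite (_ : B = \bigcap_(i in [set: 'I_n]) (rV_coord i @^-1` `[- r, r]%classic)).
    apply: fin_bigcap_measurable => // i _.
    by rewrite -[X in measurable X]setTI; apply: measurable_rV_coord.
  by apply/seteqP; split=> x /= h i; have := h i; rewrite /= ?in_itv !mxE /=; auto.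
apply: (@le_lt_trans _ _ (lebesgue_rV B)).
  apply: le_measure; rewrite ?inE// => x /Ar xr i; rewrite !mxE -ler_norml.
  exact: le_trans (le_coord_norm _ _) xr.
rewrite lebesgue_rV_box ?ltry// => i; rewrite !mxE.
by rewrite (le_trans _ r0)// oppr_le0.
Qed.

End semialgebraic_measure.

Section objective.
Context {R : realType} {n nX : nat}.
Variables (gX : 'I_nX -> {mpoly R[n]}).
Let mX := measurable_semialg gX.

Lemma measurable_outer_set v : measurable (outer_set gX v).
Proof. exact: measurableI mX (measurable_peval_ge0 v). Qed.

Let measurable_pevalE (p : {mpoly R[n]}) (D : set 'rV[R]_n) : measurable D ->
  measurable_fun D (fun x => (peval p x)%:E).
Proof.
move=> mD; apply/measurable_EFinP; apply: (measurable_funS measurableT) => //.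
exact: measurable_peval.
Qed.

Lemma outer_set_le_objective (v w : {mpoly R[n]}) :
  (forall x, semialg gX x -> 0 <= peval w x) ->
  (forall x, outer_set gX v x -> 1 <= peval w x) ->
  (lebesgue_rV (outer_set gX v) <= dual_objective gX w)%E.
Proof.
move=> w0 w1; have mO := measurable_outer_set v.
have <- : (\int[@lebesgue_rV R n]_(x in semialg gX) (\1_(outer_set gX v) x)%:E)%E =
    lebesgue_rV (outer_set gX v).
  by rewrite integral_indic//; congr (lebesgue_rV _); apply/setIidl => x [].
apply: ge0_le_integral => //.
- by apply/measurable_EFinP; exact: measurable_indic.
- exact: measurable_pevalE.
- move=> x Xx; rewrite lee_fin indicE; have [/set_mem /w1//|_] := boolP (x \in _).
  exact: w0.
Qed.

Lemma objective_le (w : {mpoly R[n]}) (B : set 'rV[R]_n) (a c : R) :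
  measurable B -> B `<=` semialg gX -> 0 <= a -> 0 <= c ->
  (forall x, semialg gX x -> 0 <= peval w x) ->
  (forall x, B x -> peval w x <= a + c) ->
  (forall x, semialg gX x -> ~ B x -> peval w x <= c) ->
  (dual_objective gX w <= a%:E * lebesgue_rV B + c%:E * lebesgue_rV (semialg gX))%E.
Proof.
move=> mB BX a0 c0 w0 wB wX.
have mi : measurable_fun (semialg gX) (fun x => (\1_B x : R)%:E).
  by apply/measurable_EFinP; exact: measurable_indic.
have i0 x : (0 <= (\1_B x : R)%:E)%E by rewrite lee_fin indicE ler0n.
have <- : (\int[@lebesgue_rV R n]_(x in semialg gX) (a%:E * (\1_B x)%:E + c%:E))%E =
    (a%:E * lebesgue_rV B + c%:E * lebesgue_rV (semialg gX))%E.
  rewrite ge0_integralD//.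
  - rewrite ge0_integralZl_EFin// integral_indic//; congr (_ * lebesgue_rV _ + _)%E.
      exact/setIidl.
    exact: (integral_cst _ mX).
  - by move=> x _; rewrite mule_ge0.
  - exact: measurable_funeM.
apply: ge0_le_integral => //.
- exact: measurable_pevalE.
- by apply: emeasurable_funD => //; exact: measurable_funeM.
- move=> x Xx; rewrite -EFinM -EFinD lee_fin indicE.
  have [/set_mem/wB|/negP Bx] := boolP (x \in B); first by rewrite mulr1.
  by rewrite mulr0 add0r; apply: wX => // Bx'; apply: Bx; rewrite inE.
Qed.

End objective.

(** * Near-optimal feasible pairs and the optimal gap *)

Section approximation.
Context {R : realType} {n m nX nU : nat}.
Variables (f : 'I_n -> {mpoly R[n + m]}).
Variables (gX : 'I_nX -> {mpoly R[n]}) (gU : 'I_nU -> {mpoly R[m]}).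
Variables (T : time_setting R) (i : 'I_nX) (j : 'I_nU) (rX rU : R).
Hypotheses (hT : valid_discount T) (cU : compact (semialg gU)).
Hypotheses (gXi : gX i = ball_poly n rX) (gUj : gU j = ball_poly m rU).

Local Notation X := (semialg gX).
Local Notation U := (semialg gU).
Local Notation XI := (max_controlled_invariant T f X U).

Let X_le x : X x -> `|x| <= `|rX|.
Proof. by move=> /(_ i); rewrite gXi; exact: ball_poly_norm_le. Qed.

Let U_le u : U u -> `|u| <= `|rU|.
Proof. by move=> /(_ j); rewrite gUj; exact: ball_poly_norm_le. Qed.

Lemma invariant_sub_state : XI `<=` X.
Proof.
case: (T) => [a|b] x /=; first by move=> [y [u [<- /(_ 0%N)[]]]].
by move=> [y [<- _ _ h]]; exact: h.
Qed.

Lemma invariant_peval_ge0 v :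
  (forall x u, X x -> U u -> 0 <= peval (Lop T f v) (row_mx x u)) ->
  forall x, XI x -> 0 <= peval v x.
Proof.
case: (T) hT => [a|b] ht hv.
  exact: (discrete_invariance X_le ht hv).
exact: (continuous_invariance X_le ht hv).
Qed.

Let measX : measurable X := measurable_semialg gX.

Let X_lty : (lebesgue_rV X < +oo)%E.
Proof. exact: lebesgue_rV_bounded_lty (normr_ge0 rX) measX X_le. Qed.

(** On the invariant set every P_l is nonnegative; a point where P_l > -1 infinitely often is
    invariant. Hence the invariant set is an upper limit of measurable sets, which gives its
    measurability and continuity from above. *)
Lemma invariant_limsup : exists P : nat -> {mpoly R[n]},
  [/\ forall l x u, X x -> U u -> 0 < peval (Lop T f (P l)) (row_mx x u),
      forall l x, X x -> peval (P l) x <= l.+1%:R^-1 &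
      XI = \bigcap_N \bigcup_(l in [set l | (N <= l)%N]) [set x | X x /\ - 1 < peval (P l) x]].
Proof.
have [P [LP PX PI]] := subsolution_sequence f (normr_ge0 rX) X_le U_le cU hT.
exists P; split=> //; apply/seteqP; split=> x.
  move=> XIx N _; exists N => /=; first by rewrite leqnn.
  split; first exact: invariant_sub_state.
  apply: lt_le_trans (invariant_peval_ge0 _ XIx); first by rewrite oppr_lt0.
  by move=> y u Xy Uu; exact/ltW/LP.
move=> h; have [l _ [Xx _]] := h 0%N I.
by apply: PI => // N; have [k Nk [_ Pk]] := h N I; exists k.
Qed.

Lemma measurable_superlevel (P : {mpoly R[n]}) : measurable [set x | X x /\ - 1 < peval P x].
Proof.
rewrite (_ : mkset _ = X `\` [set x | 0 <= peval (- P - 1) x]).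
  by apply: measurableD => //; exact: measurable_peval_ge0.
apply/seteqP; split=> x /= [Xx]; rewrite pevalB pevalN peval1 => h; split=> //.
  by apply/negP; rewrite -ltNge; move: h; lra.
by move/negP: h; rewrite -ltNge; lra.
Qed.

(* The upper bound [w] of the dual problem approximates max(P + 1, 0), whose
   integral over X is close to the measure of the invariant set. *)
Lemma max_peval_approx (P : {mpoly R[n]}) (d : R) : 0 < d -> exists w : {mpoly R[n]},
  forall x, X x -> d <= peval w x - Num.max 0 (peval P x + 1) <= 3 * d.
Proof.
move=> d0; have [L [K [L0 K0 _ hL]]] := peval_lipschitz_box P (`|rX| + 1).
have r0 : 0 < `|rX| + 1 by rewrite ltr_wpDl.
have [x y xr yr|Q hQ] := @lipschitz_poly_approx _ n (fun x => Num.max 0 (peval P x + 1)) _ _ _ r0 L0 d0.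
  apply: (le_trans (normB_max_le 0 _ _)).
  by rewrite opprD addrACA subrr addr0; exact: hL.
exists (Q + mpolyC n (2 * d)) => x /X_le xr.
have := hQ x; rewrite (le_trans xr) ?lerDl// => /(_ isT).
rewrite pevalD pevalC ler_norml => /andP[h1 h2]; apply/andP; split; lra.
Qed.

Lemma measurable_invariant : measurable XI.
Proof.
have [P [_ _ ->]] := invariant_limsup.
apply: bigcap_measurable => [|N _]; first by exists 0%N.
by apply: bigcup_measurable => l _; exact: measurable_superlevel.
Qed.

(** The pair is P_l and an approximation w of max(P_l + 1, 0) from above. On B_l, w <= 1 + 1 / (l +
    1) + 3 d, and w <= 3 d elsewhere on X. *)
Lemma near_optimal_feasible (e : R) : 0 < e -> exists K, forall k, (K <= k)%N ->
  exists v w : {mpoly R[n]}, dual_feasible T f gX gU k v w /\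
    (dual_objective gX w <= lebesgue_rV XI + e%:E)%E.
Proof.
move=> e0; have [P [LP PX PI]] := invariant_limsup.
have mXI := measurable_invariant.
pose B N := \bigcup_(l in [set l | (N <= l)%N]) [set x | X x /\ - 1 < peval (P l) x].
have BX N : B N `<=` X by move=> x [l _ []].
have mB N : measurable (B N).
  by apply: bigcup_measurable => l _; exact: measurable_superlevel.
pose S := fine (lebesgue_rV X).
have SE : lebesgue_rV X = S%:E by rewrite fineK// ge0_fin_numE.
have S0 : 0 <= S by exact: fine_ge0.
have fin A : measurable A -> A `<=` X -> lebesgue_rV A = (fine (lebesgue_rV A))%:E.
  move=> mA AX; rewrite fineK// ge0_fin_numE//; apply: le_lt_trans X_lty.
  by apply: le_measure; rewrite ?inE.
have cvgB : (@lebesgue_rV R n \o B) N @[N --> \oo] --> lebesgue_rV XI.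
  rewrite PI; apply: nonincreasing_cvg_mu => //.
  - by apply: le_lt_trans X_lty; apply: le_measure; rewrite ?inE.
  - by rewrite -PI.
  - by move=> a b ab; apply/subsetPset => x [l /= bl h]; exists l => //=; exact: leq_trans bl.
have e3 : 0 < e / 3 by rewrite divr_gt0.
rewrite (fin _ mXI invariant_sub_state) in cvgB.
have /fine_cvgP[_ /cvgrPdist_lt/(_ _ e3)[N1 _ hN1]] := cvgB.
have [N2 hN2] := divn_small S e3.
(* One index making both the excess measure of B_l and S / (l + 1) less than e / 3; d below provides
   the last third. *)
pose l := maxn N1 N2.
have /= h1 := hN1 l (leq_maxl _ _); have h2 := hN2 l (leq_maxr _ _).
pose d := e / 9 / (S + 1).
have S1 : 0 < S + 1 by rewrite ltr_wpDl.
have d0 : 0 < d by rewrite !divr_gt0.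
have [w hw] := max_peval_approx (P l) d0.
have w0 x : X x -> 0 < peval w x.
  move=> Xx; have /andP[h _] := hw x Xx.
  have : 0 <= Num.max 0 (peval (P l) x + 1) by rewrite le_max lexx.
  by move: h d0; lra.
have [K1 hK1] := cert_xu_eventually gXi gUj (LP l).
have [K2 hK2] : exists K2, forall k, (K2 <= k)%N -> cert_x gX k (w - P l - 1).
  apply: (cert_x_eventually gXi) => x Xx; rewrite !pevalB peval1.
  have /andP[h _] := hw x Xx.
  have : peval (P l) x + 1 <= Num.max 0 (peval (P l) x + 1) by rewrite le_max lexx orbT.
  by move: h d0; lra.
have [K3 hK3] := cert_x_eventually gXi w0.
(* Large enough for the three certificates and for the degree bound 2 k on both polynomials. *)
exists (K1 + K2 + K3 + mpdeg (P l) + mpdeg w)%N => k Kk.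
exists (P l), w; split.
  by split; [lia|lia|apply: hK1; lia|apply: hK2; lia|apply: hK3; lia].
have a0 : 0 <= 1 + l.+1%:R^-1 :> R by rewrite addr_ge0// invr_ge0.
have c0 : 0 <= 3 * d by rewrite mulr_ge0// ltW.
apply: le_trans (objective_le (mB l) (BX l) a0 c0 (fun x Xx => ltW (w0 x Xx)) _ _) _.
- move=> x Bx; have Xx := BX _ _ Bx; have /andP[_ h] := hw x Xx.
  have : Num.max 0 (peval (P l) x + 1) <= 1 + l.+1%:R^-1.
    by rewrite ge_max a0 addrC lerD2l PX.
  by move: h; rewrite lerBlDl => h h'; apply: (le_trans h); rewrite lerD2r.
- move=> x Xx Bx; have /andP[_ h] := hw x Xx; move: h; rewrite max_l ?subr0//.
  rewrite -lerBrDr sub0r leNgt; apply/negP => Px; apply: Bx.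
  by exists l => //=; rewrite leqnn.
rewrite SE (fin _ (mB l) (BX l)) (fin _ mXI invariant_sub_state) -!EFinM -!EFinD lee_fin.
set b := fine _; move: h1; rewrite -/b ltr_norml => /andP[h1 _].
have bS : b <= S.
  by rewrite -lee_fin -(fin _ (mB l) (BX l)) -SE; apply: le_measure; rewrite ?inE.
have h3 : l.+1%:R^-1 * b <= e / 3.
  by apply: le_trans (ltW h2); rewrite mulrC ler_wpM2r.
have h4 : 3 * d * S <= e / 3.
  have : d * S <= e / 9.
    rewrite /d -mulrA -[leRHS]mulr1 ler_pM2l ?divr_gt0// ler_pdivrMl// mulr1.
    by rewrite lerDl.
  by lra.
rewrite mulrDl mul1r; move: (_ * b) h3 => c h3; move: h1 h3 h4; lra.
Qed.

Lemma optimal_gap (e : R) : 0 < e -> exists K, forall k, (K <= k)%N ->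
  forall v w, dual_optimal T f gX gU k v w ->
  (lebesgue_rV (outer_set gX v `\` XI) <= e%:E)%E.
Proof.
move=> e0; have [K hK] := near_optimal_feasible e0.
exists K => k Kk v w [[_ _ Lv wv w0] opt].
have [v' [w' [fe obj]]] := hK k Kk.
have mXI := measurable_invariant; have mO := measurable_outer_set gX v.
have OX : outer_set gX v `<=` X by move=> x [].
have O_lty : (lebesgue_rV (outer_set gX v) < +oo)%E.
  by apply: le_lt_trans X_lty; apply: le_measure; rewrite ?inE.
have XIO : XI `<=` outer_set gX v.
  move=> x XIx; split; first exact: invariant_sub_state.
  apply: invariant_peval_ge0 XIx => y u Xy Uu; exact: cert_xu_peval_ge0 Lv _ _.
rewrite (measureD mO mXI O_lty) (setIidr XIO).
have XI_fin : lebesgue_rV XI \is a fin_num.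
  rewrite ge0_fin_numE//; apply: le_lt_trans O_lty.
  by apply: le_measure; rewrite ?inE.
rewrite leeBlDr// addeC; apply: le_trans obj; apply: le_trans (opt _ _ fe).
apply: outer_set_le_objective => [x Xx|x [Xx vx]]; first exact: cert_x_peval_ge0 w0 Xx.
by have := cert_x_peval_ge0 wv Xx; rewrite !pevalB peval1; move: vx; lra.
Qed.

End approximation.

Unset Implicit Arguments.

Theorem theorem7 (R : realType) (n m nX nU : nat)
    (f : 'I_n -> {mpoly R[n + m]})
    (gX : 'I_nX -> {mpoly R[n]}) (gU : 'I_nU -> {mpoly R[m]})
    (T : time_setting R) (v w : nat -> {mpoly R[n]}) :
  valid_discount T ->
  compact (semialg gX) ->
  compact (semialg gU) ->
  (exists (i : 'I_nX) (RX : R), gX i = ball_poly n RX) ->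
  (exists (i : 'I_nU) (RU : R), gU i = ball_poly m RU) ->
  (forall k : nat, (min_order gX gU <= k)%N ->
     dual_optimal T f gX gU k (v k) (w k)) ->
  let XI := max_controlled_invariant T f (semialg gX) (semialg gU) in
  [/\ forall k : nat, (min_order gX gU <= k)%N -> XI `<=` outer_set gX (v k),
      lebesgue_rV (outer_set gX (v k) `\` XI) @[k --> \oo] --> 0%E
    & lebesgue_rV
        ((\bigcap_(k in [set k : nat | (min_order gX gU <= k)%N])
            outer_set gX (v k)) `\` XI) = 0%E].

Proof.
move=> hT cX cU [i [rX gXi]] [j [rU gUj]] opt XI.
have gap (e : R) : 0 < e -> exists K, forall k, (K <= k)%N ->
    (min_order gX gU <= k)%N /\ (lebesgue_rV (outer_set gX (v k) `\` XI) <= e%:E)%E.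
  move=> e0; have [K hK] := optimal_gap f hT cU gXi gUj e0.
  exists (maxn K (min_order gX gU)) => k; rewrite geq_max => /andP[Kk kk]; split=> //.
  exact: hK (opt k kk).
have mXI : measurable XI := measurable_invariant f hT cU gXi gUj.
have mO k : measurable (outer_set gX (v k) `\` XI).
  by apply: measurableD => //; exact: measurable_outer_set.
split.
- move=> k kk x XIx; split; first exact: invariant_sub_state XIx.
  apply: (invariant_peval_ge0 hT gXi _ XIx) => y u Xy Uu.
  by have [[_ _ Lv _ _] _] := opt k kk; exact: cert_xu_peval_ge0 Lv _ _.
- apply/fine_cvgP; split.
    have [K hK] := gap 1 ltr01; exists K => // k /= /hK[_ h].
    by rewrite ge0_fin_numE//; apply: le_lt_trans h _; rewrite ltry.
  apply/cvgrPdist_le => e e0; have [K hK] := gap e e0; exists K => // k /= /hK[_ h].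
  rewrite sub0r normrN ger0_norm ?fine_ge0// -lee_fin fineK//.
  by rewrite ge0_fin_numE//; apply: le_lt_trans h _; rewrite ltry.
(* The intersection lies in a single outer set whose excess is at most e; nothing is required of the
   other orders. *)
- apply/eqP; rewrite eq_le measure_ge0 andbT; apply/lee_addgt0Pr => e e0.
  have [K hK] := gap e e0; have [kk h] := hK K (leqnn K).
  rewrite add0e; apply: le_trans h; apply: le_measure; rewrite ?inE//.
    apply: measurableD => //; apply: bigcap_measurable => [|k _]; first by exists K.
    exact: measurable_outer_set.
  by move=> x [h nXI]; split=> //; exact: h.
Qed.
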